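(* Assume that $I\in L^\infty(\Omega)$. Let $H_n\to H$ in $L^2(\Omega)$ as $n\to\infty$, and for each $n$ let $U_n\in K$ be a minimizer of $E(\,\cdot\,;H_n)$ over $K$. Then there exists a subsequence of $\{U_n\}$ which converges strongly in $L^1(\Omega)$ to a minimizer of $E(\,\cdot\,;H)$ over $K$.
   Context: $\Omega\subset\mathbb{R}^2$ is a bounded Lipschitz domain. For $U\in L^1(\Omega)$, the total variation is $\|U\|_{TV}=\sup\{\int_\Omega U\,\mathrm{div}\,\phi\,dx:\ \phi\in C_c^1(\Omega,\mathbb{R}^2),\ |\phi|\le 1\}$, and $BV(\Omega)=\{U\in L^1(\Omega):\|U\|_{TV}<\infty\}$. The admissible set is $K=\{U\in BV(\Omega):\ 0\le U(x)\le 1 \text{ for a.e. } x\in\Omega\}$ (real-valued functions). The kernels $H,H_n\in L^2(\Omega)$ may be complex-valued, and $I$ is real-valued. Convolution is $(H*U)(x)=\int_\Omega H(y)U(x-y)\,dy$ for $x\in\Omega$, where $U$ is extended by $0$ outside $\Omega$. For fixed real constants $a>0$ and $tr$, $Sig_a(t)=\dfrac{1}{1+\exp(-a(t-tr))}$ for $t\in\mathbb{R}$. With fixed constants $\beta_1,\beta_2>0$, define $$E(U;H)=\|Sig_a(|H*U|^2)-I\|_{L^2(\Omega)}^2+\beta_1\|U\|_{TV}+\beta_2\|U(1-U)\|_{L^1(\Omega)}.$$ *)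

(* Defs.v *)
From HB Require Import structures.
From mathcomp Require Import all_boot all_order all_algebra.
From mathcomp Require Import all_classical all_reals all_analysis.
From mathcomp.real_closed Require Import complex.

Set Implicit Arguments.
Unset Strict Implicit.
Unset Printing Implicit Defensive.

Import Order.TTheory GRing.Theory Num.Theory.
Import numFieldNormedType.Exports.

Local Open Scope classical_set_scope.
Local Open Scope ring_scope.

(* The plane is [R * R], with the product topology and the Borel sigma-algebra;
   every Lebesgue measurable function has a Borel representative, so the Lebesgue
   spaces below are the usual ones.
   Functions on a subset of the plane are total functions whose values outside
   the subset are never used; [f \_ A] is [f] on [A] and 0 elsewhere. *)

(* [measurableTypeR R] is [R] with the sigma-algebra generated by intervals. *)
Definition lebesgue2 (R : realType) :
    {measure set (measurableTypeR R * measurableTypeR R)%type -> \bar R} :=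
  (@lebesgue_measure R \x @lebesgue_measure R)%E.

Definition LpNorm (R : realType) (Omega : set (R * R)) (p : \bar R)
    (f : R * R -> R) : \bar R :=
  'N[lebesgue2 R]_p[EFin \o (f \_ Omega)]%E.

Definition memLp (R : realType) (Omega : set (R * R)) (p : \bar R)
    (f : R * R -> R) : Prop :=
  measurable_fun Omega f /\ (LpNorm Omega p f < +oo)%E.

Definition complexLpNorm (R : realType) (Omega : set (R * R)) (p : \bar R)
    (f : R * R -> R[i]) : \bar R :=
  LpNorm Omega p (fun x => Normc.normc (f x)).

Definition complexMemLp (R : realType) (Omega : set (R * R)) (p : \bar R)
    (f : R * R -> R[i]) : Prop :=
  [/\ measurable_fun Omega (fun x => complex.Re (f x)),
      measurable_fun Omega (fun x => complex.Im (f x)) &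
      (complexLpNorm Omega p f < +oo)%E].

(* Near each boundary point, in coordinates [(t, u)] obtained by a rotation of
   cosine [c] and sine [s], the set is the strict epigraph of a Lipschitz
   function. Reflections are not needed: the subgraph [u < g t] becomes an
   epigraph after a rotation by a half-turn. *)
Definition lipschitz_boundary (R : realType) (Omega : set (R * R)) : Prop :=
  forall p : R * R, (closure Omega `\` interior Omega) p ->
  exists (c s r : R) (g : R -> R),
    [/\ c ^+ 2 + s ^+ 2 = 1, 0 < r, lipschitz g &
        forall y : R * R, ball p r y ->
          (Omega y <-> g (c * y.1 + s * y.2) < - s * y.1 + c * y.2)].

Definition bounded_lipschitz_domain (R : realType) (Omega : set (R * R)) : Prop :=
  [/\ open Omega, connected Omega, Omega !=set0, bounded_set Omega &
      lipschitz_boundary Omega].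

Definition e1 (R : realType) : R * R := (1, 0).
Definition e2 (R : realType) : R * R := (0, 1).

Definition C1 (R : realType) (f : R * R -> R) : Prop :=
  [/\ forall x, derivable f x (e1 R), forall x, derivable f x (e2 R),
      continuous ('D_(e1 R) f) & continuous ('D_(e2 R) f)].

Definition divergence (R : realType) (phi : R * R -> R * R) (x : R * R) : R :=
  'D_(e1 R) (fun y => (phi y).1) x + 'D_(e2 R) (fun y => (phi y).2) x.

(* A field in C^1_c(Omega, R^2) is identified with its extension by zero to the
   plane. The norm of the library on [R * R] is the maximum norm, hence the
   explicit Euclidean bound. *)
Definition test_field (R : realType) (Omega : set (R * R))
    (phi : R * R -> R * R) : Prop :=
  [/\ C1 (fun x => (phi x).1), C1 (fun x => (phi x).2),
      compact (closure [set x | phi x != 0]),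
      closure [set x | phi x != 0] `<=` Omega &
      forall x, Num.sqrt ((phi x).1 ^+ 2 + (phi x).2 ^+ 2) <= 1].

Definition TV (R : realType) (Omega : set (R * R)) (U : R * R -> R) : \bar R :=
  ereal_sup [set (\int[lebesgue2 R]_(x in Omega) (U x * divergence phi x)%:E)%E
            | phi in test_field Omega].

Definition BV (R : realType) (Omega : set (R * R)) : set (R * R -> R) :=
  [set U | memLp Omega 1%E U /\ (TV Omega U < +oo)%E].

Definition K (R : realType) (Omega : set (R * R)) : set (R * R -> R) :=
  [set U | BV Omega U /\
           {ae lebesgue2 R, forall x, Omega x -> 0 <= U x <= 1}].

Definition convolution (R : realType) (Omega : set (R * R))
    (H : R * R -> R[i]) (U : R * R -> R) (x : R * R) : R[i] :=
  Complex
    (\int[lebesgue2 R]_(y in Omega) (complex.Re (H y) * (U \_ Omega) (x - y)))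
    (\int[lebesgue2 R]_(y in Omega) (complex.Im (H y) * (U \_ Omega) (x - y))).

Definition Sig (R : realType) (a tr t : R) : R :=
  1 / (1 + expR (- a * (t - tr))).

Definition energy (R : realType) (Omega : set (R * R)) (a tr beta1 beta2 : R)
    (I : R * R -> R) (U : R * R -> R) (H : R * R -> R[i]) : \bar R :=
  (LpNorm Omega 2%:E
     (fun x => (Sig a tr (Normc.normc (convolution Omega H U x) ^+ 2) - I x)%R)
     ^+ 2
   + beta1%:E * TV Omega U
   + beta2%:E * LpNorm Omega 1 (fun x => (U x * (1 - U x))%R))%E.

Definition is_minimizer (T : Type) (R : realType) (A : set T) (F : T -> \bar R)
    (u : T) : Prop :=
  A u /\ forall v, A v -> (F u <= F v)%E.

(* Main.v *)
(* The direct method. Comparing with the zero function bounds [TV (U_ n)]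
   uniformly in n. On a rectangle P of sides w and h, the Poincare inequality
   "integral over P of |U - mean of U| <= (w + h) TV(P, U)" follows from repeated
   bisection: cutting P in two costs half a side times TV(P, U), as one sees by
   testing with smooth approximations of tents; the total variation is
   superadditive; and the oscillation summed over finer and finer pieces tends
   to 0. Along an ultrafilter on nat all the integrals over rectangles converge,
   so by the Poincare inequality the U_n are Cauchy in L^1 on each rectangle, and
   then on Omega, because they take values in [0, 1] and Omega is a countable
   union of rectangles. A fast Cauchy subsequence converges in L^1. Along it the
   convolutions converge pointwise, so the fidelity terms converge by bounded
   convergence, the last term of the energy is L^1-continuous, and the total
   variation is lower semicontinuous; minimality passes to the limit. *)
From HB Require Import structures.
Require Import Defs.
From mathcomp Require Import all_boot all_order all_algebra.
From mathcomp Require Import all_classical all_reals all_analysis.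
From mathcomp.real_closed Require Import complex.
From mathcomp Require Import measurable_realfun ess_sup_inf ring lra.

Set Implicit Arguments.
Unset Strict Implicit.
Unset Printing Implicit Defensive.

Import Order.TTheory GRing.Theory Num.Theory.
Import numFieldNormedType.Exports.

Local Open Scope classical_set_scope.
Local Open Scope ring_scope.

(** * Oscillation of bounded measurable functions *)

(** The total variation is accessible only by duality with [C^1] fields, so no function of [K] is
    ever differentiated or mollified: each estimate comes from inserting an explicit field. The
    ideal field for comparing two halves of a rectangle has a tent profile, which is only Lipschitz;
    hence the rational smoothings of tents and of indicators, and a passage to the limit inside the
    divergence. The constant [w + h] sums a geometric series: quartering a rectangle costs
    [(w + h) / 2] times its variation, and the quarters have halved sides. That the oscillation over
    fine pieces vanishes for every measurable function with values in [0, 1] is reached by a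
    sigma-algebra argument starting from half-planes, followed by an expansion in binary digits. The
    ultrafilter stands in for a diagonal extraction: a single filter serves all the pieces of all
    the subdivisions. Membership in [K] constrains values almost everywhere on [Omega] only.
    Minimizers are exchanged for representatives with values in [0, 1] everywhere and 0 off [Omega];
    the energy does not change, because each convolution is the same at every point. *)

Definition bounded_mfun d (T : measurableType d) (R : realType)
    (f : T -> R) : Prop :=
  measurable_fun [set: T] f /\ exists M, forall x, `|f x| <= M.

Section bounded_mfun.
Context {d} {T : measurableType d} {R : realType}.
Implicit Types (f g : T -> R) (D : set T).

Lemma bounded_mfun_cst (c : R) : bounded_mfun (fun _ : T => c).
Proof. by split=> //; exists `|c|. Qed.

Lemma bounded_mfunD f g : bounded_mfun f -> bounded_mfun g ->
  bounded_mfun (fun x => f x + g x).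
Proof.
move=> [mf [M fM]] [mg [N gN]]; split; first exact: measurable_funD.
by exists (M + N) => x; rewrite (le_trans (ler_normD _ _))// lerD.
Qed.

Lemma bounded_mfunM f g : bounded_mfun f -> bounded_mfun g ->
  bounded_mfun (fun x => f x * g x).
Proof.
move=> [mf [M fM]] [mg [N gN]]; split; first exact: measurable_funM.
by exists (M * N) => x; rewrite normrM ler_pM.
Qed.

Lemma bounded_mfunZ c f : bounded_mfun f ->
  bounded_mfun (fun x => c * f x).
Proof. exact/bounded_mfunM/bounded_mfun_cst. Qed.

Lemma bounded_mfunN f : bounded_mfun f -> bounded_mfun (fun x => - f x).
Proof.
by move=> [mf [M fM]]; split; [exact: measurable_funN|exists M => x; rewrite normrN].
Qed.

Lemma bounded_mfunB f g : bounded_mfun f -> bounded_mfun g ->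
  bounded_mfun (fun x => f x - g x).
Proof. by move=> bf bg; apply: bounded_mfunD => //; exact: bounded_mfunN. Qed.

Lemma bounded_mfun_norm f : bounded_mfun f ->
  bounded_mfun (fun x => `|f x|).
Proof.
move=> [mf [M fM]]; split; first exact: measurableT_comp.
by exists M => x; rewrite normr_id.
Qed.

Lemma bounded_mfun_indic (A : set T) : measurable A -> bounded_mfun (\1_A : T -> R).
Proof.
move=> mA; split; first exact: measurable_indic.
by exists 1 => x; rewrite indicE; case: (x \in A); rewrite ?normr1// normr0.
Qed.

Variable mu : {measure set T -> \bar R}.

Lemma bounded_mfun_integrable D f : measurable D -> (mu D < +oo)%E ->
  bounded_mfun f -> mu.-integrable D (EFin \o f).
Proof.
move=> mD Dfin [mf [M fM]].
apply: (measurable_bounded_integrable mD Dfin).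
  exact: measurable_funTS.
by exists M; split; [exact: num_real|move=> N MN x _ /=]; apply: le_trans (fM x) (ltW MN).
Qed.

End bounded_mfun.

#[global] Hint Extern 0 (bounded_mfun (fun _ => _)) => exact: bounded_mfun_cst : core.

Section oscillation.
Context {d} {T : measurableType d} {R : realType}.
Variable mu : {measure set T -> \bar R}.
Implicit Types (f g : T -> R) (D : set T).

Definition finite_mset D := measurable D /\ (mu D < +oo)%E.

(** A null [D] gets average 0, since division by zero returns 0; the proofs below that divide by
    [mu D] treat this case apart. *)
Definition average D f : R := (\int[mu]_(x in D) f x) / fine (mu D).

Definition oscillation D f : R := \int[mu]_(x in D) `|f x - average D f|.

Lemma Rint_ge0 D f : (forall x, 0 <= f x) -> 0 <= \int[mu]_(x in D) f x.
Proof. by move=> f0; apply: Rintegral_ge0. Qed.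

Lemma ler_Rint D f g : finite_mset D -> bounded_mfun f ->
  bounded_mfun g -> (forall x, D x -> f x <= g x) ->
  \int[mu]_(x in D) f x <= \int[mu]_(x in D) g x.
Proof.
by move=> [mD Dfin] bf bg fg; apply: le_Rintegral => //;
  exact: bounded_mfun_integrable.
Qed.

Lemma RintD D f g : finite_mset D -> bounded_mfun f ->
  bounded_mfun g ->
  \int[mu]_(x in D) (f x + g x) = \int[mu]_(x in D) f x + \int[mu]_(x in D) g x.
Proof.
by move=> [mD Dfin] bf bg; apply: RintegralD => //; exact: bounded_mfun_integrable.
Qed.

Lemma RintB D f g : finite_mset D -> bounded_mfun f ->
  bounded_mfun g ->
  \int[mu]_(x in D) (f x - g x) = \int[mu]_(x in D) f x - \int[mu]_(x in D) g x.
Proof.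
by move=> [mD Dfin] bf bg; apply: RintegralB => //; exact: bounded_mfun_integrable.
Qed.

Lemma RintZ D f c : finite_mset D -> bounded_mfun f ->
  \int[mu]_(x in D) (c * f x) = c * \int[mu]_(x in D) f x.
Proof.
by move=> [mD Dfin] bf; apply: RintegralZl => //; exact: bounded_mfun_integrable.
Qed.

Lemma Rint_cst D c : finite_mset D -> \int[mu]_(x in D) c = c * fine (mu D).
Proof. by move=> [mD _]; rewrite Rintegral_cst. Qed.

Lemma ler_norm_Rint D f : finite_mset D -> bounded_mfun f ->
  `|\int[mu]_(x in D) f x| <= \int[mu]_(x in D) `|f x|.
Proof.
by move=> [mD Dfin] bf; apply: le_normr_Rintegral => //;
  exact: bounded_mfun_integrable.
Qed.

Lemma oscillation_ge0 D f : 0 <= oscillation D f.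
Proof. exact: Rint_ge0. Qed.

Lemma measure_norm_average D f c : finite_mset D -> bounded_mfun f ->
  fine (mu D) * `|average D f - c| <= \int[mu]_(x in D) `|f x - c|.
Proof.
move=> fD bf; have bfc : bounded_mfun (fun x => f x - c).
  exact: bounded_mfunB.
have [D0|D0] := eqVneq (fine (mu D)) 0; first by rewrite D0 mul0r Rint_ge0.
have D0' : 0 < fine (mu D) by rewrite lt_neqAle eq_sym D0 fine_ge0.
apply: le_trans (ler_norm_Rint fD bfc).
rewrite RintB// Rint_cst// -{1}(ger0_norm (ltW D0')) -normrM.
by rewrite /average mulrBr mulrC divfK// (mulrC c).
Qed.

(** Up to a factor 2 the average is the best constant in L^1: its distance to [c] is itself
    controlled by the deviation of [f] from [c]. Oscillations may thus be estimated against any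
    convenient constant. *)
Lemma oscillation_le D f c : finite_mset D -> bounded_mfun f ->
  oscillation D f <= 2 * \int[mu]_(x in D) `|f x - c|.
Proof.
move=> fD bf; rewrite mulr_natl mulr2n.
apply: le_trans (_ : \int[mu]_(x in D) (`|f x - c| + `|c - average D f|) <= _).
  apply: ler_Rint => //; [|apply: bounded_mfunD => //|].
  - exact/bounded_mfun_norm/bounded_mfunB.
  - exact/bounded_mfun_norm/bounded_mfunB.
  by move=> x _; rewrite ler_distD.
rewrite RintD//; last exact/bounded_mfun_norm/bounded_mfunB.
by rewrite lerD2l Rint_cst// mulrC distrC measure_norm_average.
Qed.

Lemma oscillationD D f g : finite_mset D ->
  bounded_mfun f -> bounded_mfun g ->
  oscillation D (fun x => f x + g x) <= oscillation D f + oscillation D g.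
Proof.
move=> fD bf bg; rewrite /oscillation -RintD//; last 2 first.
  exact/bounded_mfun_norm/bounded_mfunB.
  exact/bounded_mfun_norm/bounded_mfunB.
apply: ler_Rint => //.
- exact/bounded_mfun_norm/bounded_mfunB/bounded_mfun_cst/bounded_mfunD.
- by apply: bounded_mfunD; exact/bounded_mfun_norm/bounded_mfunB.
move=> x _; rewrite /average RintD// mulrDl opprD addrACA.
exact: ler_normD.
Qed.

Lemma oscillationZ D f c : finite_mset D -> bounded_mfun f ->
  oscillation D (fun x => c * f x) = `|c| * oscillation D f.
Proof.
move=> fD bf; rewrite /oscillation -RintZ//; last first.
  exact/bounded_mfun_norm/bounded_mfunB.
apply: eq_Rintegral => x _.
by rewrite /average RintZ// -mulrA -mulrBr normrM.
Qed.

Lemma oscillation_cst D c : finite_mset D -> oscillation D (fun=> c) = 0.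
Proof.
move=> fD; apply/eqP; rewrite eq_le oscillation_ge0 andbT.
apply: le_trans (oscillation_le c fD (bounded_mfun_cst c)) _.
by under eq_Rintegral do rewrite subrr normr0; rewrite Rint_cst// mul0r mulr0.
Qed.

Lemma eq_oscillation D f g : {in D, f =1 g} -> oscillation D f = oscillation D g.
Proof.
move=> fg; rewrite /oscillation; have -> : average D f = average D g.
  by rewrite /average (eq_Rintegral mu fg).
by apply: eq_Rintegral => x Dx; rewrite fg.
Qed.

(** With averages [p] and [q], [f g - p q = (f - p) g + p (g - q)], where [g] and [p] are bounded by
    1. The factor 2 pays for using [p q] in place of the average of the product. *)
Lemma oscillationM D f g : finite_mset D ->
  bounded_mfun f -> bounded_mfun g ->
  (forall x, `|f x| <= 1) -> (forall x, `|g x| <= 1) ->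
  oscillation D (fun x => f x * g x) <= 2 * (oscillation D f + oscillation D g).
Proof.
move=> fD bf bg f1 g1.
have avg1 : `|average D f| <= 1.
  have [D0|D0] := eqVneq (fine (mu D)) 0.
    by rewrite /average D0 invr0 mulr0 normr0.
  have D0' : 0 < fine (mu D) by rewrite lt_neqAle eq_sym D0 fine_ge0.
  rewrite /average normrM normfV (ger0_norm (ltW D0')) ler_pdivrMr// mul1r.
  apply: le_trans (ler_norm_Rint fD bf) _.
  apply: le_trans (_ : \int[mu]_(x in D) 1 <= _); last by rewrite Rint_cst// mul1r.
  by apply: ler_Rint => //; exact: bounded_mfun_norm.
apply: le_trans (oscillation_le (average D f * average D g) fD _) _.
  exact: bounded_mfunM.
rewrite ler_pM2l// /oscillation -RintD//; last 2 first.
  exact/bounded_mfun_norm/bounded_mfunB.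
  exact/bounded_mfun_norm/bounded_mfunB.
apply: ler_Rint => //.
- exact/bounded_mfun_norm/bounded_mfunB/bounded_mfun_cst/bounded_mfunM.
- by apply: bounded_mfunD; exact/bounded_mfun_norm/bounded_mfunB.
move=> x _; move: (average D f) (average D g) avg1 => p q p1.
have -> : f x * g x - p * q = (f x - p) * g x + p * (g x - q) by ring.
rewrite (le_trans (ler_normD _ _))// !normrM lerD//.
  by rewrite ler_piMr.
by rewrite ler_piMl.
Qed.

Lemma RintU (D1 D2 : set T) f : finite_mset D1 -> finite_mset D2 ->
  [disjoint D1 & D2] -> bounded_mfun f ->
  \int[mu]_(x in D1 `|` D2) f x = \int[mu]_(x in D1) f x + \int[mu]_(x in D2) f x.
Proof.
move=> [mD1 D1fin] [mD2 D2fin] D12 bf; apply: Rintegral_setU => //.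
apply: bounded_mfun_integrable => //; first exact: measurableU.
by rewrite (le_lt_trans (measureU2 mu mD1 mD2))// lte_add_pinfty.
Qed.

Lemma finite_msetU (D1 D2 : set T) : finite_mset D1 -> finite_mset D2 ->
  finite_mset (D1 `|` D2).
Proof.
move=> [mD1 D1fin] [mD2 D2fin]; split; first exact: measurableU.
by rewrite (le_lt_trans (measureU2 mu mD1 mD2))// lte_add_pinfty.
Qed.

(** As the pieces have equal measure, the overall average is the midpoint of the two averages, at
    distance [|i1 - i2| / (2 mu D1)] from each. Passing from a local average to the overall one
    costs [|i1 - i2| / 2] on each piece. *)
Lemma oscillationU (D1 D2 : set T) f : finite_mset D1 -> finite_mset D2 ->
  [disjoint D1 & D2] -> mu D1 = mu D2 -> bounded_mfun f ->
  oscillation (D1 `|` D2) f <= oscillation D1 f + oscillation D2 f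
    + `|\int[mu]_(x in D1) f x - \int[mu]_(x in D2) f x|.
Proof.
move=> f1 f2 D12 muE bf.
have fU := finite_msetU f1 f2.
set m := average (D1 `|` D2) f.
set i1 := \int[mu]_(x in D1) f x; set i2 := \int[mu]_(x in D2) f x.
have muU : fine (mu (D1 `|` D2)) = 2 * fine (mu D1).
  have D0 : D1 `&` D2 = set0 by apply/disj_set2P.
  have D1fin : (mu D1 \is a fin_num)%E by rewrite ge0_fin_numE//; exact: f1.2.
  have -> : mu (D1 `|` D2) = (mu D1 + mu D2)%E.
    by apply: measureU => //; [exact: f1.1|exact: f2.1].
  rewrite -muE fineD//.
  by rewrite mulr_natl mulr2n.
rewrite {1}/oscillation RintU//; last exact/bounded_mfun_norm/bounded_mfunB.
have half D i : finite_mset D -> i = \int[mu]_(x in D) f x ->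
    mu D = mu D1 -> (i = i1 \/ i = i2) ->
    \int[mu]_(x in D) `|f x - m| <= oscillation D f + `|i1 - i2| / 2.
  move=> fD iE DE ii.
  apply: le_trans (_ : \int[mu]_(x in D) (`|f x - average D f| +
      `|average D f - m|) <= _).
    apply: ler_Rint => //.
    - exact/bounded_mfun_norm/bounded_mfunB.
    - by apply: bounded_mfunD => //; exact/bounded_mfun_norm/bounded_mfunB.
    by move=> x _; rewrite ler_distD.
  rewrite RintD//; last exact/bounded_mfun_norm/bounded_mfunB.
  rewrite lerD2l Rint_cst// /average -iE DE /m /average muU RintU// -/i1 -/i2.
  have [D0|D0] := eqVneq (fine (mu D1)) 0.
    by rewrite D0 mulr0 divr_ge0.
  have D0' : 0 < fine (mu D1) by rewrite lt_neqAle eq_sym D0 fine_ge0.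
  have nmul y : `|y| * fine (mu D1) = `|y * fine (mu D1)|.
    by rewrite normrM (ger0_norm (ltW D0')).
  rewrite nmul.
  have -> : (i / fine (mu D1) - (i1 + i2) / (2 * fine (mu D1))) * fine (mu D1) =
     i - (i1 + i2) / 2 by field.
  case: ii => ->.
  - have -> : i1 - (i1 + i2) / 2 = (i1 - i2) / 2 by field.
    by rewrite normrM (@ger0_norm _ 2^-1).
  - have -> : i2 - (i1 + i2) / 2 = - ((i1 - i2) / 2) by field.
    by rewrite normrN normrM (@ger0_norm _ 2^-1).
have h1 := half D1 i1 f1 erefl erefl (or_introl erefl).
have h2 := half D2 i2 f2 erefl (esym muE) (or_intror erefl).
lra.
Qed.

End oscillation.

(** * Dyadic subdivisions of a rectangle *)

Section rectangles.
Context {R : realType}.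
Local Notation plane := (measurableTypeR R * measurableTypeR R)%type.
Local Notation mu := (lebesgue2 R).

(** Half-open sides make a cut along a line an exact partition. *)
Definition rect (a b c d : R) : set plane := `[a, b[%classic `*` `[c, d[%classic.

Lemma rectE a b c d (x : plane) :
  rect a b c d x <-> (a <= x.1 < b) && (c <= x.2 < d).
Proof. by rewrite /rect /= !in_itv /=; split=> [[-> ->]|/andP[]]. Qed.

Lemma measurable_rect a b c d : measurable (rect a b c d).
Proof. by apply: measurableX; exact: measurable_itv. Qed.

Lemma lebesgue2X (A B : set (measurableTypeR R)) : measurable A -> measurable B ->
  mu (A `*` B) = (@lebesgue_measure R A * @lebesgue_measure R B)%E.
Proof. by move=> mA mB; exact: product_measure1E. Qed.

Lemma lebesgue2_rect a b c d : a <= b -> c <= d ->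
  mu (rect a b c d) = ((b - a) * (d - c))%:E.
Proof.
have lenE (u v : R) : u <= v -> @lebesgue_measure R `[u, v[%classic = (v - u)%:E.
  rewrite le_eqVlt lebesgue_measure_itv /= lte_fin EFinB => /predU1P[->|->//].
  by rewrite ltxx subee.
move=> ab cd; rewrite lebesgue2X; [|exact: measurable_itv..].
by rewrite !lenE.
Qed.

Lemma finite_mset_rect a b c d : a <= b -> c <= d -> finite_mset mu (rect a b c d).
Proof.
move=> ab cd; split; first exact: measurable_rect.
by rewrite lebesgue2_rect// ltry.
Qed.

Lemma rect_splitl a b c d m : a <= m -> m <= b ->
  rect a b c d = rect a m c d `|` rect m b c d.
Proof.
move=> am mb; apply/seteqP; split=> x; rewrite /setU /= !rectE.
  by case: (ltP x.1 m) => h /andP[/andP[h1 h2] h3]; [left|right];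
     rewrite h3 ?h1 ?h2 ?andbT.
by case=> /andP[/andP[h1 h2] h3]; rewrite h3 andbT;
  [rewrite h1 (lt_le_trans h2)|rewrite h2 (le_trans am)].
Qed.

Lemma rect_splitr a b c d m : c <= m -> m <= d ->
  rect a b c d = rect a b c m `|` rect a b m d.
Proof.
move=> am mb; apply/seteqP; split=> x; rewrite /setU /= !rectE.
  by case: (ltP x.2 m) => h /andP[h3 /andP[h1 h2]]; [left|right];
     rewrite h3 ?h1 ?h2 ?andbT.
by case=> /andP[h3 /andP[h1 h2]]; rewrite h3 /=;
  [rewrite h1 (lt_le_trans h2)|rewrite h2 (le_trans am)].
Qed.

Lemma rect_disjointl a b c d m : [disjoint rect a m c d & rect m b c d].
Proof.
apply/disj_set2P/seteqP; split=> // x [/rectE /andP[/andP[_ h] _]].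
by move=> /rectE /andP[/andP[]]; rewrite leNgt h.
Qed.

Lemma rect_disjointr a b c d m : [disjoint rect a b c m & rect a b m d].
Proof.
apply/disj_set2P/seteqP; split=> // x [/rectE /andP[_ /andP[_ h]]].
by move=> /rectE /andP[_ /andP[]]; rewrite leNgt h.
Qed.

Definition mid (a b : R) := (a + b) / 2.

Lemma mid_le a b : a <= b -> a <= mid a b <= b.
Proof. by rewrite /mid => ab; apply/andP; split; lra. Qed.

(** The total oscillation over the [4 ^ j] pieces of the [j]-th quartering. The outermost cut comes
    first in the recursion, so that inductions keep the corners general and apply their hypothesis
    to four quarters. *)
Fixpoint dyadic_oscillation (j : nat) (f : plane -> R) (a b c d : R) : R :=
  if j is j'.+1 then
    dyadic_oscillation j' f a (mid a b) c (mid c d) +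
    dyadic_oscillation j' f a (mid a b) (mid c d) d +
    (dyadic_oscillation j' f (mid a b) b c (mid c d) +
     dyadic_oscillation j' f (mid a b) b (mid c d) d)
  else oscillation mu (rect a b c d) f.

Implicit Types (f g : plane -> R).

Lemma dyadic_oscillation_ge0 j f a b c d : 0 <= dyadic_oscillation j f a b c d.
Proof.
by elim: j a b c d => [|j IH] a b c d /=; [exact: oscillation_ge0|rewrite !addr_ge0].
Qed.

Lemma dyadic_oscillationD j f g a b c d : a <= b -> c <= d ->
  bounded_mfun f -> bounded_mfun g ->
  dyadic_oscillation j (fun x => f x + g x) a b c d <=
  dyadic_oscillation j f a b c d + dyadic_oscillation j g a b c d.
Proof.
elim: j a b c d => [|j IH] a b c d ab cd bf bg /=.
  by apply: oscillationD => //; exact: finite_mset_rect.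
have /andP[am mb] := mid_le ab; have /andP[cm md] := mid_le cd.
have h1 := IH _ _ _ _ am cm bf bg; have h2 := IH _ _ _ _ am md bf bg.
have h3 := IH _ _ _ _ mb cm bf bg; have h4 := IH _ _ _ _ mb md bf bg.
lra.
Qed.

Lemma dyadic_oscillationZ j f k a b c d : a <= b -> c <= d ->
  bounded_mfun f ->
  dyadic_oscillation j (fun x => k * f x) a b c d =
  `|k| * dyadic_oscillation j f a b c d.
Proof.
elim: j a b c d => [|j IH] a b c d ab cd bf /=.
  by apply: oscillationZ => //; exact: finite_mset_rect.
have /andP[am mb] := mid_le ab; have /andP[cm md] := mid_le cd.
by rewrite !IH// !mulrDr.
Qed.

Lemma dyadic_oscillationM j f g a b c d : a <= b -> c <= d ->
  bounded_mfun f -> bounded_mfun g ->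
  (forall x, `|f x| <= 1) -> (forall x, `|g x| <= 1) ->
  dyadic_oscillation j (fun x => f x * g x) a b c d <=
  2 * (dyadic_oscillation j f a b c d + dyadic_oscillation j g a b c d).
Proof.
elim: j a b c d => [|j IH] a b c d ab cd bf bg f1 g1 /=.
  by apply: oscillationM => //; exact: finite_mset_rect.
have /andP[am mb] := mid_le ab; have /andP[cm md] := mid_le cd.
have h1 := IH _ _ _ _ am cm bf bg f1 g1; have h2 := IH _ _ _ _ am md bf bg f1 g1.
have h3 := IH _ _ _ _ mb cm bf bg f1 g1; have h4 := IH _ _ _ _ mb md bf bg f1 g1.
lra.
Qed.

Lemma Rint_rect4 f a b c d : a <= b -> c <= d -> bounded_mfun f ->
  \int[mu]_(x in rect a b c d) f x =
  \int[mu]_(x in rect a (mid a b) c (mid c d)) f x +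
  \int[mu]_(x in rect a (mid a b) (mid c d) d) f x +
  (\int[mu]_(x in rect (mid a b) b c (mid c d)) f x +
   \int[mu]_(x in rect (mid a b) b (mid c d) d) f x).
Proof.
move=> ab cd bf.
have /andP[am mb] := mid_le ab; have /andP[cm md] := mid_le cd.
rewrite (rect_splitl _ _ am mb) RintU//; [|exact: finite_mset_rect..|exact: rect_disjointl].
by rewrite !(rect_splitr _ _ cm md) !RintU//;
  solve [exact: finite_mset_rect|exact: rect_disjointr].
Qed.

(** Each piece is compared with the constant 0. The bound does not depend on [j], which makes
    vanishing oscillation stable under L^1 approximation. *)
Lemma dyadic_oscillation_le j f a b c d : a <= b -> c <= d ->
  bounded_mfun f ->
  dyadic_oscillation j f a b c d <= 2 * \int[mu]_(x in rect a b c d) `|f x|.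
Proof.
elim: j a b c d => [|j IH] a b c d ab cd bf /=.
  apply: le_trans (oscillation_le 0 (finite_mset_rect ab cd) bf) _.
  by under eq_Rintegral do rewrite subr0.
have /andP[am mb] := mid_le ab; have /andP[cm md] := mid_le cd.
have h1 := IH _ _ _ _ am cm bf; have h2 := IH _ _ _ _ am md bf.
have h3 := IH _ _ _ _ mb cm bf; have h4 := IH _ _ _ _ mb md bf.
rewrite (Rint_rect4 ab cd (bounded_mfun_norm bf)); lra.
Qed.

Lemma dyadic_oscillation_eq_cst j f k a b c d : a <= b -> c <= d ->
  (forall x, rect a b c d x -> f x = k) -> dyadic_oscillation j f a b c d = 0.
Proof.
elim: j a b c d => [|j IH] a b c d ab cd fk /=.
  rewrite (@eq_oscillation _ _ _ _ _ _ (fun=> k)).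
    by apply: oscillation_cst; exact: finite_mset_rect.
  by move=> x; rewrite inE; exact: fk.
have /andP[am mb] := mid_le ab; have /andP[cm md] := mid_le cd.
rewrite (rect_splitl _ _ am mb) !(rect_splitr _ _ cm md) in fk.
by rewrite !IH ?addr0// => x xr; apply: fk; rewrite /setU /=; tauto.
Qed.

End rectangles.

(** * Bounded convergence on sets of finite measure *)

Section bounded_convergence.
Context {d} {T : measurableType d} {R : realType}.
Variable mu : {measure set T -> \bar R}.

Lemma bounded_convergence (D : set T) (f_ : nat -> T -> R) (f : T -> R) (M : R) :
  finite_mset mu D -> (forall n, measurable_fun setT (f_ n)) ->
  measurable_fun setT f -> (forall n x, `|f_ n x| <= M) ->
  {ae mu, forall x, D x -> f_ n x @[n --> \oo] --> f x} ->
  \int[mu]_(x in D) f_ n x @[n --> \oo] --> \int[mu]_(x in D) f x.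
Proof.
move=> [mD Dfin] mf_ mf fM f_f.
have intM : mu.-integrable D (cst M%:E).
  by apply: (@bounded_mfun_integrable _ _ _ mu D (fun=> M)).
have mf_' n : measurable_fun D (EFin \o f_ n).
  exact/measurable_EFinP/measurable_funTS.
have mf' : measurable_fun D (EFin \o f) by exact/measurable_EFinP/measurable_funTS.
have f_f' : {ae mu, forall x, D x -> (EFin \o f_ n) x @[n --> \oo] --> (EFin \o f) x}.
  apply: filterS f_f => x fx Dx; apply: cvg_EFin; last exact: fx.
  by near=> n.
have fM' : {ae mu, forall x n, D x -> (`|(EFin \o f_ n) x| <= cst M%:E x)%E}.
  by apply: aeW => x n Dx /=; rewrite lee_fin fM.
have [i1 _ c3] := dominated_convergence mD mf_' mf' f_f' intM fM'.
rewrite /Rintegral; apply: fine_cvg; rewrite fineK//.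
exact: integrable_fin_num.
Unshelve. all: by end_near. Qed.

End bounded_convergence.

(** * Oscillation over ever finer dyadic pieces *)

Section vanishing_oscillation.
Context {R : realType}.
Local Notation plane := (measurableTypeR R * measurableTypeR R)%type.
Local Notation mu := (lebesgue2 R).
Implicit Types (f g : plane -> R).

Definition vanishing_oscillation f := bounded_mfun f /\
  forall a b c d, a <= b -> c <= d ->
    dyadic_oscillation j f a b c d @[j --> \oo] --> 0.

(** An L^1 error contributes at most twice its size at every level of subdivision, so the
    approximant may depend on the rectangle and on [eps]. *)
Lemma vanishing_oscillation_closed f : bounded_mfun f ->
  (forall a b c d eps, a <= b -> c <= d -> 0 < eps ->
    exists2 g, vanishing_oscillation g &
      \int[mu]_(x in rect a b c d) `|f x - g x| <= eps) ->
  vanishing_oscillation f.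
Proof.
move=> bf fg; split => // a b c d ab cd; apply/cvgrPdist_le => eps eps0.
(* One quarter bounds the oscillation of [g], two quarters that of [f - g]. *)
have eps4 : 0 < eps / 4 by rewrite divr_gt0.
have [g [bg vg] gle] := fg a b c d _ ab cd eps4.
have /cvgrPdist_le/(_ _ eps4) := vg a b c d ab cd.
apply: filterS => j; rewrite !sub0r !normrN !ger0_norm ?dyadic_oscillation_ge0// => gj.
have bfg := bounded_mfunB bf bg.
have -> : f = (fun x => g x + (f x - g x)).
  by apply/funext => x; rewrite addrC subrK.
have h1 := dyadic_oscillationD j ab cd bg bfg.
have h2 := dyadic_oscillation_le j ab cd bfg.
lra.
Qed.

Lemma vanishing_oscillationD f g : vanishing_oscillation f ->
  vanishing_oscillation g -> vanishing_oscillation (fun x => f x + g x).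
Proof.
move=> [bf vf] [bg vg]; split; first exact: bounded_mfunD.
move=> a b c d ab cd.
apply: (@squeeze_cvgr _ _ _ _ (cst 0) (fun j => dyadic_oscillation j f a b c d +
  dyadic_oscillation j g a b c d)).
- by apply: nearW => j; rewrite dyadic_oscillation_ge0 dyadic_oscillationD.
- exact: cvg_cst.
- by rewrite -(addr0 0); apply: cvgD; [exact: vf|exact: vg].
Qed.

Lemma vanishing_oscillationZ f k : vanishing_oscillation f ->
  vanishing_oscillation (fun x => k * f x).
Proof.
move=> [bf vf]; split; first exact: bounded_mfunZ.
move=> a b c d ab cd.
under eq_fun do rewrite dyadic_oscillationZ//.
by rewrite -(mulr0 `|k|); apply: cvgMr; exact: vf.
Qed.

Lemma vanishing_oscillation_cst k : vanishing_oscillation (fun=> k).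
Proof.
split=> // a b c d ab cd.
under eq_fun do rewrite (@dyadic_oscillation_eq_cst _ _ _ k)//.
exact: cvg_cst.
Qed.

Lemma vanishing_oscillationM f g : vanishing_oscillation f ->
  vanishing_oscillation g ->
  (forall x, `|f x| <= 1) -> (forall x, `|g x| <= 1) ->
  vanishing_oscillation (fun x => f x * g x).
Proof.
move=> [bf vf] [bg vg] f1 g1; split; first exact: bounded_mfunM.
move=> a b c d ab cd.
apply: (@squeeze_cvgr _ _ _ _ (cst 0) (fun j => 2 * (dyadic_oscillation j f a b c d +
  dyadic_oscillation j g a b c d))).
- by apply: nearW => j; rewrite dyadic_oscillation_ge0 dyadic_oscillationM.
- exact: cvg_cst.
- rewrite -(mulr0 2); apply: cvgMr.
  by rewrite -(addr0 0); apply: cvgD; [exact: vf|exact: vg].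
Qed.

(** Two of the four quarters always lie on one side of the line where the relevant coordinate equals
    [t], and there [f] is constant. The other two have half of the total area, whence a factor 1/2
    per level; the initial value uses [|f| <= 1]. *)
Lemma dyadic_oscillation_slab_le (t : R) j f a b c d :
  bounded_mfun f -> (forall x, `|f x| <= 1) -> a <= b -> c <= d ->
  ((forall a b c d, a <= b -> c <= d -> b <= t \/ t <= a ->
      exists k, forall x, rect a b c d x -> f x = k) \/
   (forall a b c d, a <= b -> c <= d -> d <= t \/ t <= c ->
      exists k, forall x, rect a b c d x -> f x = k)) ->
  dyadic_oscillation j f a b c d <= 2 * ((b - a) * (d - c)) / 2 ^+ j.
Proof.
move=> bf f1 + + fk.
elim: j a b c d => [|j IH] a b c d ab cd.
  apply: le_trans (dyadic_oscillation_le _ ab cd bf) _.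
  rewrite expr0 divr1 ler_pM2l//.
  have fD := @finite_mset_rect R _ _ _ _ ab cd.
  apply: le_trans (ler_Rint fD _ (bounded_mfun_cst 1) _) _.
  - exact: bounded_mfun_norm.
  - by move=> x _.
  - by rewrite Rint_cst// lebesgue2_rect//= mul1r.
have /andP[am mb] := mid_le ab; have /andP[cm md] := mid_le cd.
have h1 := IH _ _ _ _ am cm; have h2 := IH _ _ _ _ am md.
have h3 := IH _ _ _ _ mb cm; have h4 := IH _ _ _ _ mb md.
rewrite exprS invfM /=.
have E1 : mid a b - a = (b - a) / 2 by rewrite /mid; field.
have E2 : b - mid a b = (b - a) / 2 by rewrite /mid; field.
have E3 : mid c d - c = (d - c) / 2 by rewrite /mid; field.
have E4 : d - mid c d = (d - c) / 2 by rewrite /mid; field.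
rewrite ?E1 ?E2 ?E3 ?E4 in h1 h2 h3 h4.
set w := (b - a) in h1 h2 h3 h4 *; set h := (d - c) in h1 h2 h3 h4 *.
set q := (2 ^+ j)^-1 in h1 h2 h3 h4 *.
have E : 2 * (w / 2 * (h / 2)) * q = 2 * (w * h) * (2^-1 * q) / 2 by field.
rewrite E in h1 h2 h3 h4.
have zero a' b' c' d' : a' <= b' -> c' <= d' ->
    (exists k, forall x, rect a' b' c' d' x -> f x = k) ->
    dyadic_oscillation j f a' b' c' d' = 0.
  by move=> ab' cd' [k fk']; apply: (@dyadic_oscillation_eq_cst _ _ _ k).
(* The position of [t] relative to the midpoint decides which two quarters contribute nothing. *)
case: fk => fk; [have [tm|tm] := leP t (mid a b)|have [tm|tm] := leP t (mid c d)].
- rewrite (zero (mid a b) b c (mid c d))//; last by apply: fk => //; right.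
  rewrite (zero (mid a b) b (mid c d) d)//; last by apply: fk => //; right.
  lra.
- rewrite (zero a (mid a b) c (mid c d))//; last by apply: fk => //; left; exact: ltW.
  rewrite (zero a (mid a b) (mid c d) d)//; last by apply: fk => //; left; exact: ltW.
  lra.
- rewrite (zero a (mid a b) (mid c d) d)//; last by apply: fk => //; right.
  rewrite (zero (mid a b) b (mid c d) d)//; last by apply: fk => //; right.
  lra.
- rewrite (zero a (mid a b) c (mid c d))//; last by apply: fk => //; left; exact: ltW.
  rewrite (zero (mid a b) b c (mid c d))//; last by apply: fk => //; left; exact: ltW.
  lra.
Qed.

(* Typically f is the indicator of a half-plane: at each step of the subdivision
   only the pieces met by its boundary line contribute, and their total area is
   halved. *)
Lemma vanishing_oscillation_slab (t : R) f :
  bounded_mfun f -> (forall x, `|f x| <= 1) ->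
  ((forall a b c d, a <= b -> c <= d -> b <= t \/ t <= a ->
      exists k, forall x, rect a b c d x -> f x = k) \/
   (forall a b c d, a <= b -> c <= d -> d <= t \/ t <= c ->
      exists k, forall x, rect a b c d x -> f x = k)) ->
  vanishing_oscillation f.
Proof.
move=> bf f1 fk; split=> // a b c d ab cd.
apply: (@squeeze_cvgr _ _ _ _ (cst 0)
    (fun j => 2 * ((b - a) * (d - c)) * (2^-1) ^+ j)).
- apply: nearW => j; rewrite dyadic_oscillation_ge0/= exprVn.
  exact: dyadic_oscillation_slab_le fk.
- exact: cvg_cst.
- rewrite -(mulr0 (2 * ((b - a) * (d - c)))); apply: cvgMr.
  by apply: cvg_expr; rewrite ger0_norm// invf_lt1// ltr1n.
Qed.

Definition dyadic_set : set (set plane) :=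
  [set A | measurable A /\ vanishing_oscillation (\1_A : plane -> R)].

Let indic1 (A : set plane) x : `|\1_A x : R| <= 1.
Proof. by rewrite indicE; case: (_ \in _); rewrite ?normr1// normr0. Qed.

Lemma dyadic_setC A : dyadic_set A -> dyadic_set (~` A).
Proof.
move=> [mA vA]; split; first exact: measurableC.
have -> : (\1_(~` A) : plane -> R) = (fun x => 1 + (-1) * \1_A x).
  by apply/funext => x; rewrite !indicE in_setC; case: (x \in A) => /=; ring.
by apply: vanishing_oscillationD; [exact: vanishing_oscillation_cst|
  exact: vanishing_oscillationZ].
Qed.

Lemma dyadic_setI A B : dyadic_set A -> dyadic_set B -> dyadic_set (A `&` B).
Proof.
move=> [mA vA] [mB vB]; split; first exact: measurableI.
by rewrite indicI; apply: vanishing_oscillationM.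
Qed.

Lemma dyadic_setU A B : dyadic_set A -> dyadic_set B -> dyadic_set (A `|` B).
Proof.
by move=> dA dB; rewrite -(setCK (A `|` B)) setCU; apply/dyadic_setC/dyadic_setI;
  exact: dyadic_setC.
Qed.

Lemma dyadic_set0 : dyadic_set set0.
Proof. by split=> //; rewrite indic0; exact: vanishing_oscillation_cst. Qed.

(** Finite unions follow from the Boolean operations; their indicators converge to that of the whole
    union in L^1 on each rectangle, so closedness under L^1 approximation concludes. *)
Lemma dyadic_bigcup (A : nat -> set plane) : (forall n, dyadic_set (A n)) ->
  dyadic_set (\bigcup_n A n).
Proof.
move=> dA; have mU : measurable (\bigcup_n A n).
  by apply: bigcup_measurable => n _; have [] := dA n.
split=> //; pose B n := \big[setU/set0]_(i < n) A i.
have dB n : dyadic_set (B n).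
  rewrite /B; elim/big_ind : _ => //; first exact: dyadic_set0.
  exact: dyadic_setU.
apply: vanishing_oscillation_closed => [|a b c d eps ab cd eps0].
  exact: bounded_mfun_indic.
have : \int[mu]_(x in rect a b c d) `|\1_(\bigcup_n A n) x - \1_(B n) x|
    @[n --> \oo] --> \int[mu]_(x in rect a b c d) (cst 0) x.
  apply: (@bounded_convergence _ _ _ _ _ _ _ 1) => //.
  - exact: finite_mset_rect.
  - move=> n; apply: measurableT_comp => //; apply: measurable_funB;
      apply: measurable_indic => //.
    by have [] := dB n.
  - move=> n x; rewrite normr_id !indicE.
    by do 2 case: (_ \in _); rewrite ?subrr ?subr0 ?sub0r ?normrN ?normr1 ?normr0.
  - apply: aeW => x _; apply/cvgrPdist_le => e e0.
    have [[k _ Akx]|nAx] := pselect ((\bigcup_n A n) x).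
      exists k.+1 => // n /= kn; rewrite !indicE.
      rewrite (@mem_set _ (\bigcup_n A n) x); last by exists k.
      rewrite (@mem_set _ (B n) x); first by rewrite subrr normr0 subr0 normr0 ltW.
      by rewrite /B -bigcup_mkord; exists k.
    near=> n; rewrite !indicE memNset//.
    rewrite memNset; first by rewrite subrr normr0 subr0 normr0 ltW.
    by rewrite /B -bigcup_mkord => -[i _ Aix]; apply: nAx; exists i.
rewrite Rintegral_cst; last exact: measurable_rect.
rewrite mul0r => /cvgrPdist_le/(_ _ eps0)[N _ HN].
exists (\1_(B N)); first exact: (dB N).2.
have := HN N (leqnn _); rewrite sub0r normrN ger0_norm//; exact: Rint_ge0.
Unshelve. all: by end_near. Qed.

(** The sets [B] with the desired property form a sigma-algebra, and the open half-lines generate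
    the Borel sets of the line. *)
Lemma dyadic_set_preimage (p : plane -> R) :
  (forall t, dyadic_set [set x | p x < t]) ->
  forall B : set (measurableTypeR R), measurable B -> dyadic_set (p @^-1` B).
Proof.
move=> pt B mB0.
have mB : (@RGenInftyO.G R).-sigma.-measurable B.
  by rewrite -RGenInftyO.measurableE.
(* Membership in a generated sigma-algebra means membership in every sigma-algebra containing the
   generators; it is instantiated here at the class of good sets. *)
apply: (mB (fun B => dyadic_set (p @^-1` B))); split.
- split=> [|A dA|A dA].
  + by rewrite preimage_set0; exact: dyadic_set0.
  + by rewrite setTD preimage_setC; exact: dyadic_setC.
  + by rewrite preimage_bigcup; exact: dyadic_bigcup.
- move=> _ [t ->].
  suff -> : p @^-1` `]-oo, t[%classic = [set x | p x < t] by exact: pt.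
  by apply/seteqP; split=> x; rewrite /preimage /= in_itv.
Qed.

(** The half-planes bounded by vertical and horizontal lines qualify by the slab estimate; the
    qualifying sets form a sigma-algebra, which then contains all measurable rectangles and whatever
    they generate. *)
Lemma measurable_dyadic_set (A : set plane) : measurable A -> dyadic_set A.
Proof.
have d1 t : dyadic_set [set x : plane | (x.1 : R) < t].
  have mA : measurable [set x : plane | (x.1 : R) < t].
    suff -> : [set x : plane | (x.1 : R) < t] = `]-oo, t[%classic `*` setT.
      by apply: measurableX => //; exact: measurable_itv.
    by apply/seteqP; split=> x; rewrite /= in_itv /= => //; case.
  split=> //; apply: (@vanishing_oscillation_slab t) => //.
    exact: bounded_mfun_indic.
  left=> a b c d ab cd [bt|ta].
  - exists 1 => x /rectE /andP[/andP[_ xb] _]; rewrite indicE mem_set//=.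
    exact: lt_le_trans bt.
  - exists 0 => x /rectE /andP[/andP[ax _] _]; rewrite indicE memNset//=.
    by apply/negP; rewrite -leNgt (le_trans ta).
have d2 t : dyadic_set [set x : plane | (x.2 : R) < t].
  have mA : measurable [set x : plane | (x.2 : R) < t].
    suff -> : [set x : plane | (x.2 : R) < t] = setT `*` `]-oo, t[%classic.
      by apply: measurableX => //; exact: measurable_itv.
    by apply/seteqP; split=> x; rewrite /= in_itv /= => //; case.
  split=> //; apply: (@vanishing_oscillation_slab t) => //.
    exact: bounded_mfun_indic.
  right=> a b c d ab cd [bt|ta].
  - exists 1 => x /rectE /andP[_ /andP[_ xb]]; rewrite indicE mem_set//=.
    exact: lt_le_trans bt.
  - exists 0 => x /rectE /andP[_ /andP[ax _]]; rewrite indicE memNset//=.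
    by apply/negP; rewrite -leNgt (le_trans ta).
rewrite measurable_prod_measurableType => mA.
apply: (mA dyadic_set); split.
- split=> [|B dB|B dB]; [exact: dyadic_set0|rewrite setTD; exact: dyadic_setC|].
  exact: dyadic_bigcup.
- move=> _ [B mB [C mC <-]].
  suff -> : B `*` C = (fst @^-1` B) `&` (snd @^-1` C).
    by apply: dyadic_setI; [exact: (dyadic_set_preimage d1)|
      exact: (dyadic_set_preimage d2)].
  by [].
Qed.

(* Subtracting half of the indicator of [set x | M / 2 <= g x] from g halves the
   range [0, M] of g, so indicators suffice up to uniform approximation. *)
Lemma bounded_mfun_vanishing_oscillation f :
  measurable_fun setT f -> (forall x, 0 <= f x <= 1) -> vanishing_oscillation f.
Proof.
move=> mf f01.
(* The approximant collects the first [n] binary digits of [g / M]; [M] and [g] are quantified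
   inside the induction because the remainder ranges over an interval of half the length. *)
have appr n : forall M g, 0 <= M -> measurable_fun setT g ->
    (forall x, 0 <= g x <= M) -> exists2 h, vanishing_oscillation h &
      forall x, 0 <= g x - h x <= M / 2 ^+ n.
  elim: n => [|n IH] M g M0 mg gM.
    exists (cst 0); first exact: vanishing_oscillation_cst.
    by move=> x; rewrite subr0 expr0 divr1.
  pose A := [set x | M / 2 <= g x].
  have mA : measurable A.
    rewrite -[A]setTI; apply: (measurable_fun_ler (measurable_cst _) mg) => //.
  pose g' x := g x - M / 2 * \1_A x.
  have mg' : measurable_fun setT g'.
    by apply: measurable_funB => //; apply: measurable_funM => //; exact: measurable_indic.
  have g'M x : 0 <= g' x <= M / 2.
    rewrite /g' indicE; have /andP[g0 gM'] := gM x; case: (boolP (x \in A)).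
      by rewrite inE /A /= => h; rewrite mulr1; apply/andP; split; lra.
    rewrite notin_setE /A /= => /negP; rewrite -ltNge => h.
    by rewrite mulr0 subr0 g0 ltW.
  have M2 : 0 <= M / 2 by rewrite divr_ge0.
  have [h vh hle] := IH _ _ M2 mg' g'M.
  exists (fun x => h x + M / 2 * \1_A x).
    apply: vanishing_oscillationD => //; apply: vanishing_oscillationZ.
    exact: (measurable_dyadic_set mA).2.
  move=> x; have := hle x; rewrite /g' exprS invfM mulrA.
  suff -> : g x - M / 2 * \1_A x - h x = g x - (h x + M / 2 * \1_A x) by [].
  by ring.
have bf : bounded_mfun f.
  by split=> //; exists 1 => x; have /andP[f0 f1] := f01 x; rewrite ger0_norm.
apply: vanishing_oscillation_closed => // a b c d eps ab cd eps0.
have : (b - a) * (d - c) * (2^-1) ^+ n @[n --> \oo] --> (0 : R).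
  rewrite -(mulr0 ((b - a) * (d - c))); apply: cvgMr.
  by apply: cvg_expr; rewrite ger0_norm// invf_lt1// ltr1n.
move=> /cvgrPdist_le/(_ _ eps0)[n _ /(_ n (leqnn _))].
have wh0 : 0 <= (b - a) * (d - c) by rewrite mulr_ge0// subr_ge0.
rewrite sub0r normrN ger0_norm; last by rewrite mulr_ge0// exprn_ge0.
move=> nle; have [h vh hle] := appr n 1 f ler01 mf f01.
exists h => //; apply: le_trans nle.
have fD := @finite_mset_rect R _ _ _ _ ab cd.
apply: le_trans (ler_Rint fD _ (bounded_mfun_cst ((2^-1) ^+ n)) _) _.
- by apply/bounded_mfun_norm/bounded_mfunB => //; exact: vh.1.
- move=> x _; have /andP[h0 h1] := hle x.
  by rewrite ger0_norm// exprVn -(mul1r (_ ^-1)).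
- by rewrite Rint_cst// lebesgue2_rect//= mulrC.
Qed.

End vanishing_oscillation.

(** * Open sets of the plane as countable unions of rectangles *)

Section plane_topology.
Context {R : realType}.
Local Notation plane := (measurableTypeR R * measurableTypeR R)%type.
Local Notation mu := (lebesgue2 R).

Lemma open_bigcup_rect (A : set (R * R)) : open A ->
  exists a b c d : nat -> R,
    [/\ forall n, a n <= b n, forall n, c n <= d n,
        forall n, rect (a n) (b n) (c n) (d n) `<=` A &
        A = \bigcup_n rect (a n) (b n) (c n) (d n)].
Proof.
move=> oA; pose P (q : rat * rat * (rat * rat)) :=
  `[< (ratr q.1.1 : R) <= ratr q.1.2 /\ (ratr q.2.1 : R) <= ratr q.2.2 /\
    rect (ratr q.1.1) (ratr q.1.2) (ratr q.2.1) (ratr q.2.2) `<=` (A : set plane) >].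
(* An invalid code falls back on a half-open rectangle with equal ends, which is empty and hence
   contained in [A]. *)
pose F n : rat * rat * (rat * rat) :=
  if unpickle n is Some q then if P q then q else (0, 0, (0, 0)) else (0, 0, (0, 0)).
have PF n : P (F n).
  have P0 : P (0, 0, (0, 0)).
    apply/asboolP; split => //=; split=> // x /rectE.
    by rewrite rmorph0 => /andP[/andP[h1 /(le_lt_trans h1)]]; rewrite ltxx.
  by rewrite /F; case: unpickle => // q; case: ifP.
exists (fun n => ratr (F n).1.1), (fun n => ratr (F n).1.2),
  (fun n => ratr (F n).2.1), (fun n => ratr (F n).2.2).
split=> [n|n|n|]; try by have /asboolP[? [? ?]] := PF n.
apply/seteqP; split; last by move=> x [n _]; have /asboolP[? [? h]] := PF n => /h.
move=> x Ax; have /nbhs_ballP[e /= e0 xe] : nbhs x A by exact: open_nbhs_nbhs.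
(* Balls of [R * R] are squares, so it suffices to place the corners within [e] of the point in each
   coordinate. *)
have h (y : R) : exists q : rat * rat, [/\ y - e < ratr q.1, ratr q.1 <= y,
    y < ratr q.2 & ratr q.2 < y + e].
  have [|q1] := @rat_in_itvoo R (y - e) y; first by rewrite ltrBlDr ltrDl.
  rewrite in_itv /= => /andP[h1 h2].
  have [|q2] := @rat_in_itvoo R y (y + e); first by rewrite ltrDl.
  rewrite in_itv /= => /andP[h3 h4].
  by exists (q1, q2); split => //=; exact: ltW.
have [[a b] /= [ha1 ha2 hb1 hb2]] := h x.1.
have [[c d] /= [hc1 hc2 hd1 hd2]] := h x.2.
have Pq : P (a, b, (c, d)).
  apply/asboolP => /=; split; first exact: le_trans (ltW hb1).
  split; first exact: le_trans (ltW hd1).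
  move=> y /rectE /andP[/andP[y1 y2] /andP[y3 y4]]; apply: xe.
  split; rewrite /ball /= ltr_distlC; apply/andP; split; lra.
exists (pickle (a, b, (c, d))) => //; apply/rectE; rewrite /F pickleK Pq /=.
by rewrite ha2 hb1 hc2 hd1.
Qed.

Lemma measurable_open_plane (A : set (R * R)) : open A ->
  measurable (A : set plane).
Proof.
move=> /open_bigcup_rect[a [b [c [d [_ _ _ ->]]]]].
by apply: bigcup_measurable => n _; exact: measurable_rect.
Qed.

Lemma continuous_measurable_plane (f : R * R -> R) : continuous f ->
  measurable_fun [set: plane] (f : plane -> R).
Proof.
move=> cf; apply: (measurability _ (RGenOpens.measurableE R)).
move=> _ [_ [a [b ->] <-]]; rewrite setTI; apply: measurable_open_plane.
by move/continuousP : cf; apply; exact: interval_open.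
Qed.

End plane_topology.

(** * Divergence of test fields *)

Section divergence.
Context {R : realType}.
Local Notation plane := (measurableTypeR R * measurableTypeR R)%type.
Local Notation mu := (lebesgue2 R).
Implicit Types (phi psi : R * R -> R * R) (Omega : set (R * R)).

Lemma derive_out_support (f : R * R -> R) (K : set (R * R)) v x : closed K ->
  (forall y, ~ K y -> f y = 0) -> ~ K x -> 'D_v f x = 0.
Proof.
move=> cK f0 nKx; have oK : open (~` K) by exact: closed_openC.
rewrite (@near_eq_derive _ _ _ f (cst 0) x v).
- exact: derive_cst.
- have : nbhs x (~` K) by exact: open_nbhs_nbhs.
  by apply: filterS => y nKy; rewrite f0.
Qed.

Lemma divergence_out_support Omega phi x : test_field Omega phi ->
  ~ closure [set x | phi x != 0] x -> divergence phi x = 0.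
Proof.
move=> tphi nx; rewrite /divergence.
have out y : ~ closure [set x | phi x != 0] y -> phi y = 0.
  move=> ny; apply/eqP; apply: contra_notT ny => phiy.
  exact: subset_closure.
rewrite !(@derive_out_support _ (closure [set x | phi x != 0]))//; first exact: addr0.
- exact: closed_closure.
- by move=> y /out ->.
- exact: closed_closure.
- by move=> y /out ->.
Qed.

Lemma divergence_out Omega phi x : test_field Omega phi ->
  ~ Omega x -> divergence phi x = 0.
Proof.
move=> tphi nx; apply: (divergence_out_support tphi).
by case: tphi => _ _ _ sub _ /sub.
Qed.

Lemma continuous_divergence Omega phi : test_field Omega phi ->
  continuous (divergence phi).
Proof.
move=> [[_ _ c1 _] [_ _ _ c2] _ _ _] x.
by apply: cvgD; [exact: c1|exact: c2].
Qed.

(** Continuity gives a bound on the compact support, and the divergence vanishes elsewhere. Pairings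
    with bounded functions thereby stay among bounded measurable functions, for which real integrals
    over sets of finite measure are linear. *)
Lemma bounded_divergence Omega phi : test_field Omega phi ->
  bounded_mfun (divergence phi : plane -> R).
Proof.
move=> tphi; have cd := continuous_divergence tphi.
split; first exact: continuous_measurable_plane.
pose K := closure [set x | phi x != 0].
have cK : compact K by case: tphi.
have : compact (divergence phi @` K).
  by apply: continuous_compact => //; exact: continuous_subspaceT.
move=> /compact_bounded[M [_ HM]].
(* The bound is available for numbers strictly above [M], hence the added 1. *)
have MM : M < `|M| + 1 by rewrite (le_lt_trans (ler_norm M))// ltrDl.
exists (`|M| + 1) => x; have [Kx|nKx] := pselect (K x).
  by apply: (HM _ MM); exists x.
by rewrite (divergence_out_support tphi nKx) normr0 addr_ge0.
Qed.

End divergence.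

(** * Total variation *)

Section total_variation.
Context {R : realType}.
Local Notation plane := (measurableTypeR R * measurableTypeR R)%type.
Local Notation mu := (lebesgue2 R).
Implicit Types (phi psi : R * R -> R * R) (P Q : set (R * R)) (U : plane -> R).

Lemma EFin_Rint d (T : measurableType d) (m : {measure set T -> \bar R})
    (D : set T) (f : T -> R) :
  finite_mset m D -> bounded_mfun f ->
  (\int[m]_(x in D) (f x)%:E)%E = (\int[m]_(x in D) f x)%:E.
Proof.
move=> [mD Dfin] bf; rewrite /Rintegral fineK//.
exact: (integrable_fin_num mD (bounded_mfun_integrable mD Dfin bf)).
Qed.

Lemma TV_ge P U phi : finite_mset mu P -> bounded_mfun U -> test_field P phi ->
  ((\int[mu]_(x in P) (U x * divergence phi x))%:E <= TV P U)%E.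
Proof.
move=> fP bU tphi; rewrite -EFin_Rint//; last first.
  exact: bounded_mfunM (bounded_divergence tphi).
by apply: ereal_sup_ubound; exists phi.
Qed.

Lemma TV_le P U M : finite_mset mu P -> bounded_mfun U ->
  (forall phi, test_field P phi ->
    \int[mu]_(x in P) (U x * divergence phi x) <= M) ->
  (TV P U <= M%:E)%E.
Proof.
move=> fP bU UM; apply: ge_ereal_sup => _ [phi tphi <-].
rewrite EFin_Rint ?lee_fin ?UM//.
exact: bounded_mfunM (bounded_divergence tphi).
Qed.

Lemma C1_cst (k : R) : C1 (fun=> k).
Proof.
have d0 v : 'D_v (fun _ : R * R => k) = cst 0.
  by apply/funext => x; exact: derive_cst.
by split => [x|x| |]; rewrite ?d0; first [exact: derivable_cst|exact: cst_continuous].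
Qed.

Lemma C1D (f g : R * R -> R) : C1 f -> C1 g -> C1 (f \+ g).
Proof.
move=> [f1 f2 f3 f4] [g1 g2 g3 g4].
have E1 : 'D_(e1 R) (f \+ g) = 'D_(e1 R) f \+ 'D_(e1 R) g.
  by apply/funext => x; rewrite deriveD.
have E2 : 'D_(e2 R) (f \+ g) = 'D_(e2 R) f \+ 'D_(e2 R) g.
  by apply/funext => x; rewrite deriveD.
split=> [x|x| |].
- by apply: derivableD.
- by apply: derivableD.
- by rewrite E1 => x; apply: cvgD; [exact: f3|exact: g3].
- by rewrite E2 => x; apply: cvgD; [exact: f4|exact: g4].
Qed.

Lemma test_field0 P : test_field P (fun=> 0).
Proof.
have -> : test_field P (fun=> 0) = test_field P (fun=> (0, 0)) by [].
split; [exact: C1_cst|exact: C1_cst| | |move=> x /=].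
- rewrite (_ : [set x | _] = set0) ?closure0; first exact: compact0.
  by apply/seteqP; split=> x //=; rewrite eqxx.
- rewrite (_ : [set x | _] = set0) ?closure0//.
  by apply/seteqP; split=> x //=; rewrite eqxx.
- by rewrite expr0n addr0 sqrtr0.
Qed.

Lemma TV_ge0 P U : finite_mset mu P -> bounded_mfun U -> (0 <= TV P U)%E.
Proof.
move=> fP bU; apply: le_trans (TV_ge fP bU (test_field0 P)).
rewrite lee_fin (_ : (fun=> _) = fun=> 0) ?Rint_cst ?mul0r//.
apply/funext => x; rewrite (divergence_out_support (test_field0 P)) ?mulr0//.
rewrite (_ : [set x | _] = set0) ?closure0//.
by apply/seteqP; split=> y //=; rewrite eqxx.
Qed.

Lemma test_field_sub P Q phi : P `<=` Q -> test_field P phi -> test_field Q phi.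
Proof. by move=> PQ [? ? ? sub ?]; split=> //; exact: subset_trans PQ. Qed.

Lemma test_field_out P phi x : test_field P phi -> ~ P x -> phi x = 0.
Proof.
move=> [_ _ _ sub _] nPx; apply/eqP; apply: contra_notT nPx => phix.
by apply: sub; exact: subset_closure.
Qed.

(** At each point at most one of the two fields is nonzero, [P] and [Q] being disjoint, so the
    Euclidean bound 1 survives addition. *)
Lemma test_fieldD P Q S phi psi : P `<=` S -> Q `<=` S -> P `&` Q = set0 ->
  test_field P phi -> test_field Q psi ->
  test_field S (fun x => phi x + psi x).
Proof.
move=> PS QS PQ tphi tpsi.
have [p1 p2 p3 p4 p5] := tphi; have [q1 q2 q3 q4 q5] := tpsi.
have sub : closure [set x | phi x + psi x != 0] `<=`
    closure [set x | phi x != 0] `|` closure [set x | psi x != 0].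
  rewrite -closureU; apply: closureS => x /=.
  by apply: contra_neqP => /not_orP[/negP/negPn/eqP -> /negP/negPn/eqP ->]; rewrite addr0.
split.
- exact: (C1D p1 q1).
- exact: (C1D p2 q2).
- by apply: subclosed_compact sub; [exact: closed_closure|exact: compactU].
- by apply: subset_trans sub _ => x [/p4/PS|/q4/QS].
- move=> x; have [Px|nPx] := pselect (P x).
    rewrite (test_field_out tpsi) ?addr0//.
    by move=> Qx; have : (P `&` Q) x by []; rewrite PQ.
  by rewrite (test_field_out tphi nPx) add0r.
Qed.

Lemma Rint_divergence_sub P Q U phi : P `<=` Q -> test_field P phi ->
  \int[mu]_(x in P) (U x * divergence phi x) =
  \int[mu]_(x in Q) (U x * divergence phi x).
Proof.
move=> PQ tphi; rewrite Rintegral_mkcond [RHS]Rintegral_mkcond.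
apply: eq_Rintegral => x _; rewrite /patch.
case: ifPn => [/set_mem Px|]; first by rewrite mem_set//; exact: PQ.
rewrite notin_setE => nPx; case: ifPn => // _.
by rewrite (divergence_out tphi nPx) mulr0.
Qed.

(** Fields on the two disjoint sets add up to an admissible field on [S]. The suprema over the two
    fields are then taken one after the other, which requires finite values to subtract. *)
Lemma TV_superadditive P Q S U : finite_mset mu S -> bounded_mfun U ->
  open P -> open Q -> P `<=` S -> Q `<=` S -> P `&` Q = set0 ->
  (TV S U < +oo)%E -> (TV P U + TV Q U <= TV S U)%E.
Proof.
move=> fS bU oP oQ PS QS PQ Sfin.
have fsub A : open A -> A `<=` S -> finite_mset mu A.
  move=> oA AS; have mA := measurable_open_plane oA; split=> //.
  by apply: le_lt_trans fS.2; apply: le_measure => //; rewrite inE//; exact: fS.1.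
have fP := fsub _ oP PS; have fQ := fsub _ oQ QS.
have SfinN : TV S U \is a fin_num by rewrite ge0_fin_numE// TV_ge0.
have key phi psi : test_field P phi -> test_field Q psi ->
    \int[mu]_(x in P) (U x * divergence phi x) +
    \int[mu]_(x in Q) (U x * divergence psi x) <= fine (TV S U).
  move=> tphi tpsi; rewrite -lee_fin fineK//.
  apply: le_trans (TV_ge fS bU (test_fieldD PS QS PQ tphi tpsi)).
  rewrite lee_fin (Rint_divergence_sub U PS tphi) (Rint_divergence_sub U QS tpsi).
  rewrite -RintD//; [|exact: bounded_mfunM (bounded_divergence tphi)|
                     exact: bounded_mfunM (bounded_divergence tpsi)].
  rewrite le_eqVlt; apply/orP; left; apply/eqP; apply: eq_Rintegral => x _.
  rewrite -mulrDr; congr (_ * _); rewrite /divergence.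
  have [[p1 _ _ _] [_ p2 _ _] _ _ _] := tphi.
  have [[q1 _ _ _] [_ q2 _ _] _ _ _] := tpsi.
  by rewrite (@deriveD _ _ _ (fun y => (phi y).1) (fun y => (psi y).1))//
    (@deriveD _ _ _ (fun y => (phi y).2) (fun y => (psi y).2))// addrACA.
(* The null field on [Q] yields monotonicity, hence finiteness of [TV P U]. *)
have leP : (TV P U <= TV S U)%E.
  rewrite -(fineK SfinN); apply: TV_le => // phi tphi.
  have := key _ _ tphi (test_field0 Q).
  rewrite [X in _ + X](_ : _ = 0) ?addr0//.
  rewrite (_ : (fun=> _) = fun=> 0) ?Rint_cst ?mul0r//.
  apply/funext => x; rewrite (divergence_out_support (test_field0 Q)) ?mulr0//.
  rewrite (_ : [set x | _] = set0) ?closure0//.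
  by apply/seteqP; split=> y //=; rewrite eqxx.
have PfinN : TV P U \is a fin_num.
  by rewrite ge0_fin_numE ?TV_ge0//; exact: le_lt_trans Sfin.
rewrite -(fineK PfinN) -(fineK SfinN) addeC -leeBrDr//.
rewrite -EFinB; apply: TV_le => // psi tpsi; rewrite lerBrDr -lerBrDl -lee_fin.
rewrite fineK//; apply: TV_le => // phi tphi.
by rewrite lerBrDr; exact: key.
Qed.

End total_variation.

(** * Smooth approximations of tents and indicators *)

Section smooth_bumps.
Context {R : realType}.
Implicit Types (e l t x y : R).

(** A quadratic bound on the remainder ignores how the function is defined by cases, so a junction
    point needs no one-sided limits. *)
Lemma is_derive_quadratic (f : R -> R) (t df C : R) :
  (forall h, `|f (h + t) - f t - df * h| <= C * h ^+ 2) -> is_derive t 1 f df.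
Proof.
move=> fC.
have lim0 : h^-1 *: ((f \o shift t) (h *: 1) - f t) @[h --> 0^'] --> df.
  have C0 : 0 <= C.
    by have h := fC 1; rewrite expr1n !mulr1 in h; exact: le_trans (normr_ge0 _) h.
  apply/cvgrPdist_le => eps eps0.
  (* [C] may be 0, hence the denominator [C + 1]. *)
  have eC : 0 < eps / (C + 1) by rewrite divr_gt0// ltr_wpDl.
  near=> h.
  have h0 : h != 0 by near: h; exact: nbhs_dnbhs_neq.
  have hC : `|h| <= eps / (C + 1).
    near: h; apply: dnbhs0_le.
    exact: eC.
  have -> : df - h^-1 *: ((f \o shift t) (h *: 1) - f t) =
      - (h^-1 * (f (h + t) - f t - df * h)).
    by rewrite /= /shift /GRing.scale /= mulr1; field.
  rewrite normrN normrM normfV.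
  apply: le_trans (_ : `|h|^-1 * (C * h ^+ 2) <= _).
    by rewrite ler_wpM2l// invr_ge0.
  rewrite -real_normK ?num_real// expr2 mulrCA mulKf ?normr_eq0//.
  apply: le_trans (_ : C * (eps / (C + 1)) <= _); first by rewrite ler_wpM2l.
  by rewrite mulrCA ler_piMr ?(ltW eps0)// ler_pdivrMr ?mul1r ?lerDl// ltr_wpDl.
apply: DeriveDef; first by apply/cvg_ex; exists df.
exact: cvg_lim.
Unshelve. all: by end_near. Qed.

(* A C^1 approximation of the positive part: for t >= 0 it is
   t - e + e ^+ 2 / (t + e). *)
Definition ramp e t := (Num.max t 0) ^+ 2 / (Num.max t 0 + e).
Definition dramp e t := 1 - e ^+ 2 / (Num.max t 0 + e) ^+ 2.

Lemma is_derive_ramp e t : 0 < e -> is_derive t 1 (ramp e) (dramp e t).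
Proof.
(* [2 / e] bounds the second derivative, which is [2 e ^ 2 / (t + e) ^ 3] for [t > 0] and 0 for
   [t < 0]. *)
move=> e0; apply: (@is_derive_quadratic _ _ _ (2 / e)) => h.
rewrite /ramp /dramp.
have -> : 2 / e * h ^+ 2 = 2 * h ^+ 2 / e by rewrite mulrAC.
have sqr_le (x y : R) : 0 <= x -> x <= y -> x ^+ 2 <= y ^+ 2.
  by move=> x0 xy; rewrite !expr2 ler_pM.
case: (leP t 0) => t0; case: (leP (h + t) 0) => ht0; rewrite ?add0r.
- rewrite expr0n/= mul0r subrr sub0r divff ?expf_neq0 ?gt_eqF// subrr mul0r.
  rewrite oppr0 normr0; apply: divr_ge0; last exact: ltW.
  by apply: mulr_ge0 => //; exact: sqr_ge0.
- rewrite expr0n/= mul0r subr0 divff ?expf_neq0 ?gt_eqF// subrr mul0r subr0.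
  rewrite ger0_norm; last by apply: divr_ge0; [exact: sqr_ge0|lra].
  have p0 : 0 < h + t + e by lra.
  rewrite ler_pdivrMr// [leRHS]mulrAC ler_pdivlMr//.
  apply: ler_pM; rewrite ?sqr_ge0 ?(ltW e0)//; last lra.
  have : (h + t) ^+ 2 <= h ^+ 2 by apply: sqr_le; lra.
  have := sqr_ge0 h; lra.
(* The increment crosses 0 from the right, so [t <= - h]; the remainder is a difference of two
   nonnegative terms, each within the bound. *)
- rewrite expr0n/= mul0r sub0r.
  have q0 : 0 < t + e by rewrite addr_gt0.
  have -> : - (t ^+ 2 / (t + e)) - (1 - e ^+ 2 / (t + e) ^+ 2) * h =
    (- h) * (t * (t + 2 * e)) / (t + e) ^+ 2 - t ^+ 2 / (t + e).
    by field; rewrite gt_eqF.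
  have A0 : 0 <= (- h) * (t * (t + 2 * e)) / (t + e) ^+ 2.
    by rewrite divr_ge0 ?sqr_ge0// mulr_ge0 ?mulr_ge0//; lra.
  have B0 : 0 <= t ^+ 2 / (t + e) by rewrite divr_ge0 ?sqr_ge0// ltW.
  have th : t ^+ 2 <= h ^+ 2 by rewrite -(sqrrN h); apply: sqr_le; lra.
  have B1 : t ^+ 2 / (t + e) <= 2 * h ^+ 2 / e.
    rewrite ler_pdivrMr// [leRHS]mulrAC ler_pdivlMr//.
    apply: ler_pM; rewrite ?sqr_ge0 ?(ltW e0)//; last lra.
    by have := sqr_ge0 h; lra.
  have A1 : (- h) * (t * (t + 2 * e)) / (t + e) ^+ 2 <= 2 * h ^+ 2 / e.
    rewrite ler_pdivrMr ?exprn_gt0// mulrAC ler_pdivlMr//.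
    apply: le_trans (_ : 2 * ((- h) * t) * (t + e) ^+ 2 <= _).
      have K : 0 <= 2 * (t + e) ^+ 2 - (t + 2 * e) * e by nra.
      have hle : 0 <= - h by lra.
      have := mulr_ge0 (mulr_ge0 hle (ltW t0)) K; lra.
    apply: ler_wpM2r; first exact: sqr_ge0.
    have hle : 0 <= - h by lra.
    have htle : 0 <= - (h + t) by lra.
    by have := mulr_ge0 hle htle; lra.
  by rewrite ler_norml; apply/andP; split; lra.
- have p0 : 0 < h + t + e by rewrite addr_gt0.
  have q0 : 0 < t + e by rewrite addr_gt0.
  have -> : (h + t) ^+ 2 / (h + t + e) - t ^+ 2 / (t + e) -
      (1 - e ^+ 2 / (t + e) ^+ 2) * h =
      e ^+ 2 * h ^+ 2 / ((h + t + e) * (t + e) ^+ 2).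
    by field; rewrite !gt_eqF.
  have D0 : 0 < (h + t + e) * (t + e) ^+ 2 by rewrite mulr_gt0// exprn_gt0.
  rewrite ger0_norm; last first.
    by apply: divr_ge0; [apply: mulr_ge0; exact: sqr_ge0|exact: ltW].
  rewrite ler_pdivrMr// [leRHS]mulrAC ler_pdivlMr//.
  have K : e * e ^+ 2 <= (h + t + e) * (t + e) ^+ 2.
    apply: ler_pM; rewrite ?sqr_ge0 ?(ltW e0)//; first lra.
    by apply: sqr_le; lra.
  have K2 : 0 <= 2 * ((h + t + e) * (t + e) ^+ 2) - e * e ^+ 2 by lra.
  by have := mulr_ge0 (sqr_ge0 h) K2; lra.
Qed.

Lemma continuous_dramp e : 0 < e -> continuous (dramp e).
Proof.
move=> e0 t; apply: cvgB; first exact: cvg_cst.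
have q0 : Num.max t 0 + e != 0.
  by rewrite gt_eqF// ltr_wpDl// le_max lexx orbT.
have cq : Num.max x 0 + e @[x --> t] --> Num.max t 0 + e.
  apply: cvgD; last exact: cvg_cst.
  apply: continuous_max => //; exact: cst_continuous.
apply: cvgMr; apply: cvgV; first by rewrite expf_neq0.
by rewrite expr2; under eq_fun do rewrite expr2; exact: cvgM.
Qed.

Lemma ramp_le e t : 0 < e -> 0 <= ramp e t <= Num.max t 0.
Proof.
move=> e0; rewrite /ramp; have m0 : 0 <= Num.max t 0 by rewrite le_max lexx orbT.
have q0 : 0 < Num.max t 0 + e by rewrite ltr_wpDl.
rewrite divr_ge0 ?sqr_ge0 ?(ltW q0)//= ler_pdivrMr// expr2 ler_wpM2l//.
by rewrite lerDl ltW.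
Qed.

(** Together with [ramp_le], this places [ramp e t] within [e] of the positive part of [t]. *)
Lemma ramp_ge e t : 0 < e -> t - e <= ramp e t.
Proof.
move=> e0; have /andP[r0 _] := ramp_le t e0; move: r0; rewrite /ramp.
case: (leP t 0) => t0 r0; first by apply: le_trans r0; lra.
have q0 : 0 < t + e by lra.
by rewrite ler_pdivlMr// -subr_ge0; have := sqr_ge0 e; nra.
Qed.

Lemma ramp_le0 e t : t <= 0 -> ramp e t = 0.
Proof. by move=> t0; rewrite /ramp max_r// expr0n mul0r. Qed.

Lemma dramp_le0 e t : 0 < e -> t <= 0 -> dramp e t = 0.
Proof.
by move=> e0 t0; rewrite /dramp max_r// add0r divff ?subrr// expf_neq0// gt_eqF.
Qed.

Lemma dramp_le e t : 0 < e -> 0 <= dramp e t <= 1.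
Proof.
move=> e0; rewrite /dramp.
have m0 : 0 <= Num.max t 0 by rewrite le_max lexx orbT.
have q0 : 0 < Num.max t 0 + e by rewrite ltr_wpDl.
rewrite subr_ge0 ler_pdivrMr ?exprn_gt0// mul1r gerBl.
rewrite divr_ge0 ?sqr_ge0// andbT ler_sqr ?nnegrE ?(ltW e0) ?(ltW q0)//.
by rewrite lerDr.
Qed.

(** The loss [e ^ 2 / (t + e) ^ 2] is at most [e / t], an explicit rate that drives the convergence
    of the slopes away from the kinks. *)
Lemma dramp_ge e t : 0 < e -> 0 < t -> 1 - e / t <= dramp e t.
Proof.
move=> e0 t0; rewrite /dramp (max_l (ltW t0)) lerD2l lerN2.
have q0 : 0 < t + e by rewrite addr_gt0.
by rewrite ler_pdivrMr ?exprn_gt0// mulrAC ler_pdivlMr//; nra.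
Qed.

(* An approximation of the positive part of l - |y|, since
   ramp e y + ramp e (- y) approximates |y|; the shift by 2 * e keeps the support
   inside the open interval of radius l. *)
Definition tent e l y := ramp e (l - 2 * e - ramp e y - ramp e (- y)).
Definition dtent e l y :=
  dramp e (l - 2 * e - ramp e y - ramp e (- y)) * (dramp e (- y) - dramp e y).

Lemma is_derive_rampN e t : 0 < e ->
  is_derive t 1 (fun x => ramp e (- x)) (- dramp e (- t)).
Proof.
move=> e0.
have h := is_derive1_comp (is_derive_ramp (- t) e0) (is_deriveNid t 1).
by apply: is_derive_eq h _; rewrite ?/GRing.scale /= ?mulN1r ?mulrN1.
Qed.

Lemma is_derive_tent e l y : 0 < e -> is_derive y 1 (tent e l) (dtent e l y).
Proof.
move=> e0.
pose g (x : R) := l - 2 * e - ramp e x - ramp e (- x).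
have h1 := is_derive_ramp y e0; have h2 := is_derive_rampN y e0.
have hg : is_derive y 1 g (dramp e (- y) - dramp e y).
  have hg0 := is_deriveB (is_deriveB (is_derive_cst (l - 2 * e) y 1) h1) h2.
  by apply: is_derive_eq hg0 _; rewrite sub0r opprK addrC.
have h := is_derive1_comp (is_derive_ramp (g y) e0) hg.
by apply: is_derive_eq h _.
Qed.

Lemma continuous_ramp e : 0 < e -> continuous (ramp e).
Proof.
move=> e0 t; apply: differentiable_continuous; apply/derivable1_diffP.
by have := is_derive_ramp t e0.
Qed.

Lemma continuous_dtent e l : 0 < e -> continuous (dtent e l).
Proof.
move=> e0 y; have cN (f : R -> R) : continuous f -> f (- x) @[x --> y] --> f (- y).
  by move=> cf; apply: continuous_comp; [exact: oppr_continuous|exact: cf].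
apply: cvgM.
  apply: (@continuous_comp _ _ _ (fun x => l - 2 * e - ramp e x - ramp e (- x))
    (dramp e)); last exact: continuous_dramp.
  apply: cvgB; last exact: (cN _ (continuous_ramp e0)).
  by apply: cvgB; [exact: cvg_cst|exact: continuous_ramp].
by apply: cvgB; [exact: (cN _ (continuous_dramp e0))|exact: continuous_dramp].
Qed.

(** [ramp e y + ramp e (- y)] lies between [|y| - e] and [|y|]. The lower half, used here, makes the
    tent vanish once [|y| >= l - e]; the upper half, in [ramp_arg_ge], keeps the argument positive
    in the interior for small [e]. *)
Lemma ramp_arg_le e l y : 0 < e -> l - 2 * e - ramp e y - ramp e (- y) <= l - e - `|y|.
Proof.
move=> e0; have /andP[a0 _] := ramp_le y e0; have /andP[b0 _] := ramp_le (- y) e0.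
have h1 := ramp_ge y e0; have h2 := ramp_ge (- y) e0.
by case: (ger0P y) => _; lra.
Qed.

Lemma ramp_arg_ge e l y : 0 < e -> l - 2 * e - `|y| <= l - 2 * e - ramp e y - ramp e (- y).
Proof.
move=> e0; case: (ger0P y) => y0.
  rewrite (@ramp_le0 e (- y)) ?oppr_le0//; have /andP[_] := ramp_le y e0.
  by rewrite max_l//; lra.
rewrite (@ramp_le0 e y) ?(ltW y0)//; have /andP[_] := ramp_le (- y) e0.
by rewrite max_l ?oppr_ge0 ?(ltW y0)//; lra.
Qed.

Lemma tent_le e l y : 0 < e -> 0 <= l -> 0 <= tent e l y <= l.
Proof.
move=> e0 l0; have /andP[h1 h2] := ramp_le (l - 2 * e - ramp e y - ramp e (- y)) e0.
rewrite /tent h1 /=; apply: le_trans h2 _; rewrite ge_max l0 andbT.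
by have := ramp_arg_le l y e0; have := normr_ge0 y; lra.
Qed.

Lemma dtent_le e l y : 0 < e -> `|dtent e l y| <= 1.
Proof.
move=> e0; have /andP[h1 h2] := dramp_le (l - 2 * e - ramp e y - ramp e (- y)) e0.
have /andP[h3 h4] := dramp_le y e0; have /andP[h5 h6] := dramp_le (- y) e0.
rewrite /dtent normrM; apply: mulr_ile1 => //; first by rewrite ger0_norm.
by rewrite ler_norml; apply/andP; split; lra.
Qed.

Lemma tent_out e l y : 0 < e -> l - e <= `|y| -> tent e l y = 0.
Proof. by move=> e0 ly; apply: ramp_le0; have := ramp_arg_le l y e0; lra. Qed.

(** According to the sign of [y] one of the two inner slopes vanishes, while the other one and the
    outer slope tend to 1. The apex 0, where the slope of the limit tent jumps, is excluded. *)
Lemma dtent_cvg (e_ : nat -> R) l y : (forall n, 0 < e_ n) ->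
  e_ n @[n --> \oo] --> 0 -> y != 0 -> `|y| < l ->
  dtent (e_ n) l y @[n --> \oo] --> - Num.sg y.
Proof.
move=> e0 ecvg y0 yl; apply/cvgrPdist_le => eps eps0.
pose s := (l - `|y|) / 2.
have s0 : 0 < s by rewrite divr_gt0// subr_gt0.
have y0' : 0 < `|y| by rewrite normr_gt0.
(* The bound [s / 2] keeps the outer argument [w] above [s]; the other one makes each of the losses
   [e / w] and [e / |y|] at most [eps / 2]. *)
have d0 : 0 < Num.min (s / 2) (eps * Num.min s `|y| / 2).
  rewrite lt_min; apply/andP; split; first exact: divr_gt0.
  by apply: divr_gt0 => //; apply: mulr_gt0 => //; rewrite lt_min s0.
move/cvgrPdist_le : ecvg => /(_ _ d0); apply: filterS => n.
have en := e0 n; rewrite sub0r normrN gtr0_norm// le_min => /andP[es ee].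
set w := l - 2 * e_ n - ramp (e_ n) y - ramp (e_ n) (- y).
have ws : s <= w.
  by have := ramp_arg_ge l y en; rewrite -/w; move: es; rewrite /s; lra.
have w0 : 0 < w by exact: lt_le_trans ws.
have A1 : e_ n / w <= eps / 2.
  rewrite ler_pdivrMr//; apply: le_trans ee _; rewrite mulrAC ler_wpM2l//.
    by rewrite divr_ge0// ltW.
  by rewrite ge_min ws.
have A2 : e_ n / `|y| <= eps / 2.
  rewrite ler_pdivrMr//; apply: le_trans ee _; rewrite mulrAC ler_wpM2l//.
    by rewrite divr_ge0// ltW.
  by rewrite ge_min lexx orbT.
have B1 := dramp_ge en w0; have /andP[_ B1'] := dramp_le w en.
have B2 := dramp_ge en y0'; have /andP[B3 B2'] := dramp_le `|y| en.
have E : dtent (e_ n) l y = - Num.sg y * (dramp (e_ n) w * dramp (e_ n) `|y|).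
  rewrite /dtent -/w; case: (ltgtP y 0) y0 => // yy _.
    by rewrite (@dramp_le0 _ y) ?(ltW yy)// ltr0_sg// ltr0_norm// subr0; ring.
  by rewrite (@dramp_le0 _ (- y)) ?oppr_le0 ?(ltW yy)// gtr0_sg// gtr0_norm//; ring.
rewrite E.
set p := dramp _ w in B1 B1' *; set q := dramp _ `|y| in B2 B2' B3 *.
have -> : - Num.sg y - - Num.sg y * (p * q) = - Num.sg y * ((1 - p) + p * (1 - q)).
  by ring.
rewrite normrM normrN normr_sg y0 mul1r.
have p0 : 0 <= p by have /andP[] := dramp_le w en.
have q1 : 0 <= 1 - q by lra.
have pq : p * (1 - q) <= 1 - q by rewrite ler_piMl.
have pq0 : 0 <= p * (1 - q) by rewrite mulr_ge0.
by rewrite ger0_norm; lra.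
Qed.

(** A [C^1] approximation of the indicator of the open interval of radius [l]: [x / (x + e)] is 0 at
    0 and tends to 1 where the tent stays away from 0, so the support remains that of the tent. *)
Definition plateau e l y := tent e l y / (tent e l y + e).
Definition dplateau e l y := e * dtent e l y / (tent e l y + e) ^+ 2.

Lemma is_derive_plateau e l y : 0 < e -> 0 <= l ->
  is_derive y 1 (plateau e l) (dplateau e l y).
Proof.
move=> e0 l0; have /andP[t0 _] := tent_le y e0 l0.
have q0 : tent e l y + e != 0 by rewrite gt_eqF// ltr_wpDl.
have ht := is_derive_tent l y e0.
have hd : is_derive y 1 (fun x => tent e l x + e) (dtent e l y).
  by apply: is_derive_eq (is_deriveD ht (is_derive_cst e y 1)) _; rewrite addr0.
have hi := @is_deriveV _ (fun x => tent e l x + e) y _ _ q0 hd.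
have h := is_deriveM ht hi.
apply: is_derive_eq h _; rewrite /dplateau /GRing.scale /=.
by field.
Qed.

Lemma continuous_tent e l : 0 < e -> continuous (tent e l).
Proof.
move=> e0 t; apply: differentiable_continuous; apply/derivable1_diffP.
by have := is_derive_tent l t e0.
Qed.

Lemma continuous_dplateau e l : 0 < e -> 0 <= l -> continuous (dplateau e l).
Proof.
move=> e0 l0 y; have /andP[t0 _] := tent_le y e0 l0.
have q0 : tent e l y + e != 0 by rewrite gt_eqF// ltr_wpDl.
apply: cvgM; first by apply: cvgMr; exact: continuous_dtent.
apply: cvgV; first by rewrite expf_neq0.
have cq : tent e l x + e @[x --> y] --> tent e l y + e.
  by apply: cvgD; [exact: continuous_tent|exact: cvg_cst].
by rewrite expr2; under eq_fun do rewrite expr2; exact: cvgM.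
Qed.

Lemma plateau_le e l y : 0 < e -> 0 <= l -> 0 <= plateau e l y <= 1.
Proof.
move=> e0 l0; have /andP[t0 _] := tent_le y e0 l0.
have q0 : 0 < tent e l y + e by rewrite ltr_wpDl.
by rewrite /plateau divr_ge0 ?(ltW q0)//= ler_pdivrMr// mul1r lerDl ltW.
Qed.

Lemma plateau_out e l y : 0 < e -> l - e <= `|y| -> plateau e l y = 0.
Proof. by move=> e0 ly; rewrite /plateau tent_out// mul0r. Qed.

Lemma plateau_cvg (e_ : nat -> R) l y : (forall n, 0 < e_ n) ->
  e_ n @[n --> \oo] --> 0 -> `|y| < l ->
  plateau (e_ n) l y @[n --> \oo] --> (1 : R).
Proof.
move=> e0 ecvg yl; apply/cvgrPdist_le => eps eps0.
pose s := (l - `|y|) / 4.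
have s0 : 0 < s by rewrite divr_gt0// subr_gt0.
have d0 : 0 < Num.min s (eps * s) by rewrite lt_min s0 mulr_gt0.
move/cvgrPdist_le : ecvg => /(_ _ d0); apply: filterS => n.
have en := e0 n; rewrite sub0r normrN gtr0_norm// le_min => /andP[es ee].
have ts : s <= tent (e_ n) l y + e_ n.
  have := ramp_ge (l - 2 * e_ n - ramp (e_ n) y - ramp (e_ n) (- y)) en.
  rewrite -/(tent (e_ n) l y).
  by have := ramp_arg_ge l y en; move: es; rewrite /s; lra.
have q0 : 0 < tent (e_ n) l y + e_ n by exact: lt_le_trans ts.
have -> : 1 - plateau (e_ n) l y = e_ n / (tent (e_ n) l y + e_ n).
  by rewrite /plateau; field; rewrite gt_eqF.
rewrite ger0_norm; last by rewrite divr_ge0// ltW.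
by rewrite ler_pdivrMr//; apply: le_trans ee _; rewrite ler_pM2l.
Qed.

End smooth_bumps.

(** * Test fields of product form *)

Section tensor_fields.
Context {R : realType}.
Implicit Types (s t : R -> R) (x : R * R).

Lemma is_derive_tensor1 s (ds : R) t x : is_derive x.1 1 s ds ->
  is_derive x (e1 R) (fun z => s z.1 * t z.2) (ds * t x.2).
Proof.
move=> [dsx <-].
have cs : h^-1 *: (((fun z => s z.1 * t z.2) \o shift x) (h *: e1 R) -
    s x.1 * t x.2) @[h --> 0^'] --> 'D_1 s x.1 * t x.2.
  rewrite (_ : (fun h => _) = (fun h : R =>
      (h^-1 *: ((s \o shift x.1) (h *: 1) - s x.1)) * t x.2)).
    by apply: cvgMl; exact: dsx.
  apply/funext => h; rewrite /= /shift /e1 /GRing.scale /= mulr0 add0r.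
  by rewrite -mulrBl mulrA.
by apply: DeriveDef; [apply/cvg_ex; eexists; exact: cs|exact: cvg_lim].
Qed.

Lemma is_derive_tensor2 s t (dt : R) x : is_derive x.2 1 t dt ->
  is_derive x (e2 R) (fun z => s z.1 * t z.2) (s x.1 * dt).
Proof.
move=> [dtx <-].
have cs : h^-1 *: (((fun z => s z.1 * t z.2) \o shift x) (h *: e2 R) -
    s x.1 * t x.2) @[h --> 0^'] --> s x.1 * 'D_1 t x.2.
  rewrite (_ : (fun h => _) = (fun h : R =>
      s x.1 * (h^-1 *: ((t \o shift x.2) (h *: 1) - t x.2)))).
    by apply: cvgMr; exact: dtx.
  apply/funext => h; rewrite /= /shift /e2 /GRing.scale /= mulr0 add0r.
  by rewrite -mulrBr mulrCA.
by apply: DeriveDef; [apply/cvg_ex; eexists; exact: cs|exact: cvg_lim].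
Qed.

(** Total variations are taken on open rectangles and integrals on the half-open [rect]; fields
    supported in [orect] have zero divergence on the rest of [rect]. *)
Definition orect (a b c d : R) : set (R * R) :=
  [set z | (a < z.1 < b) && (c < z.2 < d)].

Lemma orectE a b c d : orect a b c d = `]a, b[%classic `*` `]c, d[%classic.
Proof.
by apply/seteqP; split=> z; rewrite /orect /= !in_itv /=; [move=> /andP|case=> -> ->].
Qed.

Lemma open_orect a b c d : open (orect a b c d).
Proof.
rewrite orectE; have -> : `]a, b[%classic `*` `]c, d[%classic =
    (fst @^-1` `]a, b[%classic) `&` (snd @^-1` `]c, d[%classic) :> set (R * R) by [].
apply: openI; apply: open_comp; try exact: interval_open.
  by move=> z _; exact: cvg_fst.
by move=> z _; exact: cvg_snd.
Qed.

Lemma orect_sub_rect a b c d : orect a b c d `<=` (rect a b c d : set (R * R)).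
Proof.
move=> z /andP[/andP[h1 h2] /andP[h3 h4]]; apply/rectE.
by rewrite (ltW h1) h2 (ltW h3).
Qed.

(** The margin [e] at both ends is what makes the product of two bumps compactly supported inside
    the open rectangle. *)
Definition bump (a b : R) (s ds : R -> R) := [/\ forall y : R, is_derive y (1 : R) s (ds y),
  continuous ds & exists2 e : R, 0 < e & forall y, s y != 0 -> a + e <= y <= b - e].

Lemma bump_continuous a b s ds : bump a b s ds -> continuous s.
Proof.
move=> [sd _ _] y; apply: differentiable_continuous; apply/derivable1_diffP.
by have := sd y.
Qed.

Lemma C1_tensor a b c d s ds t dt : bump a b s ds -> bump c d t dt ->
  C1 (fun z => s z.1 * t z.2).
Proof.
move=> bs bt; have cs := bump_continuous bs; have ct := bump_continuous bt.
have [hs cds _] := bs; have [ht cdt _] := bt.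
have D1 : 'D_(e1 R) (fun z => s z.1 * t z.2) = (fun z => ds z.1 * t z.2).
  by apply/funext => z; rewrite (@derive_val _ _ _ _ _ _ _ (is_derive_tensor1 t (hs z.1))).
have D2 : 'D_(e2 R) (fun z => s z.1 * t z.2) = (fun z => s z.1 * dt z.2).
  by apply/funext => z; rewrite (@derive_val _ _ _ _ _ _ _ (is_derive_tensor2 s (ht z.2))).
have cmp1 (f : R -> R) (z : R * R) : continuous f -> f w.1 @[w --> z] --> f z.1.
  by move=> cf; apply: continuous_comp; [exact: cvg_fst|exact: cf].
have cmp2 (f : R -> R) (z : R * R) : continuous f -> f w.2 @[w --> z] --> f z.2.
  by move=> cf; apply: continuous_comp; [exact: cvg_snd|exact: cf].
split=> [z|z| |].
- by have [] := is_derive_tensor1 t (hs z.1).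
- by have [] := is_derive_tensor2 s (ht z.2).
- by rewrite D1 => z; apply: cvgM; [exact: (cmp1 ds)|exact: (cmp2 t)].
- by rewrite D2 => z; apply: cvgM; [exact: (cmp1 s)|exact: (cmp2 dt)].
Qed.

Lemma tensor_support a b c d s ds t dt (A : set (R * R)) :
  bump a b s ds -> bump c d t dt ->
  A `<=` [set z | s z.1 * t z.2 != 0] ->
  compact (closure A) /\ closure A `<=` orect a b c d.
Proof.
move=> [_ _ [e e0 se]] [_ _ [e' e'0 te]] sub.
pose Q : set (R * R) := `[a + e, b - e]%classic `*` `[c + e', d - e']%classic.
have cQ : compact Q by apply: compact_setX; exact: segment_compact.
have clQ : closed Q.
  have -> : Q = (fst @^-1` `[a + e, b - e]%classic) `&`
      (snd @^-1` `[c + e', d - e']%classic) :> set (R * R) by [].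
  apply: closedI; apply: closed_comp; try exact: interval_closed.
    by move=> z _; exact: cvg_fst.
  by move=> z _; exact: cvg_snd.
have AQ : closure A `<=` Q.
  rewrite ((closure_id Q).1 clQ); apply: closureS => z /sub /=; rewrite mulf_eq0 negb_or => /andP[sz tz].
  by split; rewrite /= in_itv /=; [exact: se|exact: te].
split; first by apply: subclosed_compact cQ AQ; exact: closed_closure.
move=> z /AQ [/=]; rewrite !in_itv /= => /andP[h1 h2] /andP[h3 h4].
by apply/andP; split; apply/andP; split; lra.
Qed.

Lemma test_field_tensor1 a b c d s ds t dt : bump a b s ds -> bump c d t dt ->
  (forall y, `|s y| <= 1) -> (forall y, `|t y| <= 1) ->
  test_field (orect a b c d) (fun z => (s z.1 * t z.2, 0)).
Proof.
move=> bs bt s1 t1.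
have [|cA subA] := tensor_support (A := [set z | (s z.1 * t z.2, 0) != 0 :> R * R]) bs bt.
  by move=> z /=; apply: contra_neq => ->.
split=> //; first exact: C1_tensor bs bt.
  exact: C1_cst.
move=> z /=; rewrite expr0n addr0 sqrtr_sqr normrM.
exact: mulr_ile1.
Qed.

Lemma test_field_tensor2 a b c d s ds t dt : bump a b s ds -> bump c d t dt ->
  (forall y, `|s y| <= 1) -> (forall y, `|t y| <= 1) ->
  test_field (orect a b c d) (fun z => (0, s z.1 * t z.2)).
Proof.
move=> bs bt s1 t1.
have [|cA subA] := tensor_support (A := [set z | (0, s z.1 * t z.2) != 0 :> R * R]) bs bt.
  by move=> z /=; apply: contra_neq => ->.
split=> //; [exact: C1_cst|exact: C1_tensor bs bt|].
move=> z /=; rewrite expr0n add0r sqrtr_sqr normrM.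
exact: mulr_ile1.
Qed.

Lemma divergence_tensor1 s (ds : R) t (z : R * R) : is_derive z.1 1 s ds ->
  divergence (fun z => (s z.1 * t z.2, 0)) z = ds * t z.2.
Proof.
move=> sd; rewrite /divergence /= (@derive_val _ _ _ _ _ _ _ (is_derive_tensor1 t sd)).
by rewrite (_ : 'D_(e2 R) _ z = 0) ?addr0//; exact: derive_cst.
Qed.

Lemma divergence_tensor2 s t (dt : R) (z : R * R) : is_derive z.2 1 t dt ->
  divergence (fun z => (0, s z.1 * t z.2)) z = s z.1 * dt.
Proof.
move=> td; rewrite /divergence /= (@derive_val _ _ _ _ _ _ _ (is_derive_tensor2 s td)).
by rewrite (_ : 'D_(e1 R) _ z = 0) ?add0r//; exact: derive_cst.
Qed.

Lemma is_derive_center (f : R -> R) (df k m y : R) : is_derive (y - m) 1 f df ->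
  is_derive y 1 (fun u => k * f (u - m)) (k * df).
Proof.
move=> fd.
have hg : is_derive y 1 (fun u : R => u - m) 1.
  by apply: is_derive_eq (is_deriveB (is_derive_id y 1) (is_derive_cst m y 1)) _; rewrite subr0.
have h := is_deriveZ k (@is_derive1_comp _ f (fun u : R => u - m) _ _ _ fd hg).
by apply: is_derive_eq h _; rewrite ?/GRing.scale /= ?mulr1 ?mul1r.
Qed.

Let mid_out (a b e y : R) : y < a + e \/ b - e < y -> (b - a) / 2 - e <= `|y - mid a b|.
Proof.
have h1 := ler_norm (y - mid a b); have h2 := ler_norm (mid a b - y).
by rewrite distrC in h2; rewrite /mid in h1 h2 *; case; lra.
Qed.

Let centered_support (a b e k : R) (f : R -> R) : 0 < e ->
  (forall y, (b - a) / 2 - e <= `|y| -> f y = 0) ->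
  exists2 e', 0 < e' & forall y, k * f (y - mid a b) != 0 -> a + e' <= y <= b - e'.
Proof.
move=> e0 f0; exists e => // y; apply: contraNT; rewrite negb_and -!ltNge => /orP ho.
by rewrite f0 ?mulr0//; exact: mid_out.
Qed.

Let continuous_center (f : R -> R) (k m : R) : continuous f ->
  continuous (fun y => k * f (y - m)).
Proof.
move=> cf y; apply: cvgMr; apply: continuous_comp; last exact: cf.
by apply: cvgB; [exact: cvg_id|exact: cvg_cst].
Qed.

Lemma bump_tent (a b e k : R) : 0 < e ->
  bump a b (fun y => k * tent e ((b - a) / 2) (y - mid a b))
           (fun y => k * dtent e ((b - a) / 2) (y - mid a b)).
Proof.
move=> e0; split.
- by move=> y; apply: is_derive_center; exact: is_derive_tent.
- exact/continuous_center/continuous_dtent.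
- by apply: (@centered_support a b e k (tent e _) e0) => y; exact: tent_out.
Qed.

Lemma bump_plateau (a b e k : R) : a <= b -> 0 < e ->
  bump a b (fun y => k * plateau e ((b - a) / 2) (y - mid a b))
           (fun y => k * dplateau e ((b - a) / 2) (y - mid a b)).
Proof.
move=> ab e0; have l0 : 0 <= (b - a) / 2 by lra.
split.
- by move=> y; apply: is_derive_center; exact: is_derive_plateau.
- exact/continuous_center/continuous_dplateau.
- by apply: (@centered_support a b e k (plateau e _) e0) => y; exact: plateau_out.
Qed.

End tensor_fields.

(** * Comparing the two halves of a rectangle *)

Section poincare.
Context {R : realType}.
Local Notation plane := (measurableTypeR R * measurableTypeR R)%type.
Local Notation mu := (lebesgue2 R).
Implicit Types (U : plane -> R) (P : set (R * R)).

Lemma finite_mset_sub (A B : set plane) : measurable A -> A `<=` B ->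
  finite_mset mu B -> finite_mset mu A.
Proof.
move=> mA AB [mB Bfin]; split=> //; apply: le_lt_trans Bfin.
by apply: le_measure => //; rewrite inE.
Qed.

Lemma finite_mset_orect (a b c d : R) : a <= b -> c <= d ->
  finite_mset mu (orect a b c d).
Proof.
move=> ab cd; apply: finite_mset_sub (finite_mset_rect ab cd).
- by apply: measurable_open_plane; exact: open_orect.
- exact: orect_sub_rect.
Qed.

(** The duality inequality extends to bounded limits of divergences, which need not be divergences
    of [C^1] fields: this is how genuine tents become usable. *)
Lemma TV_limit P (D : set plane) U (phi : nat -> R * R -> R * R) (g : plane -> R) (M : R) :
  finite_mset mu P -> finite_mset mu D -> P `<=` D -> bounded_mfun U ->
  (TV P U < +oo)%E -> (forall n, test_field P (phi n)) ->
  (forall n z, `|divergence (phi n) z| <= M) -> bounded_mfun g ->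
  {ae mu, forall z, D z -> divergence (phi n) z @[n --> \oo] --> g z} ->
  \int[mu]_(z in D) (U z * g z) <= fine (TV P U).
Proof.
move=> fP fD PD bU TVfin tphi phiM bg cvg_g.
have [mU [N UN]] := bU.
have TVfinN : TV P U \is a fin_num by rewrite ge0_fin_numE// TV_ge0.
have lim : \int[mu]_(z in D) (U z * divergence (phi n) z) @[n --> \oo] -->
    \int[mu]_(z in D) (U z * g z).
  apply: (@bounded_convergence _ _ _ _ _ _ _ (N * M)) => //.
  - move=> n; exact: (bounded_mfunM bU (bounded_divergence (tphi n))).1.
  - exact: (bounded_mfunM bU bg).1.
  - by move=> n z; rewrite normrM; apply: ler_pM.
  - by apply: filterS cvg_g => z cz Dz; apply: cvgMr; exact: cz.
apply: (ler_cvg_to lim (cvg_cst _)); apply: nearW => n.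
rewrite /= -(Rint_divergence_sub U PD (tphi n)) -lee_fin (fineK TVfinN).
exact: (TV_ge fP bU (tphi n)).
Qed.

Let null_line1 (a : R) : mu.-negligible [set z : plane | z.1 = a].
Proof.
exists ([set a] `*` setT); split.
- by apply: measurableX => //; exact: measurable_set1.
- by rewrite lebesgue2X ?lebesgue_measure_set1 ?mul0e//; exact: measurable_set1.
- by move=> z /= ->.
Qed.

Let null_line2 (a : R) : mu.-negligible [set z : plane | z.2 = a].
Proof.
exists (setT `*` [set a]); split.
- by apply: measurableX => //; exact: measurable_set1.
- by rewrite lebesgue2X ?lebesgue_measure_set1 ?mule0//; exact: measurable_set1.
- by move=> z /= ->.
Qed.

(** The half-open rectangle contains its left and bottom edges, where the bumps vanish, and the
    slope of a tent jumps on a central line. Discarding all four lines serves both directions of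
    cutting. *)
Let ae_off_lines (a b c d : R) (Q : plane -> Prop) :
  (forall z, z.1 <> a -> z.1 <> mid a b -> z.2 <> c -> z.2 <> mid c d ->
    rect a b c d z -> Q z) ->
  {ae mu, forall z, rect a b c d z -> Q z}.
Proof.
move=> hQ; apply: (@negligibleS _ _ _ _ ([set z : plane | z.1 = a] `|`
  [set z | z.1 = mid a b] `|` ([set z | z.2 = c] `|` [set z | z.2 = mid c d]))).
  move=> z /= nQ; apply: contrapT => /not_orP[/not_orP[n1 n2] /not_orP[n3 n4]].
  by apply: nQ => rz; exact: hQ.
by apply: negligibleU; apply: negligibleU;
  first [exact: null_line1|exact: null_line2].
Qed.

Let eps_ (n : nat) : R := n.+1%:R^-1.
Let eps_gt0 n : 0 < eps_ n. Proof. by rewrite invr_gt0 ltr0n. Qed.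
Let eps_cvg : eps_ n @[n --> \oo] --> 0. Proof. exact: cvg_harmonic. Qed.

Let Rint_sign (D1 D2 : set plane) U k : finite_mset mu D1 -> finite_mset mu D2 ->
  [disjoint D1 & D2] -> bounded_mfun U ->
  \int[mu]_(z in D1 `|` D2) (U z * (k * (\1_D1 z - \1_D2 z)))
  = k * (\int[mu]_(z in D1) U z - \int[mu]_(z in D2) U z).
Proof.
move=> f1 f2 dj bU.
have b1 := bounded_mfun_indic (R := R) f1.1.
have b2 := bounded_mfun_indic (R := R) f2.1.
have nI z : D1 z -> ~ D2 z.
  by move=> h1 h2; have /disj_set2P := dj; rewrite -subset0 => /(_ z); apply.
rewrite RintU//; last by apply/bounded_mfunM/bounded_mfunZ/bounded_mfunB.
have -> : \int[mu]_(z in D1) (U z * (k * (\1_D1 z - \1_D2 z))) =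
    \int[mu]_(z in D1) (k * U z).
  apply: eq_Rintegral => z /[!inE] h1; rewrite !indicE mem_set// memNset; last exact: nI.
  by rewrite subr0 mulr1 mulrC.
have -> : \int[mu]_(z in D2) (U z * (k * (\1_D1 z - \1_D2 z))) =
    \int[mu]_(z in D2) (- k * U z).
  apply: eq_Rintegral => z /[!inE] h1; rewrite !indicE memNset; last by move=> /nI.
  by rewrite mem_set// sub0r !mulrN mulr1 mulNr mulrC.
by rewrite !RintZ//; ring.
Qed.

Let TV_slab_real U (D1 D2 : set plane) P (l : R) :
  finite_mset mu P -> bounded_mfun U -> 0 < l ->
  (forall k, `|k| = 1 -> k / l * (\int[mu]_(z in D1) U z - \int[mu]_(z in D2) U z)
    <= fine (TV P U)) ->
  `|\int[mu]_(z in D1) U z - \int[mu]_(z in D2) U z| <= l * fine (TV P U).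
Proof.
move=> fP bU l0 h.
have h1 := h 1 (normr1 _); have h2 := h (-1) (normrN1 _).
rewrite mul1r ler_pdivrMl// in h1.
rewrite mulN1r mulNr -mulrN ler_pdivrMl// in h2.
by rewrite ler_norml; apply/andP; split; lra.
Qed.

(** A horizontal field with a tent profile in the first coordinate has opposite constant divergences
    on the two halves, so pairing [U] with it measures the difference of the integrals. A plateau in
    the second coordinate cuts the field off near the horizontal edges. *)
Lemma TV_slab1 U (a b c d : R) : a <= b -> c <= d -> bounded_mfun U ->
  (TV (orect a b c d) U < +oo)%E ->
  `|\int[mu]_(z in rect a (mid a b) c d) U z - \int[mu]_(z in rect (mid a b) b c d) U z|
  <= (b - a) / 2 * fine (TV (orect a b c d) U).
Proof.
move=> ab cd bU TVfin; have fP := finite_mset_orect ab cd.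
have tv0 : 0 <= fine (TV (orect a b c d) U) by rewrite fine_ge0// TV_ge0.
have /andP[am mb] := mid_le ab.
(* Flat rectangles are settled apart, since the construction divides by half a side. *)
move: ab; rewrite le_eqVlt => /predU1P[ab|ab].
  have -> : mid a b = a by rewrite /mid -ab; field.
  by rewrite -ab !subrr normr0 mul0r mul0r.
move: cd; rewrite le_eqVlt => /predU1P[cd|cd].
  have e0 (u v : R) : rect u v c d = set0.
    apply/seteqP; split=> // z /rectE /andP[_ /andP[h1]].
    by rewrite -cd ltNge h1.
  by rewrite !e0 subrr normr0 mulr_ge0// divr_ge0// subr_ge0 ltW.
have l0 : 0 < (b - a) / 2 by rewrite divr_gt0// subr_gt0.
have l'0 : 0 < (d - c) / 2 by rewrite divr_gt0// subr_gt0.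
set l := (b - a) / 2 in l0 *; set l' := (d - c) / 2 in l'0 *.
have f1 := finite_mset_rect am (ltW cd); have f2 := finite_mset_rect mb (ltW cd).
have dj := @rect_disjointl R a b c d (mid a b).
apply: TV_slab_real => // k k1.
rewrite -Rint_sign// -rect_splitl//.
have li0 : 0 <= l^-1 by rewrite invr_ge0 ltW.
have kl : `|k / l| = l^-1 by rewrite normrM k1 mul1r ger0_norm.
(* The tent has height at most [l], so dividing by [l] gives the unit bound, and [k] is the sign
   under test. The slope tends to [k / l] left of the middle and to [- k / l] right of it. *)
pose s n (y : R) := k / l * tent (eps_ n) l (y - mid a b).
pose t n (y : R) := 1 * plateau (eps_ n) l' (y - mid c d).
have bs n := bump_tent a b (k / l) (eps_gt0 n).
have bt n := bump_plateau 1 (ltW cd) (eps_gt0 n).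
have divE n z : divergence (fun z => (s n z.1 * t n z.2, 0)) z =
    k / l * dtent (eps_ n) l (z.1 - mid a b) * (1 * plateau (eps_ n) l' (z.2 - mid c d)).
  by have [sd _ _] := bs n; exact: (divergence_tensor1 (t n) (sd z.1)).
have t1 n y : `|t n y| <= 1.
  rewrite /t mul1r; have /andP[p0 p1] := plateau_le (y - mid c d) (eps_gt0 n) (ltW l'0).
  by rewrite ger0_norm.
apply: (TV_limit (phi := fun n z => (s n z.1 * t n z.2, 0)) (M := l^-1) fP
  (finite_mset_rect (ltW ab) (ltW cd)) (@orect_sub_rect _ a b c d) bU TVfin).
- move=> n; apply: (test_field_tensor1 (bs n) (bt n)) => y; last by have := t1 n y.
  have /andP[p0 p1] := tent_le (y - mid a b) (eps_gt0 n) (ltW l0).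
  by rewrite normrM kl ger0_norm// ler_pdivrMl// mulr1.
- move=> n z; rewrite divE normrM [X in X * _]normrM kl.
  rewrite -[leRHS]mulr1 -[X in _ <= X * 1]mulr1.
  apply: ler_pM; [exact: mulr_ge0|exact: normr_ge0| |exact: t1].
  by apply: ler_pM => //; exact: dtent_le.
- apply/bounded_mfunZ/bounded_mfunB; apply: bounded_mfun_indic; exact: measurable_rect.
- apply: ae_off_lines => z z1 z2 z3 z4 /rectE /andP[/andP[za zb] /andP[zc zd]].
  under eq_fun do rewrite divE.
  have -> : \1_(rect a (mid a b) c d) z - \1_(rect (mid a b) b c d) z =
      - Num.sg (z.1 - mid a b) * (1 * 1) :> R.
    rewrite !indicE; have [zm|zm|zm] := ltgtP z.1 (mid a b); last by case: z2.
    - rewrite mem_set; last by apply/rectE; rewrite za zm zc zd.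
      rewrite memNset; last by move=> /rectE; rewrite leNgt zm.
      by rewrite ltr0_sg ?subr_lt0// opprK subr0 !mulr1.
    - rewrite memNset; last by move=> /rectE; rewrite (ltNge z.1) (ltW zm) andbF.
      rewrite mem_set; last by apply/rectE; rewrite (ltW zm) zb zc zd.
      by rewrite gtr0_sg ?subr_gt0// sub0r !mulr1.
  move/eqP: z1; rewrite eq_sym => z1; have za' : a < z.1 by rewrite lt_neqAle z1.
  move/eqP: z3; rewrite eq_sym => z3; have zc' : c < z.2 by rewrite lt_neqAle z3.
  have -> : k / l * (- Num.sg (z.1 - mid a b) * (1 * 1)) =
      k / l * - Num.sg (z.1 - mid a b) * (1 * 1) by ring.
  apply: (@cvgM _ _ _ _ (fun n => k / l * dtent (eps_ n) l (z.1 - mid a b))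
    (fun n => 1 * plateau (eps_ n) l' (z.2 - mid c d))); apply: cvgMr.
    apply: dtent_cvg => //; first by rewrite subr_eq0; apply/eqP.
    by rewrite ltr_norml /l /mid; apply/andP; split; lra.
  apply: plateau_cvg => //.
  by rewrite ltr_norml /l' /mid; apply/andP; split; lra.
Qed.

(** The same field with the coordinates exchanged: vertical, with the tent in the second
    coordinate. *)
Lemma TV_slab2 U (a b c d : R) : a <= b -> c <= d -> bounded_mfun U ->
  (TV (orect a b c d) U < +oo)%E ->
  `|\int[mu]_(z in rect a b c (mid c d)) U z - \int[mu]_(z in rect a b (mid c d) d) U z|
  <= (d - c) / 2 * fine (TV (orect a b c d) U).
Proof.
move=> ab cd bU TVfin; have fP := finite_mset_orect ab cd.
have tv0 : 0 <= fine (TV (orect a b c d) U) by rewrite fine_ge0// TV_ge0.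
have /andP[cm md] := mid_le cd.
move: cd; rewrite le_eqVlt => /predU1P[cd|cd].
  have -> : mid c d = c by rewrite /mid -cd; field.
  by rewrite -cd !subrr normr0 mul0r mul0r.
move: ab; rewrite le_eqVlt => /predU1P[ab|ab].
  have e0 (u v : R) : rect a b u v = set0.
    apply/seteqP; split=> // z /rectE /andP[/andP[h1 +] _].
    by rewrite -ab ltNge h1.
  by rewrite !e0 subrr normr0 mulr_ge0// divr_ge0// subr_ge0 ltW.
have l0 : 0 < (b - a) / 2 by rewrite divr_gt0// subr_gt0.
have l'0 : 0 < (d - c) / 2 by rewrite divr_gt0// subr_gt0.
set l := (b - a) / 2 in l0 *; set l' := (d - c) / 2 in l'0 *.
have f1 := finite_mset_rect (ltW ab) cm; have f2 := finite_mset_rect (ltW ab) md.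
have dj := @rect_disjointr R a b c d (mid c d).
apply: TV_slab_real => // k k1.
rewrite -Rint_sign// -rect_splitr//.
have li0 : 0 <= l'^-1 by rewrite invr_ge0 ltW.
have kl : `|k / l'| = l'^-1 by rewrite normrM k1 mul1r ger0_norm.
pose s n (y : R) := 1 * plateau (eps_ n) l (y - mid a b).
pose t n (y : R) := k / l' * tent (eps_ n) l' (y - mid c d).
have bs n := bump_plateau 1 (ltW ab) (eps_gt0 n).
have bt n := bump_tent c d (k / l') (eps_gt0 n).
have divE n z : divergence (fun z => (0, s n z.1 * t n z.2)) z =
    1 * plateau (eps_ n) l (z.1 - mid a b) * (k / l' * dtent (eps_ n) l' (z.2 - mid c d)).
  by have [td _ _] := bt n; exact: (divergence_tensor2 (s n) (td z.2)).
have s1 n y : `|s n y| <= 1.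
  rewrite /s mul1r; have /andP[p0 p1] := plateau_le (y - mid a b) (eps_gt0 n) (ltW l0).
  by rewrite ger0_norm.
apply: (TV_limit (phi := fun n z => (0, s n z.1 * t n z.2)) (M := l'^-1) fP
  (finite_mset_rect (ltW ab) (ltW cd)) (@orect_sub_rect _ a b c d) bU TVfin).
- move=> n; apply: (test_field_tensor2 (bs n) (bt n)) => y; first by have := s1 n y.
  have /andP[p0 p1] := tent_le (y - mid c d) (eps_gt0 n) (ltW l'0).
  by rewrite normrM kl ger0_norm// ler_pdivrMl// mulr1.
- move=> n z; rewrite divE normrM [X in _ * X]normrM kl.
  rewrite -[leRHS]mul1r -[X in _ <= 1 * X]mulr1.
  apply: ler_pM; [exact: normr_ge0|exact: mulr_ge0|exact: s1|].
  by apply: ler_pM => //; exact: dtent_le.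
- apply/bounded_mfunZ/bounded_mfunB; apply: bounded_mfun_indic; exact: measurable_rect.
- apply: ae_off_lines => z z1 z2 z3 z4 /rectE /andP[/andP[za zb] /andP[zc zd]].
  under eq_fun do rewrite divE.
  have -> : \1_(rect a b c (mid c d)) z - \1_(rect a b (mid c d) d) z =
      (1 * 1) * - Num.sg (z.2 - mid c d) :> R.
    rewrite !indicE; have [zm|zm|zm] := ltgtP z.2 (mid c d); last by case: z4.
    - rewrite mem_set; last by apply/rectE; rewrite za zb zc zm.
      rewrite memNset; last by move=> /rectE; rewrite (leNgt (mid c d)) zm andbF.
      by rewrite ltr0_sg ?subr_lt0// opprK subr0 !mulr1.
    - rewrite memNset; last by move=> /rectE; rewrite (ltNge z.2) (ltW zm) !andbF.
      rewrite mem_set; last by apply/rectE; rewrite (ltW zm) za zb zd.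
      by rewrite gtr0_sg ?subr_gt0// sub0r !mul1r.
  move/eqP: z1; rewrite eq_sym => z1; have za' : a < z.1 by rewrite lt_neqAle z1.
  move/eqP: z3; rewrite eq_sym => z3; have zc' : c < z.2 by rewrite lt_neqAle z3.
  have -> : k / l' * (1 * 1 * - Num.sg (z.2 - mid c d)) =
      1 * 1 * (k / l' * - Num.sg (z.2 - mid c d)) by ring.
  apply: (@cvgM _ _ _ _ (fun n => 1 * plateau (eps_ n) l (z.1 - mid a b))
    (fun n => k / l' * dtent (eps_ n) l' (z.2 - mid c d))); apply: cvgMr.
    apply: plateau_cvg => //.
    by rewrite ltr_norml /l /mid; apply/andP; split; lra.
  apply: dtent_cvg => //; first by rewrite subr_eq0; apply/eqP.
  by rewrite ltr_norml /l' /mid; apply/andP; split; lra.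
Qed.

End poincare.

(** * The Poincare inequality and compactness in L^1 *)

Section poincare_inequality.
Context {R : realType}.
Local Notation plane := (measurableTypeR R * measurableTypeR R)%type.
Local Notation mu := (lebesgue2 R).
Implicit Types (U : plane -> R) (P Q : set (R * R)).

Lemma TV_split P Q (S : set (R * R)) U : finite_mset mu S -> bounded_mfun U ->
  open P -> open Q -> P `<=` S -> Q `<=` S -> P `&` Q = set0 ->
  (TV S U < +oo)%E ->
  [/\ (TV P U < +oo)%E, (TV Q U < +oo)%E &
      fine (TV P U) + fine (TV Q U) <= fine (TV S U)].
Proof.
move=> fS bU oP oQ PS QS PQ Sfin.
have fP := finite_mset_sub (measurable_open_plane oP) PS fS.
have fQ := finite_mset_sub (measurable_open_plane oQ) QS fS.
have P0 := TV_ge0 fP bU; have Q0 := TV_ge0 fQ bU; have S0 := TV_ge0 fS bU.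
have h := TV_superadditive fS bU oP oQ PS QS PQ Sfin.
have Pfin : (TV P U < +oo)%E by apply: le_lt_trans Sfin; apply: le_trans h; rewrite leeDl.
have Qfin : (TV Q U < +oo)%E by apply: le_lt_trans Sfin; apply: le_trans h; rewrite leeDr.
split=> //; rewrite -fineD ?ge0_fin_numE//; apply: fine_le => //.
- by rewrite fin_numD !ge0_fin_numE// Pfin.
- by rewrite ge0_fin_numE.
Qed.

Lemma TV_orect_splitl (a b c d : R) U : a <= b -> c <= d -> bounded_mfun U ->
  (TV (orect a b c d) U < +oo)%E ->
  [/\ (TV (orect a (mid a b) c d) U < +oo)%E, (TV (orect (mid a b) b c d) U < +oo)%E &
      fine (TV (orect a (mid a b) c d) U) + fine (TV (orect (mid a b) b c d) U)
      <= fine (TV (orect a b c d) U)].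
Proof.
move=> ab cd bU; have /andP[am mb] := mid_le ab.
apply: TV_split; rewrite //.
- exact: finite_mset_orect.
- exact: open_orect.
- exact: open_orect.
- by move=> z /andP[/andP[h1 h2] h3]; rewrite /orect /= h1 h3 (lt_le_trans h2).
- by move=> z /andP[/andP[h1 h2] h3]; rewrite /orect /= h2 h3 (le_lt_trans am).
- apply/seteqP; split=> // z [/andP[/andP[_ h] _] /andP[/andP[h' _] _]].
  by have := lt_trans h h'; rewrite ltxx.
Qed.

Lemma TV_orect_splitr (a b c d : R) U : a <= b -> c <= d -> bounded_mfun U ->
  (TV (orect a b c d) U < +oo)%E ->
  [/\ (TV (orect a b c (mid c d)) U < +oo)%E, (TV (orect a b (mid c d) d) U < +oo)%E &
      fine (TV (orect a b c (mid c d)) U) + fine (TV (orect a b (mid c d) d) U)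
      <= fine (TV (orect a b c d) U)].
Proof.
move=> ab cd bU; have /andP[cm md] := mid_le cd.
apply: TV_split; rewrite //.
- exact: finite_mset_orect.
- exact: open_orect.
- exact: open_orect.
- by move=> z /andP[h3 /andP[h1 h2]]; rewrite /orect /= h1 h3 (lt_le_trans h2).
- by move=> z /andP[h3 /andP[h1 h2]]; rewrite /orect /= h2 h3 (le_lt_trans cm).
- apply/seteqP; split=> // z [/andP[_ /andP[_ h]] /andP[_ /andP[h' _]]].
  by have := lt_trans h h'; rewrite ltxx.
Qed.

(** The first cut costs [(b - a) / 2] times the variation. Cutting each half the other way costs
    [(d - c) / 2] times the variation of that half, and by superadditivity these two add up to at
    most the whole. *)
Lemma poincare_step (a b c d : R) U : a <= b -> c <= d -> bounded_mfun U ->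
  (TV (orect a b c d) U < +oo)%E ->
  oscillation mu (rect a b c d) U <=
  dyadic_oscillation 1 U a b c d +
  ((b - a) / 2 + (d - c) / 2) * fine (TV (orect a b c d) U).
Proof.
move=> ab cd bU Tfin; have dc0 : 0 <= (d - c) / 2 by lra.
have /andP[am mb] := mid_le ab; have /andP[cm md] := mid_le cd.
have [Lfin Rfin LR] := TV_orect_splitl ab cd bU Tfin.
have muE : mu (rect a (mid a b) c d) = mu (rect (mid a b) b c d).
  by rewrite !lebesgue2_rect// /mid; congr (_%:E); field.
have muE' a' b' : a' <= b' -> mu (rect a' b' c (mid c d)) = mu (rect a' b' (mid c d) d).
  by move=> ab'; rewrite !lebesgue2_rect//; congr (_%:E); rewrite /mid; field.
have h0 : oscillation mu (rect a b c d) U <=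
    oscillation mu (rect a (mid a b) c d) U + oscillation mu (rect (mid a b) b c d) U +
    (b - a) / 2 * fine (TV (orect a b c d) U).
  rewrite (rect_splitl _ _ am mb).
  apply: le_trans (oscillationU (finite_mset_rect am cd) (finite_mset_rect mb cd)
    (rect_disjointl _ _ _ _ _) muE bU) _.
  by rewrite lerD2l; exact: TV_slab1.
have h1 a' b' : a' <= b' -> (TV (orect a' b' c d) U < +oo)%E ->
    oscillation mu (rect a' b' c d) U <=
    oscillation mu (rect a' b' c (mid c d)) U + oscillation mu (rect a' b' (mid c d) d) U +
    (d - c) / 2 * fine (TV (orect a' b' c d) U).
  move=> ab' Tfin'; rewrite (rect_splitr _ _ cm md).
  apply: le_trans (oscillationU (finite_mset_rect ab' cm) (finite_mset_rect ab' md)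
    (rect_disjointr _ _ _ _ _) (muE' _ _ ab') bU) _.
  by rewrite lerD2l; exact: TV_slab2.
have h2 := h1 _ _ am Lfin; have h3 := h1 _ _ mb Rfin.
have arith (o oL oR x1 x2 x3 x4 w h T TL TR : R) :
    o <= oL + oR + w * T -> oL <= x1 + x2 + h * TL -> oR <= x3 + x4 + h * TR ->
    h * (TL + TR) <= h * T -> o <= x1 + x2 + (x3 + x4) + (w + h) * T.
  by clear; move=> *; lra.
exact: arith h0 h2 h3 (ler_wpM2l dc0 LR).
Qed.

Lemma TV_orect4 (a b c d : R) U : a <= b -> c <= d -> bounded_mfun U ->
  (TV (orect a b c d) U < +oo)%E ->
  [/\ (TV (orect a (mid a b) c (mid c d)) U < +oo)%E,
      (TV (orect a (mid a b) (mid c d) d) U < +oo)%E,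
      (TV (orect (mid a b) b c (mid c d)) U < +oo)%E,
      (TV (orect (mid a b) b (mid c d) d) U < +oo)%E &
      fine (TV (orect a (mid a b) c (mid c d)) U) +
      fine (TV (orect a (mid a b) (mid c d) d) U) +
      (fine (TV (orect (mid a b) b c (mid c d)) U) +
       fine (TV (orect (mid a b) b (mid c d) d) U))
      <= fine (TV (orect a b c d) U)].
Proof.
move=> ab cd bU Tfin.
have /andP[am mb] := mid_le ab; have /andP[cm md] := mid_le cd.
have [Lfin Rfin LR] := TV_orect_splitl ab cd bU Tfin.
have [f1 f2 h1] := TV_orect_splitr am cd bU Lfin.
have [f3 f4 h2] := TV_orect_splitr mb cd bU Rfin.
split; [exact: f1|exact: f2|exact: f3|exact: f4|].
exact: le_trans (lerD h1 h2) LR.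
Qed.

(** One step leaves the cost [(w + h) / 2] times the variation; by induction the quarters cost
    [w / 2 + h / 2] times theirs, whose sum is at most the variation of the whole. Hence a constant
    [w + h] uniform in [j]. *)
Lemma poincare_dyadic j (a b c d : R) U : a <= b -> c <= d -> bounded_mfun U ->
  (TV (orect a b c d) U < +oo)%E ->
  oscillation mu (rect a b c d) U <=
  dyadic_oscillation j U a b c d +
  ((b - a) + (d - c)) * fine (TV (orect a b c d) U).
Proof.
elim: j a b c d => [|j IH] a b c d ab cd bU Tfin.
  rewrite /= lerDl mulr_ge0//; first by rewrite addr_ge0// subr_ge0.
  by rewrite fine_ge0// TV_ge0//; exact: finite_mset_orect.
have /andP[am mb] := mid_le ab; have /andP[cm md] := mid_le cd.
have w0 : 0 <= (b - a) / 2 + (d - c) / 2 by lra.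
have h0 := poincare_step ab cd bU Tfin.
have [f1 f2 f3 f4 h4] := TV_orect4 ab cd bU Tfin.
have k1 := IH _ _ _ _ am cm bU f1; have k2 := IH _ _ _ _ am md bU f2.
have k3 := IH _ _ _ _ mb cm bU f3; have k4 := IH _ _ _ _ mb md bU f4.
have E1 : mid a b - a = (b - a) / 2 by rewrite /mid; field.
have E2 : b - mid a b = (b - a) / 2 by rewrite /mid; field.
have E3 : mid c d - c = (d - c) / 2 by rewrite /mid; field.
have E4 : d - mid c d = (d - c) / 2 by rewrite /mid; field.
rewrite ?E1 ?E2 ?E3 ?E4 in k1 k2 k3 k4.
have arith (o x1 x2 x3 x4 y1 y2 y3 y4 w h T T1 T2 T3 T4 : R) :
    o <= x1 + x2 + (x3 + x4) + (w / 2 + h / 2) * T ->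
    x1 <= y1 + (w / 2 + h / 2) * T1 -> x2 <= y2 + (w / 2 + h / 2) * T2 ->
    x3 <= y3 + (w / 2 + h / 2) * T3 -> x4 <= y4 + (w / 2 + h / 2) * T4 ->
    (w / 2 + h / 2) * (T1 + T2 + (T3 + T4)) <= (w / 2 + h / 2) * T ->
    o <= y1 + y2 + (y3 + y4) + (w + h) * T.
  by clear; move=> *; lra.
exact: arith h0 k1 k2 k3 k4 (ler_wpM2l w0 h4).
Qed.

Lemma poincare_rect (a b c d : R) U : a <= b -> c <= d ->
  measurable_fun setT U -> (forall z, 0 <= U z <= 1) ->
  (TV (orect a b c d) U < +oo)%E ->
  oscillation mu (rect a b c d) U <=
  ((b - a) + (d - c)) * fine (TV (orect a b c d) U).
Proof.
move=> ab cd mU U01 Tfin.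
have [bU vU] := bounded_mfun_vanishing_oscillation mU U01.
have lim : dyadic_oscillation j U a b c d +
    ((b - a) + (d - c)) * fine (TV (orect a b c d) U) @[j --> \oo] -->
    0 + ((b - a) + (d - c)) * fine (TV (orect a b c d) U).
  by apply: cvgD; [exact: vU|exact: cvg_cst].
rewrite -[leRHS]add0r; apply: (ler_cvg_to (cvg_cst _) lim).
by apply: nearW => j; exact: poincare_dyadic.
Qed.

End poincare_inequality.

(** * Cauchy estimates along an ultrafilter *)

Section ultrafilter_compactness.
Context {R : realType}.
Local Notation plane := (measurableTypeR R * measurableTypeR R)%type.
Local Notation mu := (lebesgue2 R).

(** The image of [F] clusters at some point [p] of the segment. The indices whose values are near
    [p] form a set which is in [F] or has its complement in [F], and the latter would contradict
    clustering. *)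
Lemma ultra_bounded_cauchy (F : set_system nat) (UF : UltraFilter F)
    (u : nat -> R) (M eps : R) : (forall n, 0 <= u n <= M) -> 0 < eps ->
  exists2 S, F S & forall n m, S n -> S m -> `|u n - u m| <= eps.
Proof.
move=> uM eps0; have FF := @ultra_proper _ F UF.
have FA : (u @ F) `[0, M]%classic.
  by apply: (@filterS _ F _ setT) filterT => n _; rewrite /= in_itv /=.
have [p [_ clp]] := @segment_compact R 0 M (u @ F) _ FA.
have e2 : 0 < eps / 2 by rewrite divr_gt0.
pose S := [set n | `|p - u n| < eps / 2].
have [FS|FnS] := @in_ultra_setVsetC _ F S UF.
  exists S => // n m Sn Sm.
  have -> : u n - u m = (p - u m) - (p - u n) by ring.
  by apply: le_trans (ler_normB _ _) _; move: Sn Sm; rewrite /S /=; lra.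
have [|x [/= xu xp]] :=
    clp [set x | ~ `|p - x| < eps / 2] (ball p (eps / 2)) _ (nbhsx_ballx _ _ e2).
  exact: FnS.
by case: xu.
Qed.

Variables (F : set_system nat) (UF : UltraFilter F) (f : nat -> plane -> R).
Hypothesis mf : forall n, measurable_fun setT (f n).
Hypothesis f01 : forall n z, 0 <= f n z <= 1.

Let bf n : bounded_mfun (f n).
Proof.
by split=> //; exists 1 => z; have /andP[f0 f1] := f01 n z; rewrite ger0_norm.
Qed.

Let bff n m : bounded_mfun (fun z => `|f n z - f m z|).
Proof. exact/bounded_mfun_norm/bounded_mfunB. Qed.

Let FF : ProperFilter F := @ultra_proper _ F UF.

(** Both functions are replaced by their averages, at the cost of the oscillations; two constants
    differ in L^1 by the difference of their integrals. *)
Lemma L1_dist_oscillation (D : set plane) n m : finite_mset mu D ->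
  \int[mu]_(z in D) `|f n z - f m z| <=
  oscillation mu D (f n) + oscillation mu D (f m) +
  `|\int[mu]_(z in D) f n z - \int[mu]_(z in D) f m z|.
Proof.
move=> fD; pose p := average mu D (f n); pose q := average mu D (f m).
have bp : bounded_mfun (fun z => `|f n z - p|) by exact/bounded_mfun_norm/bounded_mfunB.
have bq : bounded_mfun (fun z => `|f m z - q|) by exact/bounded_mfun_norm/bounded_mfunB.
apply: le_trans (_ : \int[mu]_(z in D) (`|f n z - p| + `|f m z - q| + `|p - q|) <= _).
  apply: ler_Rint => //; first by apply: bounded_mfunD => //; exact: bounded_mfunD.
  move=> z _; have -> : f n z - f m z = (f n z - p) - (f m z - q) + (p - q) by ring.
  apply: le_trans (ler_normD _ _) _; rewrite lerD2r.
  exact: ler_normB.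
rewrite RintD//; last exact: bounded_mfunD.
rewrite RintD// Rint_cst// lerD2l /p /q /average.
have [D0|D0] := eqVneq (fine (mu D)) 0; first by rewrite D0 mulr0.
have D0' : 0 < fine (mu D) by rewrite lt_neqAle eq_sym D0 fine_ge0.
by rewrite -mulrBl normrM normfV (gtr0_norm D0') divfK.
Qed.

(** Poincare is applied on the [4 ^ j] pieces, whose sides are [2 ^ j] times smaller, while the
    variations of the pieces still sum to at most that of the whole. The constant therefore becomes
    arbitrarily small. *)
Lemma ultra_cauchy_rect j (a b c d eps : R) : a <= b -> c <= d -> 0 < eps ->
  (forall n, (TV (orect a b c d) (f n) < +oo)%E) ->
  exists2 S, F S & forall n m, S n -> S m ->
    \int[mu]_(z in rect a b c d) `|f n z - f m z| <=
    ((b - a) + (d - c)) / 2 ^+ j *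
      (fine (TV (orect a b c d) (f n)) + fine (TV (orect a b c d) (f m))) + eps.
Proof.
elim: j a b c d eps => [|j IH] a b c d eps ab cd eps0 Tfin.
  have fD := @finite_mset_rect R _ _ _ _ ab cd.
  have [|S FS hS] := @ultra_bounded_cauchy F UF
      (fun n => \int[mu]_(z in rect a b c d) f n z) (fine (mu (rect a b c d))) eps _ eps0.
    move=> n; rewrite Rint_ge0 ?andTb; last by move=> z; have /andP[] := f01 n z.
    rewrite -[leRHS]mul1r -Rint_cst//; apply: ler_Rint => // z _.
    by have /andP[] := f01 n z.
  exists S => // n m Sn Sm; apply: le_trans (L1_dist_oscillation n m fD) _.
  have h1 := poincare_rect ab cd (mf n) (f01 n) (Tfin n).
  have h2 := poincare_rect ab cd (mf m) (f01 m) (Tfin m).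
  have h3 := hS n m Sn Sm.
  rewrite expr0 divr1 mulrDr; apply: lerD => //; exact: lerD.
have /andP[am mb] := mid_le ab; have /andP[cm md] := mid_le cd.
have T4 n := TV_orect4 ab cd (bf n) (Tfin n).
have eps4 : 0 < eps / 4 by rewrite divr_gt0.
have [|S1 FS1 h1] := IH _ _ _ _ _ am cm eps4; first by move=> n; have [] := T4 n.
have [|S2 FS2 h2] := IH _ _ _ _ _ am md eps4; first by move=> n; have [] := T4 n.
have [|S3 FS3 h3] := IH _ _ _ _ _ mb cm eps4; first by move=> n; have [] := T4 n.
have [|S4 FS4 h4] := IH _ _ _ _ _ mb md eps4; first by move=> n; have [] := T4 n.
exists (S1 `&` S2 `&` (S3 `&` S4)); first exact: filterI (filterI FS1 FS2) (filterI FS3 FS4).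
move=> n m [[n1 n2] [n3 n4]] [[m1 m2] [m3 m4]].
have k1 := h1 n m n1 m1; have k2 := h2 n m n2 m2.
have k3 := h3 n m n3 m3; have k4 := h4 n m n4 m4.
have [_ _ _ _ tn] := T4 n; have [_ _ _ _ tm] := T4 m.
have E1 : mid a b - a = (b - a) / 2 by rewrite /mid; field.
have E2 : b - mid a b = (b - a) / 2 by rewrite /mid; field.
have E3 : mid c d - c = (d - c) / 2 by rewrite /mid; field.
have E4 : d - mid c d = (d - c) / 2 by rewrite /mid; field.
rewrite ?E1 ?E2 ?E3 ?E4 in k1 k2 k3 k4.
rewrite (Rint_rect4 ab cd (bff n m)) exprS invfM.
have E : ((b - a) / 2 + (d - c) / 2) / 2 ^+ j = (b - a + (d - c)) * (2^-1 / 2 ^+ j).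
  by rewrite -mulrDl mulrA.
rewrite E in k1 k2 k3 k4.
set C := (b - a + (d - c)) * (2^-1 / 2 ^+ j) in k1 k2 k3 k4 *.
have C0 : 0 <= C.
  apply: mulr_ge0; first by rewrite addr_ge0// subr_ge0.
  by apply: mulr_ge0; rewrite invr_ge0// exprn_ge0.
have arith (i1 i2 i3 i4 n1' n2' n3' n4' m1' m2' m3' m4' Tn Tm e : R) :
    i1 <= C * (n1' + m1') + e / 4 -> i2 <= C * (n2' + m2') + e / 4 ->
    i3 <= C * (n3' + m3') + e / 4 -> i4 <= C * (n4' + m4') + e / 4 ->
    C * (n1' + n2' + (n3' + n4') + (m1' + m2' + (m3' + m4'))) <= C * (Tn + Tm) ->
    i1 + i2 + (i3 + i4) <= C * (Tn + Tm) + e.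
  by clear; move=> *; lra.
exact: arith k1 k2 k3 k4 (ler_wpM2l C0 (lerD tn tm)).
Qed.

Lemma ultra_cauchy_rect0 (a b c d eps M : R) : a <= b -> c <= d -> 0 < eps ->
  (forall n, (TV (orect a b c d) (f n) <= M%:E)%E) ->
  exists2 S, F S & forall n m, S n -> S m ->
    \int[mu]_(z in rect a b c d) `|f n z - f m z| <= eps.
Proof.
move=> ab cd eps0 TM; have e2 : 0 < eps / 2 by rewrite divr_gt0.
have fP := finite_mset_orect ab cd.
have Tfin n : (TV (orect a b c d) (f n) < +oo)%E by rewrite (le_lt_trans (TM n)) ?ltry.
have TMr n : 0 <= fine (TV (orect a b c d) (f n)) <= M.
  rewrite fine_ge0 ?TV_ge0//= -lee_fin fineK// ge0_fin_numE// TV_ge0//.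
have lim : ((b - a) + (d - c)) * (M + M) * (2^-1) ^+ j @[j --> \oo] --> (0 : R).
  rewrite -(mulr0 (((b - a) + (d - c)) * (M + M))); apply: cvgMr.
  by apply: cvg_expr; rewrite ger0_norm// invf_lt1// ltr1n.
have /cvgrPdist_le/(_ _ e2)[j _ /(_ j (leqnn j))] := lim.
have M0 : 0 <= M by have /andP[h1 h2] := TMr 0%N; exact: le_trans h2.
have C0 : 0 <= (b - a) + (d - c) by rewrite addr_ge0// subr_ge0.
rewrite sub0r normrN exprVn => hj.
have {}hj := le_trans (ler_norm _) hj.
have [S FS hS] := ultra_cauchy_rect j ab cd e2 Tfin.
exists S => // n m Sn Sm; apply: le_trans (hS n m Sn Sm) _.
have /andP[_ tn] := TMr n; have /andP[_ tm] := TMr m.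
have C0' : 0 <= (b - a + (d - c)) / 2 ^+ j by rewrite mulr_ge0// invr_ge0 exprn_ge0.
rewrite {2}(splitr eps) lerD2r; apply: le_trans hj.
by rewrite [leRHS]mulrAC; exact: (ler_wpM2l C0' (lerD tn tm)).
Qed.

(** The rectangles filling [Omega] may overlap, so the indicator of a finite union is bounded by the
    sum of the indicators. The rest of [Omega] has small measure, and the integrand is at most 1
    there. *)
Lemma ultra_cauchy_open (Omega : set (R * R)) (eps M : R) : open Omega ->
  finite_mset mu Omega -> 0 < eps ->
  (forall n, (TV Omega (f n) <= M%:E)%E) ->
  exists2 S, F S & forall n m, S n -> S m ->
    \int[mu]_(z in Omega) `|f n z - f m z| <= eps.
Proof.
move=> oO fO eps0 TM.
have e2 : 0 < eps / 2 by rewrite divr_gt0.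
have [a [b [c [d [ab cd rO OE]]]]] := open_bigcup_rect oO.
pose r n := rect (a n) (b n) (c n) (d n).
pose B N : set plane := \big[setU/set0]_(i < N) r i.
have mB N : measurable (B N).
  by apply: bigsetU_measurable => i _; exact: measurable_rect.
have bB N : bounded_mfun (\1_(B N) : plane -> R) by exact: bounded_mfun_indic.
have Tr i n : (TV (orect (a i) (b i) (c i) (d i)) (f n) <= M%:E)%E.
  apply: le_trans (TM n); apply: le_ereal_sup => _ [phi tphi <-].
  have sub : orect (a i) (b i) (c i) (d i) `<=` Omega.
    by move=> z /orect_sub_rect; exact: rO.
  exists phi; first exact: test_field_sub tphi.
  have fo := finite_mset_orect (ab i) (cd i).
  have bU := bounded_mfunM (bf n) (bounded_divergence tphi).
  by rewrite !EFin_Rint// (Rint_divergence_sub _ sub tphi).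
have key N : forall e, 0 < e -> exists2 S, F S & forall n m, S n -> S m ->
    \int[mu]_(z in Omega) (`|f n z - f m z| * \1_(B N) z) <= e.
  elim: N => [|N IH] e e0.
    exists setT; first exact: filterT.
    move=> n m _ _; rewrite /B big_ord0 indic0.
    by under eq_Rintegral do rewrite mulr0; rewrite Rint_cst// mul0r ltW.
  have e2' : 0 < e / 2 by rewrite divr_gt0.
  have [S1 FS1 h1] := IH _ e2'.
  have [S2 FS2 h2] := ultra_cauchy_rect0 (ab N) (cd N) e2' (Tr N).
  exists (S1 `&` S2); first exact: filterI.
  move=> n m [n1 n2] [m1 m2].
  have k1 := h1 n m n1 m1; have k2 := h2 n m n2 m2.
  have br : bounded_mfun (\1_(r N) : plane -> R).
    by apply: bounded_mfun_indic; exact: measurable_rect.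
  apply: le_trans (_ : \int[mu]_(z in Omega) (`|f n z - f m z| * \1_(B N) z +
      `|f n z - f m z| * \1_(r N) z) <= _).
    apply: ler_Rint => //; first exact: bounded_mfunM.
      by apply: bounded_mfunD; exact: bounded_mfunM.
    move=> z _; rewrite -mulrDr ler_wpM2l// /B big_ord_recr /= !indicE in_setU.
    by case: (z \in _); case: (z \in _); rewrite /= ?addr0 ?add0r// lerDl.
  rewrite RintD//; [|exact: bounded_mfunM|exact: bounded_mfunM].
  have -> : \int[mu]_(z in Omega) (`|f n z - f m z| * \1_(r N) z) =
      \int[mu]_(z in r N) `|f n z - f m z|.
    rewrite [RHS]Rintegral_mkcond [LHS]Rintegral_mkcond.
    apply: eq_Rintegral => z _; rewrite /patch indicE.
    case: (boolP (z \in r N)) => [/set_mem zr|_].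
      by rewrite mem_set ?mulr1//; exact: rO zr.
    by rewrite mulr0; case: ifP.
  by apply: le_trans (lerD k1 k2) _; rewrite -splitr.
have cO : \int[mu]_(z in Omega) (1 - \1_(B N) z) @[N --> \oo] -->
    \int[mu]_(z in Omega) (fun=> 0 : R) z.
  apply: (@bounded_convergence _ _ _ _ _ _ _ 1) => //.
  - by move=> n; exact: (bounded_mfunB (bounded_mfun_cst 1) (bB n)).1.
  - move=> n z; rewrite indicE; case: (_ \in _); rewrite ?subrr ?subr0 ?normr0 ?normr1//.
  - apply: aeW => z; rewrite [in X in X -> _]OE => -[k _ rk].
    apply/cvgrPdist_le => e e0; exists k.+1 => // n /= kn.
    rewrite indicE mem_set; first by rewrite subrr subr0 normr0 ltW.
    by rewrite /B -bigcup_mkord; exists k.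
rewrite Rint_cst// mul0r in cO.
have /cvgrPdist_le/(_ _ e2)[N _ /(_ N (leqnn N))] := cO.
rewrite sub0r normrN => hN; have {}hN := le_trans (ler_norm _) hN.
have [S FS hS] := key N _ e2.
exists S => // n m Sn Sm; have k := hS n m Sn Sm.
have b1 : bounded_mfun (fun z : plane => 1 - \1_(B N) z : R) by exact: bounded_mfunB.
apply: le_trans (_ : \int[mu]_(z in Omega) (`|f n z - f m z| * \1_(B N) z +
    (1 - \1_(B N) z)) <= _); last first.
  rewrite RintD//; last exact: bounded_mfunM.
  by apply: le_trans (lerD k hN) _; rewrite -splitr.
apply: ler_Rint => //; first by apply: bounded_mfunD => //; exact: bounded_mfunM.
move=> z _; rewrite indicE; case: (_ \in _); rewrite ?mulr1 ?subrr ?addr0//.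
rewrite mulr0 subr0 add0r.
have /andP[h1 h2] := f01 n z; have /andP[h3 h4] := f01 m z.
by rewrite ler_norml; apply/andP; split; lra.
Qed.

End ultrafilter_compactness.

(** * From the ultrafilter to a convergent subsequence *)

Section L1_compactness.
Context {R : realType}.
Local Notation plane := (measurableTypeR R * measurableTypeR R)%type.
Local Notation mu := (lebesgue2 R).

Lemma unit_bounded_mfun d (T : measurableType d) (g : T -> R) :
  measurable_fun setT g -> (forall z, 0 <= g z <= 1) -> bounded_mfun g.
Proof.
by move=> mg g01; split=> //; exists 1 => z; have /andP[g0 g1] := g01 z; rewrite ger0_norm.
Qed.

Lemma fast_cauchy_subsequence (Omega : set (R * R)) (M : R) (f : nat -> plane -> R) :
  open Omega -> finite_mset mu Omega ->
  (forall n, measurable_fun setT (f n)) -> (forall n z, 0 <= f n z <= 1) ->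
  (forall n, (TV Omega (f n) <= M%:E)%E) ->
  exists2 k : nat -> nat, increasing_seq k &
    forall n, \int[mu]_(z in Omega) `|f (k n.+1) z - f (k n) z| <= 2^-1 ^+ n.
Proof.
move=> oO fO mf f01 TM.
(* [F] refines the filter of tails, so each member contains arbitrarily large indices and the choice
   below can be made increasing. *)
have [F [UF FE]] := ultraFilterLemma eventually_filter.
have e0 n : 0 < (2^-1 : R) ^+ n by rewrite exprn_gt0.
have FF := @ultra_proper _ F UF.
have /choice[S HS] : forall n, exists S, F S /\ forall i j, S i -> S j ->
    \int[mu]_(z in Omega) `|f i z - f j z| <= 2^-1 ^+ n.
  move=> n; have [S FS hS] := ultra_cauchy_open UF mf f01 oO fO (e0 n) TM.
  by exists S.
(* Nesting puts both the [n]-th and the next chosen index in [S n]. *)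
pose fix T k : set nat := if k is k'.+1 then T k' `&` S k else S 0%N.
have FT k : F (T k).
  elim: k => [|k IH] /=; first by have [] := HS 0%N.
  by apply: filterI => //; have [] := HS k.+1.
have TS k i : T k i -> S k i by case: k => [//|k] [].
have /choice[pick Hpick] : forall kN : nat * nat, exists n, T kN.1 n /\ (kN.2 < n)%N.
  move=> [k N] /=; have FN : F [set n | (N < n)%N].
    by apply: FE; exists N.+1.
  by have [n [n1 n2]] := filter_ex (filterI (FT k) FN); exists n.
pose fix ks k := if k is k'.+1 then pick (k'.+1, ks k') else pick (0, 0)%N.
have Tks k : T k (ks k) by case: k => [|k] /=; [have [] := Hpick (0, 0)%N|
  have [] := Hpick (k.+1, ks k)].
exists ks; first by apply/increasing_seqP => n; have [] := Hpick (n.+1, ks n).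
move=> n; have [_ hS] := HS n; apply: hS.
- by apply: TS; have [] := Tks n.+1.
- exact: TS.
Qed.

(** Bounds that hold eventually pass to the upper limit. This gives the range [0, 1] of the limit
    function and its distance to each term. *)
Lemma limn_sup_between (u : nat -> R) (A B M : R) n : (forall m, `|u m| <= M) ->
  (forall m, (n <= m)%N -> A <= u m <= B) -> A <= limn_sup u <= B.
Proof.
move=> uM uAB.
have bu : bounded_fun u.
  by exists M; split; [exact: num_real|move=> N MN x _; apply: le_trans (uM x) (ltW MN)].
have ub m : has_ubound (sdrop u m).
  by exists M => _ [i _ <-]; apply: le_trans (uM i); exact: ler_norm.
rewrite limn_supE//; apply/andP; split.
- apply: lb_le_inf; first by exists (sups u 0%N); exists 0%N.
  move=> _ [m _ <-].
  apply: le_trans (_ : u (maxn n m) <= _).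
    by have /andP[] := uAB (maxn n m) (leq_maxl n m).
  by apply: ub_le_sup => //; exists (maxn n m) => //=; exact: leq_maxr.
- apply: le_trans (_ : sups u n <= _).
    apply: ge_inf; last by exists n.
    exists (- M) => _ [m _ <-]; apply: le_trans (_ : u m <= _).
      by have := uM m; rewrite ler_norml => /andP[].
    by apply: ub_le_sup => //; exists m => //=.
  apply: ge_sup; first by exists (u n); exists n => /=.
  by move=> _ [m /= nm <-]; have /andP[] := uAB m nm.
Qed.

(* With U the pointwise upper limit, |g n - U| is at most the sum of
   |g i.+1 - g i| over i >= n, whether or not the sequence converges at the
   point. *)
Lemma L1_limit (D : set plane) (g : nat -> plane -> R) : finite_mset mu D ->
  (forall n, measurable_fun setT (g n)) -> (forall n z, 0 <= g n z <= 1) ->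
  (forall n, \int[mu]_(z in D) `|g n.+1 z - g n z| <= 2^-1 ^+ n) ->
  exists U : plane -> R, [/\ measurable_fun setT U, forall z, 0 <= U z <= 1 &
    forall n, \int[mu]_(z in D) `|g n z - U z| <= 2 * 2^-1 ^+ n].
Proof.
move=> fD mg g01 gfast.
have g1 n z : `|g n z| <= 1 by have /andP[g0 ?] := g01 n z; rewrite ger0_norm.
have bg n := unit_bounded_mfun (mg n) (g01 n).
exists (fun z => limn_sup (g ^~ z)).
have U01 z : 0 <= limn_sup (g ^~ z) <= 1.
  by apply: (@limn_sup_between _ _ _ 1 0%N) => m.
have mU : measurable_fun setT (fun z => limn_sup (g ^~ z)).
  apply: measurable_fun_limn_sup => //.
  - by move=> t _; exists 1 => _ [m _ <-]; have /andP[] := g01 m t.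
  - by move=> t _; exists 0 => _ [m _ <-]; have /andP[] := g01 m t.
split=> // n.
have bU := unit_bounded_mfun mU U01.
pose h i z := `|g (n + i).+1 z - g (n + i)%N z|.
have bh i : bounded_mfun (h i) by exact/bounded_mfun_norm/bounded_mfunB.
have h00 i z : (0 <= (h i z)%:E)%E by rewrite lee_fin normr_ge0.
have ptw z : (`|g n z - limn_sup (g ^~ z)|%:E <= \sum_(i <oo) (h i z)%:E)%E.
  have [soo|sfin] := eqVneq (\sum_(i <oo) (h i z)%:E)%E +oo%E; first by rewrite soo leey.
  have s0 : (0 <= \sum_(i <oo) (h i z)%:E)%E by apply: nneseries_ge0.
  have sf : (\sum_(i <oo) (h i z)%:E)%E \is a fin_num by rewrite ge0_fin_numE// ltey.
  rewrite -(fineK sf) lee_fin; set s := fine _.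
  have tele j : `|g (n + j)%N z - g n z| <= \sum_(i < j) h i z.
    elim: j => [|j IH]; first by rewrite addn0 subrr normr0 big_ord0.
    rewrite big_ord_recr /= addnS.
    have -> : g (n + j).+1 z - g n z =
      (g (n + j)%N z - g n z) + (g (n + j).+1 z - g (n + j)%N z) by ring.
    by apply: le_trans (ler_normD _ _) _; rewrite lerD2r.
  have les j : \sum_(i < j) h i z <= s.
    rewrite -lee_fin /s fineK// -sumEFin.
    have := @nneseries_lim_ge _ (fun i => (h i z)%:E) xpredT 0%N j (fun i _ _ => h00 i z).
    by rewrite big_mkord.
  have btw m : (n <= m)%N -> g n z - s <= g m z <= g n z + s.
    move=> nm; have := le_trans (tele (m - n)%N) (les (m - n)%N).
    by rewrite subnKC// ler_norml => /andP[h1 h2]; apply/andP; split; lra.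
  have /andP[h1 h2] := limn_sup_between (fun m => g1 m z) btw.
  by rewrite ler_norml; apply/andP; split; lra.
have mh i : measurable_fun D (EFin \o h i).
  by apply/measurable_EFinP/measurable_funTS; exact: (bh i).1.
rewrite -lee_fin -EFin_Rint//; last exact/bounded_mfun_norm/bounded_mfunB.
apply: le_trans (_ : \int[mu]_(z in D) (\sum_(i <oo) (h i z)%:E) <= _)%E.
  apply: ge0_le_integral => //.
  - exact: fD.1.
  - apply/measurable_EFinP/measurable_funTS.
    exact: (bounded_mfun_norm (bounded_mfunB (bg n) bU)).1.
  - by apply: ge0_emeasurable_sum => [i z _ _|i _]; [exact: h00|exact: mh].
rewrite (@integral_nneseries _ _ _ mu D fD.1 _ mh (fun i z _ => h00 i z)).
apply: lime_le; first by apply: is_cvg_nneseries => i _ _; apply: integral_ge0 => z _; exact: h00.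
apply: nearW => N.
apply: le_trans (_ : (\sum_(0 <= i < N) ((2^-1 : R) ^+ (n + i))%:E <= _)%E).
  by apply: lee_sum => i _; rewrite EFin_Rint// lee_fin; exact: gfast.
rewrite sumEFin lee_fin big_mkord.
(* The geometric sum is kept with its remainder, without which the induction on [N] would not
   close. *)
have : \sum_(i < N) (2^-1 : R) ^+ (n + i) <= 2 * 2^-1 ^+ n - 2 * 2^-1 ^+ (n + N).
  elim: N => [|N IH]; first by rewrite big_ord0 addn0 subrr.
  rewrite big_ord_recr /= addnS exprS; lra.
have : 0 <= (2^-1 : R) ^+ (n + N) by rewrite exprn_ge0.
lra.
Qed.

End L1_compactness.

(** * Convolution *)

Section lebesgue2_sigma_finite.
Context {R : realType}.
Local Notation plane := (measurableTypeR R * measurableTypeR R)%type.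

Lemma lebesgue2_sigma_finite : sigma_finite [set: plane] (lebesgue2 R).
Proof.
pose F (n : nat) : set plane := rect (- n%:R) n%:R (- n%:R) n%:R.
exists F => [|n].
  apply/esym/seteqP; split=> // x _.
  have [N hN] : exists N : nat, `|x.1| < N%:R /\ `|x.2| < N%:R.
    exists (maxn (Num.bound `|x.1|) (Num.bound `|x.2|)); split;
      by apply: lt_le_trans (archi_boundP (normr_ge0 _)) _;
         rewrite ler_nat ?leq_maxl ?leq_maxr.
  exists N => //; apply/rectE; case: hN; rewrite !ltr_norml.
  by move=> /andP[/ltW -> ->] /andP[/ltW -> ->].
have n0 : - n%:R <= n%:R :> R by rewrite (@le_trans _ _ 0) ?oppr_le0.
exact: (finite_mset_rect n0 n0).
Qed.

(* A copy of [lebesgue2 R] as a bare set function, so that it can be given the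
   sigma-finiteness needed by Fubini's theorem. *)
Definition sigma_lebesgue2 : set plane -> \bar R := lebesgue2 R.

HB.instance Definition _ := isMeasure.Build _ _ _ sigma_lebesgue2
  (measure0 (lebesgue2 R)) (measure_ge0 (lebesgue2 R))
  (@measure_semi_sigma_additive _ _ _ (lebesgue2 R)).

HB.instance Definition _ := Measure_isSigmaFinite.Build _ _ _ sigma_lebesgue2
  lebesgue2_sigma_finite.

(** Tonelli's theorem handles nonnegative functions, so the positive and negative parts are
    integrated separately. *)
Lemma measurable_fun_Rint d (T : measurableType d) (g : T * plane -> R) :
  measurable_fun setT g ->
  measurable_fun setT (fun x => \int[lebesgue2 R]_y g (x, y)).
Proof.
move=> mg.
have mE : measurable_fun setT (EFin \o g) by exact/measurable_EFinP.
have mp := @measurable_fun_fubini_tonelli_F _ _ T _ R sigma_lebesgue2 _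
  (measurable_funepos mE) (fun x => funepos_ge0 _ x).
have mn := @measurable_fun_fubini_tonelli_F _ _ T _ R sigma_lebesgue2 _
  (measurable_funeneg mE) (fun x => funeneg_ge0 _ x).
rewrite (_ : (fun x => _) = fine \o (fun x =>
    (fubini_F sigma_lebesgue2 (EFin \o g)^\+ x - fubini_F sigma_lebesgue2 (EFin \o g)^\- x)%E)).
  by apply: measurableT_comp => //; exact: emeasurable_funB.
apply/funext => x; rewrite /Rintegral [in LHS]integralE /=; congr fine.
by congr (_ - _)%E; apply: eq_integral => y _; rewrite ?funeposE ?funenegE.
Qed.

End lebesgue2_sigma_finite.

(** * Invariance of Lebesgue measure under reflections *)

Section reflection.
Context {R : realType}.
Local Notation plane := (measurableTypeR R * measurableTypeR R)%type.
Local Notation mu := (lebesgue2 R).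

Lemma measurable_reflect (x : R) :
  measurable_fun setT (fun y : measurableTypeR R => (x - y : measurableTypeR R)).
Proof.
have h : measurable_fun [set: R] (fun y : R => x - y).
  by apply: measurable_funB => //; exact: measurable_cst.
exact: h.
Qed.

(** The image measure agrees with Lebesgue measure on intervals, which determines it; the reflection
    exchanges the open and the closed end. *)
Lemma lebesgue_measure_reflect (x : R) (A : set (measurableTypeR R)) :
  measurable A ->
  @lebesgue_measure R ((fun y => x - y) @^-1` A) = @lebesgue_measure R A.
Proof.
move=> mA; apply/esym.
pose m := measure_function_pushforward__canonical__measure_function_Measure
  (@lebesgue_measure R) (measurable_reflect x).
apply: (@lebesgue_measure_unique R m) mA => X [[a b] _ <-] /=.
rewrite /m /= /pushforward (_ : _ @^-1` _ = `[x - b, x - a[%classic).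
  rewrite !lebesgue_measure_itv /= !lte_fin ltrD2l ltrN2.
  by case: ifP => // _; rewrite -!EFinB; congr (_%:E); ring.
apply/seteqP; split=> y; rewrite /preimage /= !in_itv /= => /andP[h1 h2];
  apply/andP; split; lra.
Qed.

Lemma measurable_reflect2 (x : plane) :
  measurable_fun setT (fun y : plane => (x.1 - y.1, x.2 - y.2) : plane).
Proof.
apply: measurable_fun_pair.
- by apply: (measurableT_comp (measurable_reflect x.1)); exact: measurable_fst.
- by apply: (measurableT_comp (measurable_reflect x.2)); exact: measurable_snd.
Qed.

(** A reflection acts on each coordinate separately, so uniqueness of the product measure reduces
    the claim to the line. *)
Lemma lebesgue2_reflect (x : plane) (A : set plane) : measurable A ->
  mu ((fun y : plane => (x.1 - y.1, x.2 - y.2)) @^-1` A) = mu A.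
Proof.
move=> mA.
pose m := measure_function_pushforward__canonical__measure_function_Measure
  mu (measurable_reflect2 x).
apply/esym; apply: (@product_measure_unique _ _ _ _ R _ _ m _ A mA) => B C mB mC.
rewrite /m /= /pushforward.
rewrite (_ : _ @^-1` _ = ((fun y => x.1 - y) @^-1` B) `*` ((fun y => x.2 - y) @^-1` C))//.
have mpre (t : R) (E : set (measurableTypeR R)) : measurable E ->
    measurable ((fun y : measurableTypeR R => (t - y : measurableTypeR R)) @^-1` E).
  by move=> mE; rewrite -[X in measurable X]setTI; exact: measurable_reflect.
rewrite lebesgue2X; [|exact: mpre|exact: mpre].
by rewrite !lebesgue_measure_reflect.
Qed.

Lemma integral_reflect (x : plane) (g : plane -> \bar R) : measurable_fun setT g ->
  (forall z, (0 <= g z)%E) ->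
  (\int[mu]_y g (x.1 - y.1, x.2 - y.2)%R = \int[mu]_z g z)%E.
Proof.
move=> mg g0.
have := @ge0_integral_pushforward _ _ _ _ R _ (measurable_reflect2 x) mu setT g
  measurableT mg (fun y _ => g0 y).
rewrite preimage_setT => <-.
apply: eq_measure_integral; first exact: measurable_reflect2.
by move=> mphi A mA _; exact: lebesgue2_reflect.
Qed.

End reflection.

Section norms.
Context {R : realType}.
Local Notation plane := (measurableTypeR R * measurableTypeR R)%type.
Local Notation mu := (lebesgue2 R).
Implicit Types (Omega : set (R * R)) (f g : R * R -> R).

Lemma LpNorm1E Omega f : LpNorm Omega 1 f = (\int[mu]_(x in Omega) `|f x|%:E)%E.
Proof.
rewrite /LpNorm Lnorm1 [RHS]integral_mkcond.
apply: eq_integral => x _; rewrite /= /patch.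
by case: ifP => // _; rewrite normr0.
Qed.

Lemma LpNorm2E Omega f :
  (LpNorm Omega 2%:E f ^+ 2 = \int[mu]_(x in Omega) (f x ^+ 2)%:E)%E.
Proof.
have p2 (x : \bar R) : (0 <= x)%E -> (x `^ 2 = x ^+ 2)%E.
  case: x => [x|_|//]; first by rewrite lee_fin => x0; rewrite poweR_EFin powR_mulrn// EFin_expe.
  by rewrite poweRyr// expe2 mulyy.
rewrite -p2 ?Lnorm_ge0// /LpNorm poweR_Lnorm// [RHS]integral_mkcond.
apply: eq_integral => x _; rewrite /= powR_mulrn// /patch.
case: ifP => _; first by rewrite real_normK ?num_real.
by rewrite normr0 expr0n.
Qed.

End norms.

(** * Convolution with square integrable kernels *)

Section convolution_estimates.
Context {R : realType}.
Local Notation plane := (measurableTypeR R * measurableTypeR R)%type.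
Local Notation mu := (lebesgue2 R).
Variable Omega : set (R * R).
Hypothesis fO : finite_mset mu Omega.
Implicit Types (h : plane -> R) (f g : plane -> R).

Definition square_integrable h := measurable_fun (Omega : set plane) h /\
  (\int[mu]_(x in Omega) (h x ^+ 2)%:E < +oo)%E.

(** Representatives of elements of [K]: the bounds hold everywhere and the extension by 0 is built
    in, so that [f \_ Omega] is [f]. *)
Definition phase f := [/\ measurable_fun setT f, forall z, 0 <= f z <= 1 &
  forall z, ~ Omega z -> f z = 0].

Definition real_convolution h f (x : plane) : R :=
  \int[mu]_(y in Omega) (h y * f (x.1 - y.1, x.2 - y.2)).

Lemma square_integrable_sq h : square_integrable h ->
  mu.-integrable Omega (fun x => (h x ^+ 2)%:E).
Proof.
move=> [mh hfin]; apply/integrableP; split.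
  exact/measurable_EFinP/measurable_funX.
by under eq_integral do rewrite gee0_abs ?lee_fin ?sqr_ge0//.
Qed.

Lemma phase_reflect f (x : plane) : phase f ->
  measurable_fun setT (fun y : plane => f (x.1 - y.1, x.2 - y.2)).
Proof. by move=> [mf _ _]; apply: (measurableT_comp mf); exact: measurable_reflect2. Qed.

(** The integrand is dominated by [|h| <= 1 + h ^ 2], integrable because [Omega] has finite
    measure. *)
Lemma convolution_integrable h f (x : plane) : square_integrable h -> phase f ->
  mu.-integrable Omega (fun y => (h y * f (x.1 - y.1, x.2 - y.2))%:E).
Proof.
move=> sh pf; have [mf f01 _] := pf.
have bO : mu.-integrable Omega (fun=> 1%:E).
  by apply: (bounded_mfun_integrable fO.1 fO.2 (bounded_mfun_cst 1)).
apply: le_integrable (integrableD fO.1 bO (square_integrable_sq sh)).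
- exact: fO.1.
- by apply/measurable_EFinP/measurable_funM; [exact: sh.1|
    apply: measurable_funTS; exact: phase_reflect].
- move=> y _; rewrite /= lee_fin; set u := f _.
  have /andP[u0 u1] : 0 <= u <= 1 by exact: f01.
  rewrite [leRHS]ger0_norm ?addr_ge0 ?sqr_ge0// normrM (ger0_norm u0).
  apply: le_trans (_ : `|h y| <= _); first by rewrite ler_piMr.
  by have := sqr_ge0 (`|h y| - 1); rewrite -[h y ^+ 2]real_normK ?num_real//; nra.
Qed.

(* The weighted AM-GM inequality s t <= de s^2 + t^2 / de replaces Cauchy-Schwarz,
   and |f' - f|^2 <= |f' - f| since phases take values in [0, 1]. *)
Lemma real_convolution_dist h h' f f' (x : plane) (de : R) : 0 < de ->
  square_integrable h -> square_integrable h' -> phase f -> phase f' ->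
  (`|real_convolution h' f' x - real_convolution h f x|%:E <=
   de%:E * (mu Omega + \int[mu]_(y in Omega) (h y ^+ 2)%:E) +
   de^-1%:E * (\int[mu]_(y in Omega) ((h' y - h y) ^+ 2)%:E +
      \int[mu]_(y in Omega) `|f' y - f y|%:E))%E.
Proof.
move=> de0 sh sh' pf pf'.
have i1 := convolution_integrable x sh pf.
have i2 := convolution_integrable x sh' pf'.
have [mf f01 f0] := pf; have [mf' f01' f0'] := pf'.
have de'0 : 0 < de^-1 by rewrite invr_gt0.
have mO : measurable (Omega : set plane) := fO.1.
rewrite /real_convolution -RintegralB//.
rewrite EFin_normr_Rintegral//; last exact: (integrableB fO.1 i2 i1).
have mD : measurable_fun setT (fun z : plane => `|f' z - f z|%:E).
  by apply/measurable_EFinP/measurableT_comp => //; exact: measurable_funB.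
have mDx : measurable_fun setT
    (fun y : plane => `|f' (x.1 - y.1, x.2 - y.2) - f (x.1 - y.1, x.2 - y.2)|%:E).
  by apply: (measurableT_comp mD (measurable_reflect2 x)).
have msq : measurable_fun (Omega : set plane) (fun y => (h y ^+ 2)%:E).
  by apply/measurable_EFinP/measurable_funX; exact: sh.1.
have msq' : measurable_fun (Omega : set plane) (fun y => ((h' y - h y) ^+ 2)%:E).
  by apply/measurable_EFinP/measurable_funX/measurable_funB; [exact: sh'.1|exact: sh.1].
(* Enlarge the domain to the plane, reflect, then return to [Omega], off which both phases
   vanish. *)
have Dle : (\int[mu]_(y in Omega)
    `|f' (x.1 - y.1, x.2 - y.2)%R - f (x.1 - y.1, x.2 - y.2)%R|%:E <=
    \int[mu]_(y in Omega) `|f' y - f y|%:E)%E.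
  apply: le_trans (_ : (\int[mu]_y `|f' (x.1 - y.1, x.2 - y.2)%R - f (x.1 - y.1, x.2 - y.2)%R|%:E
    <= _)%E).
    by apply: ge0_subset_integral => //; exact: mO.
  have D0 z : (0 <= `|f' z - f z|%:E)%E by rewrite lee_fin.
  rewrite (integral_reflect x mD D0).
  rewrite [leRHS]integral_mkcond le_eqVlt; apply/orP; left; apply/eqP.
  apply: eq_integral => z _; rewrite /patch; case: ifPn => //.
  by rewrite notin_setE => nO; rewrite f0// f0'// subrr normr0.
apply: le_trans (le_abse_integral mu mO (measurable_int _ (integrableB fO.1 i2 i1))) _.
apply: le_trans (_ : (\int[mu]_(y in Omega) ((de%:E * (1 + (h y ^+ 2)%:E)) +
   de^-1%:E * (((h' y - h y) ^+ 2)%:E +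
    `|f' (x.1 - y.1, x.2 - y.2)%R - f (x.1 - y.1, x.2 - y.2)%R|%:E)) <= _)%E).
  apply: ge0_le_integral => //.
  - by apply/measurableT_comp => //; exact: measurable_int (integrableB fO.1 i2 i1).
  - apply: emeasurable_funD.
      by apply: measurable_funeM; apply: emeasurable_funD.
    apply: measurable_funeM; apply: emeasurable_funD => //; exact: measurable_funTS.
  move=> y _.
  suff : `|h' y * f' (x.1 - y.1, x.2 - y.2) - h y * f (x.1 - y.1, x.2 - y.2)| <=
    de * (1 + h y ^+ 2) + de^-1 * ((h' y - h y) ^+ 2 +
      `|f' (x.1 - y.1, x.2 - y.2) - f (x.1 - y.1, x.2 - y.2)|) by [].
  have /andP[u0 u1] := f01 (x.1 - y.1, x.2 - y.2); have /andP[v0 v1] := f01' (x.1 - y.1, x.2 - y.2).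
  set u := f _ in u0 u1 *; set v := f' _ in v0 v1 *.
  have AG (s t : R) : 0 <= s -> 0 <= t -> s * t <= de * s ^+ 2 + de^-1 * t ^+ 2.
    move=> s0 t0; have := sqr_ge0 (de * s - t); have := mulr_ge0 s0 t0 => st0 sq.
    rewrite -(ler_pM2l de0) mulrDr mulVKf ?gt_eqF//.
    have := mulr_ge0 (ltW de0) st0; nra.
  (* One term carries the error on the kernel, the other the error on the phase. *)
  have -> : h' y * v - h y * u = (h' y - h y) * v + h y * (v - u) by ring.
  apply: le_trans (ler_normD _ _) _; rewrite !normrM (ger0_norm v0).
  have a1 : `|h' y - h y| * v <= de + de^-1 * (h' y - h y) ^+ 2.
    apply: le_trans (_ : `|h' y - h y| * 1 <= _); first by rewrite ler_wpM2l.
    have := AG 1 `|h' y - h y| ler01 (normr_ge0 _).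
    by rewrite mul1r mulr1 expr1n mulr1 real_normK ?num_real.
  have a2 : `|h y| * `|v - u| <= de * h y ^+ 2 + de^-1 * `|v - u|.
    apply: le_trans (AG _ _ (normr_ge0 _) (normr_ge0 _)) _.
    rewrite real_normK ?num_real// lerD2l ler_pM2l// expr2 ler_piMr//.
    by rewrite ler_norml; apply/andP; split; lra.
  by rewrite !mulrDr mulr1; lra.
rewrite ge0_integralD//; last 4 first.
- by move=> y _; rewrite -EFinD -EFinM lee_fin mulr_ge0 ?addr_ge0 ?sqr_ge0// ltW.
- by apply: measurable_funeM; apply: emeasurable_funD.
- by move=> y _; rewrite -EFinD -EFinM lee_fin mulr_ge0 ?addr_ge0 ?sqr_ge0// ltW.
- apply: measurable_funeM; apply: emeasurable_funD => //; exact: measurable_funTS.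
rewrite ge0_integralZl//; last 3 first.
- by apply: emeasurable_funD.
- by move=> y _; rewrite -EFinD lee_fin addr_ge0 ?sqr_ge0.
- by rewrite lee_fin ltW.
rewrite ge0_integralZl//; last 3 first.
- by apply: emeasurable_funD => //; exact: measurable_funTS.
- by move=> y _; rewrite -EFinD lee_fin addr_ge0 ?sqr_ge0.
- by rewrite lee_fin ltW.
rewrite ge0_integralD//; last by move=> y _; rewrite lee_fin sqr_ge0.
rewrite ge0_integralD//; last 2 first.
- by move=> y _; rewrite lee_fin sqr_ge0.
- exact: measurable_funTS.
rewrite integral_cst// mul1e leeD2l// lee_wpmul2l//; first by rewrite lee_fin ltW.
by rewrite leeD2l.
Qed.

End convolution_estimates.

Section convolution_limits.
Context {R : realType}.
Local Notation plane := (measurableTypeR R * measurableTypeR R)%type.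
Local Notation mu := (lebesgue2 R).
Variable Omega : set (R * R).
Hypothesis fO : finite_mset mu Omega.
Implicit Types (h : plane -> R) (f g : plane -> R).

(** The weight [de] is chosen first, to make the fixed part small; only then is [n] taken large
    enough to absorb the factor [1 / de]. *)
Lemma real_convolution_cvg (h_ : nat -> plane -> R) h (f_ : nat -> plane -> R) f x :
  square_integrable Omega h -> (forall n, square_integrable Omega (h_ n)) ->
  phase Omega f -> (forall n, phase Omega (f_ n)) ->
  (\int[mu]_(y in Omega) ((h_ n y - h y) ^+ 2)%:E)%E @[n --> \oo] --> 0%E ->
  (\int[mu]_(y in Omega) `|f_ n y - f y|%:E)%E @[n --> \oo] --> 0%E ->
  real_convolution Omega (h_ n) (f_ n) x @[n --> \oo] --> real_convolution Omega h f x.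
Proof.
move=> sh sh_ pf pf_ hcvg fcvg; apply/cvgrPdist_le => eps eps0.
have sq0 y : (0 <= (h y ^+ 2)%:E)%E by rewrite lee_fin sqr_ge0.
have Cfin : (mu Omega + \int[mu]_(y in Omega) (h y ^+ 2)%:E)%E \is a fin_num.
  rewrite ge0_fin_numE; last by apply: adde_ge0 => //; apply: integral_ge0 => y _; exact: sq0.
  by apply: lte_add_pinfty; [exact: fO.2|exact: sh.2].
set C := fine (mu Omega + \int[mu]_(y in Omega) (h y ^+ 2)%:E)%E.
have C0 : 0 <= C by apply: fine_ge0; apply: adde_ge0 => //; apply: integral_ge0 => y _; exact: sq0.
have C1 : 0 < C + 1 by rewrite ltr_wpDl.
pose de := eps / 2 / (C + 1).
have e2 : 0 < eps / 2 by rewrite divr_gt0.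
have de0 : 0 < de by rewrite divr_gt0.
have cc : (\int[mu]_(y in Omega) ((h_ n y - h y) ^+ 2)%:E +
    \int[mu]_(y in Omega) `|f_ n y - f y|%:E)%E @[n --> \oo] --> 0%:E.
  by rewrite -(adde0 0%:E); apply: cvgeD.
move/fine_cvgP : cc => [cfin /cvgrPdist_le/(_ _ (mulr_gt0 de0 e2))].
apply: filterS2 cfin => n nfin; rewrite sub0r normrN => nle.
have := real_convolution_dist fO x de0 sh (sh_ n) pf (pf_ n).
rewrite -(fineK Cfin) -/C -(fineK nfin) -!EFinM -EFinD lee_fin distrC => nd.
apply: le_trans nd _; rewrite [leRHS](splitr eps); apply: lerD.
  by rewrite /de mulrAC ler_pdivrMr// ler_pM2l// lerDl.
rewrite ler_pdivrMl//.
exact: le_trans (ler_norm _) nle.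
Qed.

Let measurable_diff : measurable_fun [set: plane * plane]
  (fun p => (p.1.1 - p.2.1, p.1.2 - p.2.2) : plane).
Proof.
have m1 : measurable_fun [set: plane * plane] (fun p => p.1.1 : R).
  exact: (measurableT_comp (@measurable_fst _ _ _ _) (@measurable_fst _ _ _ _)).
have m2 : measurable_fun [set: plane * plane] (fun p => p.2.1 : R).
  exact: (measurableT_comp (@measurable_fst _ _ _ _) (@measurable_snd _ _ _ _)).
have m3 : measurable_fun [set: plane * plane] (fun p => p.1.2 : R).
  exact: (measurableT_comp (@measurable_snd _ _ _ _) (@measurable_fst _ _ _ _)).
have m4 : measurable_fun [set: plane * plane] (fun p => p.2.2 : R).
  exact: (measurableT_comp (@measurable_snd _ _ _ _) (@measurable_snd _ _ _ _)).
have h1 := measurable_funB m1 m2; have h2 := measurable_funB m3 m4.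
exact: measurable_fun_pair h1 h2.
Qed.

(** Extending the kernel by 0 makes the integrand jointly measurable on the product of two
    planes. *)
Lemma measurable_real_convolution h f : square_integrable Omega h -> phase Omega f ->
  measurable_fun setT (real_convolution Omega h f).
Proof.
move=> [mh _] [mf _ _].
have mhO : measurable_fun setT (h \_ (Omega : set plane)).
  by apply/(measurable_restrictT h fO.1).
have mg : measurable_fun [set: plane * plane]
    (fun p => (h \_ (Omega : set plane)) p.2 * f (p.1.1 - p.2.1, p.1.2 - p.2.2)).
  apply: measurable_funM; first exact: (measurableT_comp mhO (@measurable_snd _ _ _ _)).
  exact: (measurableT_comp mf measurable_diff).
have := measurable_fun_Rint mg; congr (measurable_fun _ _).
apply/funext => x; rewrite /real_convolution [RHS]Rintegral_mkcond.
by apply: eq_Rintegral => y _; rewrite /patch; case: ifP => //; rewrite mul0r.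
Qed.

End convolution_limits.

Lemma cvg_sqr (R : realType) (u : nat -> R) (l : R) : u n @[n --> \oo] --> l ->
  u n ^+ 2 @[n --> \oo] --> l ^+ 2.
Proof. by move=> ul; rewrite expr2; under eq_fun do rewrite expr2; exact: cvgM. Qed.

Section sigmoid.
Context {R : realType}.
Implicit Types (a tr t : R).

Lemma Sig_bound a tr t : 0 <= Sig a tr t <= 1.
Proof.
have e0 := expR_gt0 (- a * (t - tr)).
by rewrite /Sig divr_ge0 ?addr_ge0 ?(ltW e0)//= ler_pdivrMr ?mul1r ?lerDl ?ltW// addr_gt0.
Qed.

Lemma continuous_Sig a tr : continuous (Sig a tr).
Proof.
move=> t; rewrite /Sig; apply: cvgM; first exact: cvg_cst.
apply: cvgV; first by rewrite gt_eqF// addr_gt0// expR_gt0.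
apply: cvgD; first exact: cvg_cst.
apply: (@continuous_comp _ _ _ (fun t => - a * (t - tr)) expR); last exact: continuous_expR.
by apply: cvgMr; apply: cvgB; [exact: cvg_id|exact: cvg_cst].
Qed.

End sigmoid.

(** * The fidelity term *)

Section fidelity.
Context {R : realType}.
Local Notation plane := (measurableTypeR R * measurableTypeR R)%type.
Local Notation mu := (lebesgue2 R).
Variables (Omega : set (R * R)) (a tr : R).
Hypothesis fO : finite_mset mu Omega.
Implicit Types (H : R * R -> R[i]) (f g : plane -> R).

Lemma normc_sq (z : R[i]) : Normc.normc z ^+ 2 = complex.Re z ^+ 2 + complex.Im z ^+ 2.
Proof. by case: z => x y /=; rewrite sqr_sqrtr// addr_ge0 ?sqr_ge0. Qed.

Lemma square_integrable_complex H : complexMemLp Omega 2%:E H ->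
  square_integrable Omega (fun y => complex.Re (H y)) /\
  square_integrable Omega (fun y => complex.Im (H y)).
Proof.
move=> [mre mim Hfin].
have mre' : measurable_fun (Omega : set plane) (fun y : plane => complex.Re (H y)) by exact: mre.
have mim' : measurable_fun (Omega : set plane) (fun y : plane => complex.Im (H y)) by exact: mim.
have Hsq : (\int[mu]_(x in Omega) (Normc.normc (H x) ^+ 2)%:E < +oo)%E.
  rewrite -LpNorm2E expe2; move: Hfin; rewrite /complexLpNorm.
  have : (0 <= LpNorm Omega 2%:E (fun x => Normc.normc (H x)))%E by exact: Lnorm_ge0.
  by case: LpNorm => [r| |]//= _ _; rewrite -EFinM ltry.
have mo := fO.1.
have msq : measurable_fun (Omega : set plane) (fun x => (Normc.normc (H x) ^+ 2)%:E).
  apply/measurable_EFinP; under eq_fun do rewrite normc_sq.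
  by apply: measurable_funD; apply: measurable_funX.
split; split=> //; apply: le_lt_trans Hsq; apply: ge0_le_integral => //.
- by move=> y _; rewrite lee_fin sqr_ge0.
- exact/measurable_EFinP/measurable_funX.
- by move=> y _; rewrite lee_fin normc_sq lerDl sqr_ge0.
- by move=> y _; rewrite lee_fin sqr_ge0.
- exact/measurable_EFinP/measurable_funX.
- by move=> y _; rewrite lee_fin normc_sq lerDr sqr_ge0.
Qed.

Lemma complexLpNorm_cvg (H_ : nat -> R * R -> R[i]) H :
  complexMemLp Omega 2%:E H -> (forall n, complexMemLp Omega 2%:E (H_ n)) ->
  complexLpNorm Omega 2%:E (fun x => H_ n x - H x) @[n --> \oo] --> 0%E ->
  (\int[mu]_(y in Omega) ((complex.Re (H_ n y) - complex.Re (H y)) ^+ 2)%:E)%E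
    @[n --> \oo] --> 0%E /\
  (\int[mu]_(y in Omega) ((complex.Im (H_ n y) - complex.Im (H y)) ^+ 2)%:E)%E
    @[n --> \oo] --> 0%E.
Proof.
move=> mH mH_ Hcvg; have mo := fO.1.
have [[mre _] [mim _]] := square_integrable_complex mH.
have mre_ n : measurable_fun (Omega : set plane) (fun y => complex.Re (H_ n y)).
  by have [[]] := square_integrable_complex (mH_ n).
have mim_ n : measurable_fun (Omega : set plane) (fun y => complex.Im (H_ n y)).
  by have [_ []] := square_integrable_complex (mH_ n).
have sqcvg : (\int[mu]_(y in Omega) ((complex.Re (H_ n y) - complex.Re (H y)) ^+ 2 +
    (complex.Im (H_ n y) - complex.Im (H y)) ^+ 2)%:E)%E @[n --> \oo] --> 0%E.
  have : (complexLpNorm Omega 2%:E (fun x => (H_ n x - H x)%R) ^+ 2)%E @[n --> \oo] --> 0%E.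
    have -> : 0%E = (0 * 0)%E :> \bar R by rewrite mule0.
    by under eq_fun do rewrite expe2; apply: cvgeM.
  under eq_fun do rewrite /complexLpNorm LpNorm2E.
  apply: cvg_trans; apply: near_eq_cvg; apply: nearW => n.
  apply: eq_integral => y _; rewrite normc_sq.
  by case: (H_ n y) => ? ?; case: (H y) => ? ?.
have sq0 n y : (0 <= ((complex.Re (H_ n y) - complex.Re (H y)) ^+ 2 +
    (complex.Im (H_ n y) - complex.Im (H y)) ^+ 2)%:E)%E.
  by rewrite lee_fin addr_ge0 ?sqr_ge0.
split; apply: (squeeze_cvge _ (cvg_cst _) sqcvg); apply: nearW => n; apply/andP; split.
- by apply: integral_ge0 => y _; rewrite lee_fin sqr_ge0.
- apply: ge0_le_integral => //.
  + by move=> y _; rewrite lee_fin sqr_ge0.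
  + by apply/measurable_EFinP/measurable_funX/measurable_funB.
  + by apply/measurable_EFinP/measurable_funD; apply/measurable_funX/measurable_funB.
  + by move=> y _; rewrite lee_fin lerDl sqr_ge0.
- by apply: integral_ge0 => y _; rewrite lee_fin sqr_ge0.
- apply: ge0_le_integral => //.
  + by move=> y _; rewrite lee_fin sqr_ge0.
  + by apply/measurable_EFinP/measurable_funX/measurable_funB.
  + by apply/measurable_EFinP/measurable_funD; apply/measurable_funX/measurable_funB.
  + by move=> y _; rewrite lee_fin lerDr sqr_ge0.
Qed.

Definition response H f (x : plane) : R :=
  Sig a tr (Normc.normc (convolution Omega H f x) ^+ 2).

Lemma phase_restrict f : phase Omega f -> (f \_ Omega : R * R -> R) = f.
Proof.
move=> [_ _ f0]; apply/funext => z; rewrite /patch; case: ifPn => //.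
by rewrite notin_setE => /f0 ->.
Qed.

Lemma responseE H f x : phase Omega f -> response H f x =
  Sig a tr (real_convolution Omega (fun y => complex.Re (H y)) f x ^+ 2 +
            real_convolution Omega (fun y => complex.Im (H y)) f x ^+ 2).
Proof.
by move=> pf; rewrite /response normc_sq /convolution /= phase_restrict.
Qed.

Lemma bounded_response H f : complexMemLp Omega 2%:E H -> phase Omega f ->
  bounded_mfun (response H f).
Proof.
move=> mH pf; have [sre sim] := square_integrable_complex mH.
apply: unit_bounded_mfun; last by move=> z; exact: Sig_bound.
rewrite (_ : response H f = Sig a tr \o (fun x =>
  real_convolution Omega (fun y => complex.Re (H y)) f x ^+ 2 +
  real_convolution Omega (fun y => complex.Im (H y)) f x ^+ 2)); last first.
  by apply/funext => x; rewrite responseE.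
have mS : measurable_fun [set: R] (Sig a tr).
  by apply: continuous_measurable_fun; exact: continuous_Sig.
apply: (measurableT_comp mS).
by apply: measurable_funD; apply: measurable_funX; exact: measurable_real_convolution.
Qed.

Lemma response_cvg (H_ : nat -> R * R -> R[i]) H (f_ : nat -> plane -> R) f x :
  complexMemLp Omega 2%:E H -> (forall n, complexMemLp Omega 2%:E (H_ n)) ->
  complexLpNorm Omega 2%:E (fun x => H_ n x - H x) @[n --> \oo] --> 0%E ->
  phase Omega f -> (forall n, phase Omega (f_ n)) ->
  (\int[mu]_(y in Omega) `|f_ n y - f y|%:E)%E @[n --> \oo] --> 0%E ->
  response (H_ n) (f_ n) x @[n --> \oo] --> response H f x.
Proof.
move=> mH mH_ Hcvg pf pf_ fcvg.
have [c1 c2] := complexLpNorm_cvg mH mH_ Hcvg.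
have [sre sim] := square_integrable_complex mH.
have sre_ n := (square_integrable_complex (mH_ n)).1.
have sim_ n := (square_integrable_complex (mH_ n)).2.
rewrite responseE//; under eq_fun do rewrite responseE//.
have r1 := real_convolution_cvg fO (x := x) sre sre_ pf pf_ c1 fcvg.
have r2 := real_convolution_cvg fO (x := x) sim sim_ pf pf_ c2 fcvg.
apply: continuous_cvg; first exact: continuous_Sig.
by apply: cvgD; apply: cvg_sqr.
Qed.

Lemma fidelity_cvg (I' : plane -> R) (H_ : nat -> R * R -> R[i]) H
    (f_ : nat -> plane -> R) f : bounded_mfun I' ->
  complexMemLp Omega 2%:E H -> (forall n, complexMemLp Omega 2%:E (H_ n)) ->
  complexLpNorm Omega 2%:E (fun x => H_ n x - H x) @[n --> \oo] --> 0%E ->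
  phase Omega f -> (forall n, phase Omega (f_ n)) ->
  (\int[mu]_(y in Omega) `|f_ n y - f y|%:E)%E @[n --> \oo] --> 0%E ->
  \int[mu]_(x in Omega) (response (H_ n) (f_ n) x - I' x) ^+ 2 @[n --> \oo] -->
  \int[mu]_(x in Omega) (response H f x - I' x) ^+ 2.
Proof.
move=> bI mH mH_ Hcvg pf pf_ fcvg; have [_ [M IM]] := bI.
(* The response lies in [0, 1] and [I'] is bounded by [M]. *)
apply: (@bounded_convergence _ _ _ _ _ _ _ ((1 + M) ^+ 2)) => //.
- by move=> n; apply/measurable_funX; exact: (bounded_mfunB (bounded_response (mH_ n) (pf_ n)) bI).1.
- by apply/measurable_funX; exact: (bounded_mfunB (bounded_response mH pf) bI).1.
- move=> n x; rewrite normrX !expr2; apply: ler_pM => //;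
    (apply: le_trans (ler_normB _ _) _; apply: lerD; last exact: IM);
    by have /andP[s0 s1] := Sig_bound a tr (Normc.normc (convolution Omega (H_ n) (f_ n) x) ^+ 2);
       rewrite /response ger0_norm.
- apply: aeW => x _.
  have rc := response_cvg (x := x) mH mH_ Hcvg pf pf_ fcvg.
  apply: (@cvg_sqr _ (fun n => response (H_ n) (f_ n) x - I' x)).
  by apply: cvgB; [exact: rc|exact: cvg_cst].
Qed.

End fidelity.

(** * The energy *)

Section truncation.
Context {R : realType}.
Local Notation plane := (measurableTypeR R * measurableTypeR R)%type.
Local Notation mu := (lebesgue2 R).
Variables (Omega : set (R * R)).
Hypothesis fO : finite_mset mu Omega.
Implicit Types (U V : plane -> R) (H : R * R -> R[i]).

Let mO : measurable (Omega : set plane) := fO.1.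

Definition clamp (l u x : R) : R := Num.max l (Num.min u x).

Lemma clamp_bound l u x : l <= u -> l <= clamp l u x <= u.
Proof. by move=> lu; rewrite /clamp le_max lexx ge_max lu ge_min lexx. Qed.

Lemma clamp_id l u x : l <= x <= u -> clamp l u x = x.
Proof. by move=> /andP[lx xu]; rewrite /clamp min_r// max_r. Qed.

(** General bounds allow one construction to serve both the phases, with range [0, 1], and the data
    [I], with a symmetric range. *)
Definition truncation (l u : R) U : plane -> R :=
  (fun z => clamp l u (U z)) \_ (Omega : set plane).

Lemma measurable_truncation l u U : measurable_fun (Omega : set plane) U ->
  measurable_fun setT (truncation l u U).
Proof.
move=> mU; apply/(measurable_restrictT _ mO).
apply: measurable_maxr; first exact: measurable_cst.
by apply: measurable_minr => //; exact: measurable_cst.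
Qed.

Lemma truncationE l u U z : Omega z -> truncation l u U z = clamp l u (U z).
Proof. by move=> Oz; rewrite /truncation /patch mem_set. Qed.

Lemma truncation_out l u U z : ~ Omega z -> truncation l u U z = 0.
Proof. by move=> Oz; rewrite /truncation /patch memNset. Qed.

Lemma phase_truncation U : measurable_fun (Omega : set plane) U ->
  phase Omega (truncation 0 1 U).
Proof.
move=> mU; split; first exact: measurable_truncation.
- move=> z; have [Oz|nOz] := pselect (Omega z).
    by rewrite truncationE// clamp_bound.
  by rewrite truncation_out// lexx ler01.
- by move=> z; exact: truncation_out.
Qed.

Lemma essentially_bounded_representative (I : R * R -> R) : memLp Omega +oo%E I ->
  exists2 I' : plane -> R, bounded_mfun I' &
    {ae mu, forall x : plane, Omega x -> I x = I' x}.
Proof.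
move=> [mI Ifin].
have mI' : measurable_fun (Omega : set plane) (I : plane -> R) by exact: mI.
(* The norm of exponent [+oo] is the essential supremum only on a space of positive measure. *)
have muT : (0 < mu [set: plane])%E.
  apply: (@lt_le_trans _ _ (mu (rect 0 1 0 1))).
    by rewrite lebesgue2_rect// subr0 mulr1 lte_fin.
  by apply: le_measure; rewrite ?inE//; exact: measurable_rect.
have [C aeC] : exists C : R, {ae mu, forall x : plane, Omega x -> `|I x| <= C}.
  move: Ifin; rewrite /LpNorm unlock muT => sfin.
  have := ess_sup_ge mu (abse \o (EFin \o (I \_ Omega))).
  case: (ess_sup _ _) sfin => [r _| //|_] hae.
  - exists r; apply: filterS hae => x /=; rewrite /patch => + Ox.
    by rewrite mem_set//= lee_fin.
  - exists 0; apply: filterS hae => x /= + _.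
    by rewrite leeNy_eq.
pose C' := Num.max C 0.
exists (truncation (- C') C' I).
  split; first exact: measurable_truncation.
  exists C' => z; have C'0 : 0 <= C' by rewrite le_max lexx orbT.
  have [Oz|nOz] := pselect (Omega z).
    by rewrite truncationE// ler_norml clamp_bound// ge0_cp.
  by rewrite truncation_out// normr0.
apply: filterS aeC => x Ix Ox; rewrite truncationE// clamp_id// -ler_norml.
by rewrite le_max Ix.
Qed.

Lemma ae_truncation U : K Omega U ->
  {ae mu, forall x : plane, Omega x -> U x = truncation 0 1 U x}.
Proof.
move=> [_ ae01].
have {}ae01 : {ae mu, forall x : plane, Omega x -> 0 <= U x <= 1} by exact: ae01.
apply: filterS ae01 => x h Ox.
by rewrite truncationE// clamp_id//; exact: h.
Qed.

Lemma measurable_K U : K Omega U -> measurable_fun (Omega : set plane) U.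
Proof. by move=> [[[mU _] _] _]; exact: mU. Qed.

Lemma LpNorm1_ae (f g : plane -> R) : measurable_fun (Omega : set plane) f ->
  measurable_fun (Omega : set plane) g ->
  {ae mu, forall x : plane, Omega x -> f x = g x} ->
  LpNorm Omega 1 f = LpNorm Omega 1 g.
Proof.
move=> mf mg fg; rewrite !LpNorm1E; apply: ae_eq_integral => //.
- by apply/measurable_EFinP/measurableT_comp.
- by apply/measurable_EFinP/measurableT_comp.
- by apply: filterS fg => x fgx Ox; rewrite fgx.
Qed.

Lemma LpNorm2_ae (f g : plane -> R) : measurable_fun (Omega : set plane) f ->
  measurable_fun (Omega : set plane) g ->
  {ae mu, forall x : plane, Omega x -> f x = g x} ->
  (LpNorm Omega 2%:E f ^+ 2 = LpNorm Omega 2%:E g ^+ 2)%E.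
Proof.
move=> mf mg fg; rewrite !LpNorm2E; apply: ae_eq_integral => //.
- exact/measurable_EFinP/measurable_funX.
- exact/measurable_EFinP/measurable_funX.
- by apply: filterS fg => x fgx Ox; rewrite fgx.
Qed.

Lemma TV_ae U V : measurable_fun (Omega : set plane) U ->
  measurable_fun (Omega : set plane) V ->
  {ae mu, forall x : plane, Omega x -> U x = V x} -> TV Omega U = TV Omega V.
Proof.
move=> mU mV UV; congr ereal_sup.
have E phi : test_field Omega phi ->
    (\int[mu]_(x in Omega) (U x * divergence phi x)%:E =
     \int[mu]_(x in Omega) (V x * divergence phi x)%:E)%E.
  move=> tphi; have [md _] := bounded_divergence tphi.
  apply: ae_eq_integral => //.
  - by apply/measurable_EFinP/measurable_funM => //; exact: measurable_funTS.
  - by apply/measurable_EFinP/measurable_funM => //; exact: measurable_funTS.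
  - by apply: filterS UV => x UVx Ox; rewrite UVx.
by apply/seteqP; split=> _ [phi tphi <-]; exists phi => //; rewrite E.
Qed.

(** The exceptional set stays null after reflection about any [x], so the convolutions agree at
    every point and not merely almost everywhere. *)
Lemma convolution_ae U V H : complexMemLp Omega 2%:E H ->
  measurable_fun (Omega : set plane) U -> measurable_fun (Omega : set plane) V ->
  {ae mu, forall x : plane, Omega x -> U x = V x} ->
  convolution Omega H U = convolution Omega H V.
Proof.
move=> mH mU mV [N [mN N0 UVN]]; apply/funext => x.
have mpatch (W : plane -> R) : measurable_fun (Omega : set plane) W ->
    measurable_fun setT (fun y : plane => (W \_ (Omega : set plane)) (x.1 - y.1, x.2 - y.2)).
  move=> mW; have mW' : measurable_fun setT (W \_ (Omega : set plane)).
    by apply/(measurable_restrictT _ mO).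
  exact: (measurableT_comp mW' (measurable_reflect2 x)).
have E (h : plane -> R) : measurable_fun (Omega : set plane) h ->
    \int[mu]_(y in Omega) (h y * (U \_ Omega) (x - y)) =
    \int[mu]_(y in Omega) (h y * (V \_ Omega) (x - y)).
  move=> mh; rewrite /Rintegral; congr fine; apply: ae_eq_integral => //.
  - apply/measurable_EFinP/measurable_funM => //; apply: measurable_funTS; exact: mpatch.
  - apply/measurable_EFinP/measurable_funM => //; apply: measurable_funTS; exact: mpatch.
  exists ((fun y : plane => (x.1 - y.1, x.2 - y.2)) @^-1` N); split.
  - by rewrite -[X in measurable X]setTI; exact: measurable_reflect2.
  - by rewrite lebesgue2_reflect.
  - move=> y /= /not_implyP[Oy neq]; apply: UVN => /= UVx; apply: neq.
    congr (_ * _)%:E; rewrite /patch; case: ifPn => // /set_mem Oxy; exact: UVx.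
have [[mre _] [mim _]] := square_integrable_complex fO mH.
by rewrite /convolution (E _ mre) (E _ mim).
Qed.

Lemma energy_ae a tr beta1 beta2 I U V H : complexMemLp Omega 2%:E H ->
  measurable_fun (Omega : set plane) U -> measurable_fun (Omega : set plane) V ->
  {ae mu, forall x : plane, Omega x -> U x = V x} ->
  energy Omega a tr beta1 beta2 I U H = energy Omega a tr beta1 beta2 I V H.
Proof.
move=> mH mU mV UV; rewrite /energy (convolution_ae mH mU mV UV) (TV_ae mU mV UV).
congr (_ + _ * _)%E; apply: LpNorm1_ae.
- by apply: measurable_funM => //; apply: measurable_funB => //; exact: measurable_cst.
- by apply: measurable_funM => //; apply: measurable_funB => //; exact: measurable_cst.
- by apply: filterS UV => x UVx Ox; rewrite UVx.
Qed.

Definition fidelity a tr (I' : plane -> R) H (f : plane -> R) : R :=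
  \int[mu]_(x in Omega) (response Omega a tr H f x - I' x) ^+ 2.

Definition potential (f : plane -> R) : R :=
  \int[mu]_(x in Omega) `|f x * (1 - f x)|.

Lemma bounded_phase f : phase Omega f -> bounded_mfun f.
Proof. by move=> [mf f01 _]; exact: unit_bounded_mfun. Qed.

(** On phases of finite variation the energy is a real number, which permits the subtractions made
    with minimality. *)
Lemma energyE a tr beta1 beta2 I I' f H : complexMemLp Omega 2%:E H ->
  phase Omega f -> (TV Omega f < +oo)%E -> measurable_fun (Omega : set plane) I ->
  bounded_mfun I' -> {ae mu, forall x : plane, Omega x -> I x = I' x} ->
  energy Omega a tr beta1 beta2 I f H =
  (fidelity a tr I' H f + beta1 * fine (TV Omega f) + beta2 * potential f)%:E.
Proof.
move=> mH pf Tfin mI bI II'; rewrite /energy.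
have br := bounded_response a tr fO mH pf.
have bf := bounded_phase pf.
have Tn : TV Omega f \is a fin_num by rewrite ge0_fin_numE// TV_ge0.
rewrite (@LpNorm2_ae _ (fun x => response Omega a tr H f x - I' x)); last 3 first.
- by apply: measurable_funB => //; apply: measurable_funTS; exact: br.1.
- by apply: measurable_funTS; exact: (bounded_mfunB br bI).1.
- by apply: filterS II' => x IIx Ox; rewrite /response IIx.
rewrite LpNorm2E LpNorm1E EFin_Rint//; last first.
  by under eq_fun do rewrite expr2; apply: bounded_mfunM; exact: bounded_mfunB.
rewrite EFin_Rint//; last first.
  by apply: bounded_mfun_norm; apply: bounded_mfunM => //; exact: bounded_mfunB.
by rewrite -{1}(fineK Tn) !EFinD !EFinM.
Qed.

Lemma K_phase f : phase Omega f -> (TV Omega f < +oo)%E -> K Omega f.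
Proof.
move=> pf Tfin; have [mf f01 f0] := pf; have bf := bounded_phase pf; split.
  split=> //; split; first by apply: (measurable_funTS mf).
  by rewrite LpNorm1E EFin_Rint ?ltry//; exact: bounded_mfun_norm.
by apply: aeW => x _.
Qed.

End truncation.

(** * Behaviour of the regularizing terms under L^1 convergence *)

Section lower_semicontinuity.
Context {R : realType}.
Local Notation plane := (measurableTypeR R * measurableTypeR R)%type.
Local Notation mu := (lebesgue2 R).
Variables (Omega : set (R * R)).
Hypothesis fO : finite_mset mu Omega.

Lemma Rint_cvg_of_L1 (M : R) (g_ : nat -> plane -> R) (g : plane -> R)
    (u_ : nat -> plane -> R) (u : plane -> R) :
  (forall n, bounded_mfun (g_ n)) -> bounded_mfun g ->
  (forall n, bounded_mfun (u_ n)) -> bounded_mfun u ->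
  (forall n z, `|u_ n z - u z| <= M * `|g_ n z - g z|) ->
  \int[mu]_(z in Omega) `|g_ n z - g z| @[n --> \oo] --> 0 ->
  \int[mu]_(z in Omega) u_ n z @[n --> \oo] --> \int[mu]_(z in Omega) u z.
Proof.
move=> bg_ bg bu_ bu ugM gcvg; apply/cvgrPdist_le => eps eps0.
have Mcvg : M * \int[mu]_(z in Omega) `|g_ n z - g z| @[n --> \oo] --> (0 : R).
  by rewrite -(mulr0 M); apply: cvgMr.
move/cvgrPdist_le : Mcvg => /(_ _ eps0); apply: filterS => n.
rewrite sub0r normrN distrC -RintB// => nle.
apply: le_trans (ler_norm_Rint fO _) _; first exact: bounded_mfunB.
apply: le_trans (le_trans (ler_norm _) nle).
have bgn : bounded_mfun (fun z => `|g_ n z - g z|) by exact/bounded_mfun_norm/bounded_mfunB.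
rewrite -RintZ//; apply: ler_Rint => //.
- exact/bounded_mfun_norm/bounded_mfunB.
- exact: bounded_mfunZ.
Qed.

(** The pairing with a fixed field is L^1-continuous, and the supremum is taken only after the
    limit. A convergent majorant [t_] is the form in which minimality supplies the bound; a constant
    one yields finiteness. *)
Lemma TV_lower_semicontinuous (g_ : nat -> plane -> R) (g : plane -> R)
    (t_ : nat -> R) (t : R) :
  (forall n, bounded_mfun (g_ n)) -> bounded_mfun g ->
  \int[mu]_(z in Omega) `|g_ n z - g z| @[n --> \oo] --> 0 ->
  (forall n, (TV Omega (g_ n) <= (t_ n)%:E)%E) -> t_ n @[n --> \oo] --> t ->
  (TV Omega g <= t%:E)%E.
Proof.
move=> bg_ bg gcvg TVt tcvg; apply: TV_le => // phi tphi.
have bd := bounded_divergence tphi; have [_ [M dM]] := bd.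
have lim := @Rint_cvg_of_L1 M g_ g (fun n z => g_ n z * divergence phi z)
  (fun z => g z * divergence phi z) bg_ bg (fun n => bounded_mfunM (bg_ n) bd)
  (bounded_mfunM bg bd) _ gcvg.
apply: (ler_cvg_to (lim _) tcvg).
  by move=> n z; rewrite -mulrBl normrM mulrC ler_wpM2r.
apply: nearW => n; rewrite -lee_fin; apply: le_trans (TVt n).
exact: TV_ge.
Qed.

Lemma potential_cvg (g_ : nat -> plane -> R) (g : plane -> R) :
  (forall n, phase Omega (g_ n)) -> phase Omega g ->
  \int[mu]_(z in Omega) `|g_ n z - g z| @[n --> \oo] --> 0 ->
  potential Omega (g_ n) @[n --> \oo] --> potential Omega g.
Proof.
move=> pg_ pg gcvg.
have bpot f : phase Omega f -> bounded_mfun (fun z => `|f z * (1 - f z)|).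
  move=> pf; apply: bounded_mfun_norm; apply: bounded_mfunM; first exact: bounded_phase pf.
  by apply: bounded_mfunB => //; exact: bounded_phase pf.
apply: (@Rint_cvg_of_L1 1 g_ g) => //.
- by move=> n; exact: bounded_phase (pg_ n).
- exact: bounded_phase pg.
- by move=> n; exact: bpot.
- exact: bpot.
move=> n z; rewrite mul1r; have [_ h _] := pg_ n; have [_ h' _] := pg.
have /andP[a0 a1] := h z; have /andP[b0 b1] := h' z.
rewrite (@ger0_norm _ (g_ n z * _)) ?mulr_ge0 ?subr_ge0//.
rewrite (@ger0_norm _ (g z * _)) ?mulr_ge0 ?subr_ge0//.
(* The second factor has absolute value at most 1, so [s (1 - s)] is 1-Lipschitz on [0, 1]. *)
have -> : g_ n z * (1 - g_ n z) - g z * (1 - g z) =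
  (g_ n z - g z) * (1 - g_ n z - g z) by ring.
rewrite normrM ler_piMr// ler_norml; apply/andP; split; lra.
Qed.

End lower_semicontinuity.

Lemma bounded_set_finite_mset (R : realType) (Omega : set (R * R)) :
  open Omega -> bounded_set Omega -> finite_mset (lebesgue2 R) Omega.
Proof.
move=> oO [M [_ bO]]; have h := bO (`|M| + 1).
(* One unit because the bound holds strictly above [M], another because the square is half-open. *)
have N0 : - (`|M| + 2) <= `|M| + 2 by have := normr_ge0 M; lra.
apply: finite_mset_sub (finite_mset_rect N0 N0).
  exact: measurable_open_plane.
move=> x Ox; have /= xM : `|x| <= `|M| + 1.
  by apply: h Ox; rewrite (le_lt_trans (ler_norm M))// ltrDl.
have x1 : `|x.1| <= `|M| + 1 by apply: le_trans xM; rewrite /Num.norm /= le_max lexx.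
have x2 : `|x.2| <= `|M| + 1 by apply: le_trans xM; rewrite /Num.norm /= le_max lexx orbT.
move: x1 x2; rewrite !ler_norml => /andP[? ?] /andP[? ?].
by apply/rectE; apply/andP; split; apply/andP; split; lra.
Qed.

Theorem theorem2p1 (R : realType) (Omega : set (R * R))
  (a tr beta1 beta2 : R) (I : R * R -> R)
  (H : R * R -> R[i]) (H_ : nat -> R * R -> R[i]) (U_ : nat -> R * R -> R)
  (hOmega : bounded_lipschitz_domain Omega)
  (ha : 0 < a) (hbeta1 : 0 < beta1) (hbeta2 : 0 < beta2)
  (hI : memLp Omega +oo%E I)
  (hH : complexMemLp Omega 2%:E H)
  (hH_ : forall n, complexMemLp Omega 2%:E (H_ n))
  (hcvg : complexLpNorm Omega 2%:E (fun x => H_ n x - H x)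
            @[n --> \oo] --> 0%E)
  (hU_ : forall n, is_minimizer (K Omega)
     (fun U => energy Omega a tr beta1 beta2 I U (H_ n)) (U_ n)) :
  exists (k : nat -> nat) (U : R * R -> R),
    [/\ increasing_seq k,
        LpNorm Omega 1%E (fun x => U_ (k n) x - U x) @[n --> \oo] --> 0%E &
        is_minimizer (K Omega)
          (fun V => energy Omega a tr beta1 beta2 I V H) U].
Proof.
have [oO _ _ bO _] := hOmega.
have fO := bounded_set_finite_mset oO bO.
have [I' bI II'] := essentially_bounded_representative fO hI.
pose mu := lebesgue2 R.
have mI : measurable_fun (Omega : set (measurableTypeR R * measurableTypeR R)) I by exact: hI.1.
(* From here on each minimizer is handled through its representative, which has the same energy. *)
pose f n := truncation Omega 0 1 (U_ n).
have mU n := measurable_K (hU_ n).1.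
have pf n : phase Omega (f n) by exact: phase_truncation (mU n).
have aef n := ae_truncation (hU_ n).1.
have Tf n : (TV Omega (f n) < +oo)%E.
  rewrite -(TV_ae fO (mU n) (measurable_funTS (measurable_truncation fO 0 1 (mU n))) (aef n)).
  by have [[_ ?] _] := (hU_ n).1.
pose E G g := fidelity Omega a tr I' G g + beta1 * fine (TV Omega g) +
  beta2 * potential Omega g.
have EE G g : complexMemLp Omega 2%:E G -> phase Omega g -> (TV Omega g < +oo)%E ->
    energy Omega a tr beta1 beta2 I g G = (E G g)%:E.
  by move=> mG pg Tg; exact: energyE mG pg Tg mI bI II'.
have minE n g : phase Omega g -> (TV Omega g < +oo)%E -> E (H_ n) (f n) <= E (H_ n) g.
  move=> pg Tg; rewrite -lee_fin -!EE//.
  rewrite -(energy_ae fO a tr beta1 beta2 I (hH_ n) (mU n)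
    (measurable_funTS (measurable_truncation fO 0 1 (mU n))) (aef n)).
  by have [_ h] := hU_ n; apply: h; exact: K_phase.
have p0 : phase Omega (fun=> 0) by split=> // z; rewrite lexx ler01.
have TV0 : TV Omega (fun=> 0) = 0%E.
  apply/eqP; rewrite eq_le TV_ge0// andbT; apply: TV_le => // phi _.
  by under eq_Rintegral do rewrite mul0r; rewrite Rint_cst// mul0r.
have fid0 G g : 0 <= fidelity Omega a tr I' G g.
  by apply: Rint_ge0 => z; exact: sqr_ge0.
have pot0 g : 0 <= potential Omega g by apply: Rint_ge0.
(* The energy of the zero function: its convolution with any kernel is 0, so this bound is the same
   for all [n]. *)
pose C0 := \int[mu]_(x in Omega) (Sig a tr 0 - I' x) ^+ 2.
have E0 G : E G (fun=> 0) = C0.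
  have c0 (h : measurableTypeR R * measurableTypeR R -> R) x :
      real_convolution Omega h (fun=> 0) x = 0.
    by rewrite /real_convolution; under eq_Rintegral do rewrite mulr0;
       rewrite Rint_cst// mul0r.
  rewrite /E TV0 /= mulr0 addr0 /potential.
  under [X in _ + beta2 * X]eq_Rintegral do rewrite mul0r normr0.
  rewrite Rint_cst// mul0r mulr0 addr0; apply: eq_Rintegral => x _.
  by rewrite responseE// !c0 expr0n addr0.
have TfM n : (TV Omega (f n) <= (C0 / beta1)%:E)%E.
  have Tn : TV Omega (f n) \is a fin_num.
    by rewrite ge0_fin_numE// TV_ge0//; exact: bounded_phase (pf n).
  have T0 : (TV Omega (fun=> 0%R) < +oo)%E by rewrite TV0.
  have := minE n _ p0 T0; rewrite E0 /E => h.
  rewrite -(fineK Tn) lee_fin ler_pdivlMr// mulrC.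
  apply: le_trans h; rewrite -addrA ler_wpDl// lerDl mulr_ge0//; exact: ltW.
have [k kinc kfast] := fast_cauchy_subsequence oO fO (fun n => let: And3 m _ _ := pf n in m)
  (fun n => let: And3 _ m _ := pf n in m) TfM.
have [U0 [mU0 U01 U0le]] := L1_limit fO (fun n => let: And3 m _ _ := pf (k n) in m)
  (fun n => let: And3 _ m _ := pf (k n) in m) kfast.
(* [U0] is controlled on [Omega] only; truncation also sets it to 0 elsewhere. *)
pose U := truncation Omega 0 1 U0.
have pU : phase Omega U by apply: phase_truncation => //; exact: measurable_funTS.
have bU := bounded_phase pU.
have bf n := bounded_phase (pf n).
have fU n : \int[mu]_(z in Omega) `|f (k n) z - U z| =
    \int[mu]_(z in Omega) `|f (k n) z - U0 z|.
  by apply: eq_Rintegral => z /[!inE] Oz; rewrite /U truncationE// clamp_id.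
have fcvg : \int[mu]_(z in Omega) `|f (k n) z - U z| @[n --> \oo] --> (0 : R).
  apply: (@squeeze_cvgr _ _ _ _ (cst 0) (fun n => 2 * 2^-1 ^+ n)).
  - by apply: nearW => n; rewrite Rint_ge0//= fU.
  - exact: cvg_cst.
  - rewrite -(mulr0 2); apply: cvgMr.
    by apply: cvg_expr; rewrite ger0_norm// invf_lt1// ltr1n.
have fcvgE : (\int[mu]_(z in Omega) `|f (k n) z - U z|%:E)%E @[n --> \oo] --> 0%E.
  have bfU n : bounded_mfun (fun z => `|f (k n) z - U z|).
    by apply: bounded_mfun_norm; exact: bounded_mfunB.
  under eq_fun do rewrite EFin_Rint//.
  by apply: cvg_EFin; [exact: nearW|exact: fcvg].
have nk n : (n <= k n)%N.
  elim: n => // n IH; apply: leq_ltn_trans IH _.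
  by move/increasing_seqP : kinc; exact.
have kcvg : k n @[n --> \oo] --> \oo.
  by move=> A [N _ NA]; exists N => // n /= Nn; apply: NA; exact: leq_trans Nn (nk n).
have Hk : complexLpNorm Omega 2%:E (fun x => H_ (k n) x - H x) @[n --> \oo] --> 0%E.
  exact: (cvg_comp k _ kcvg hcvg).
have fidU := fidelity_cvg (a := a) (tr := tr) fO bI hH (fun n => hH_ (k n)) Hk pU
  (fun n => pf (k n)) fcvgE.
have potU := potential_cvg fO (fun n => pf (k n)) pU fcvg.
(* Finiteness comes first, with a constant majorant, so that the energy of [U] can be written as a
   real number. *)
have TU : (TV Omega U < +oo)%E.
  apply: le_lt_trans (ltry (C0 / beta1)).
  exact: (TV_lower_semicontinuous fO (fun n => bf (k n)) bU fcvg
    (fun n => TfM (k n)) (cvg_cst _)).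
have LE n : LpNorm Omega 1%E (fun x => U_ (k n) x - U x) =
    (\int[mu]_(z in Omega) `|f (k n) z - U z|%:E)%E.
  rewrite -LpNorm1E; apply: (LpNorm1_ae fO).
  - by apply: measurable_funB => //; apply: measurable_funTS; exact: bU.1.
  - by apply: measurable_funTS; exact: (bounded_mfunB (bf (k n)) bU).1.
  - by apply: filterS (aef (k n)) => x xU Ox; rewrite xU.
exists k, U; split=> //; first by under eq_fun do rewrite LE.
split; first exact: K_phase.
move=> V KV; have mV := measurable_K KV; have aeV := ae_truncation KV.
pose v := truncation Omega 0 1 V.
have mv : measurable_fun setT v by exact: measurable_truncation.
have pv : phase Omega v by exact: phase_truncation.
have Tv : (TV Omega v < +oo)%E.
  by rewrite -(TV_ae fO mV (measurable_funTS mv) aeV); have [[_ ?] _] := KV.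
rewrite (energy_ae fO a tr beta1 beta2 I hH mV (measurable_funTS mv) aeV) !EE// lee_fin.
(* For the competitor [v] the phase is constant in [n]; only the kernel varies. *)
have vcvgE : (\int[mu]_(z in Omega) `|v z - v z|%:E)%E @[n --> \oo] --> 0%E.
  under eq_integral do rewrite subrr normr0.
  by rewrite integral0; exact: cvg_cst.
have fidv := fidelity_cvg (a := a) (tr := tr) fO bI hH (fun n => hH_ (k n)) Hk pv
  (fun=> pv) vcvgE.
(* Minimality against [v], solved for the variation of [f (k n)]. The other terms converge, so [t]
   converges, and lower semicontinuity is needed for the variation alone. *)
pose t n := (E (H_ (k n)) v - fidelity Omega a tr I' (H_ (k n)) (f (k n)) -
  beta2 * potential Omega (f (k n))) / beta1.
have tcvg : t n @[n --> \oo] -->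
    (E H v - fidelity Omega a tr I' H U - beta2 * potential Omega U) / beta1.
  apply: cvgMl; apply: cvgB; last exact: cvgMr.
  apply: cvgB; last exact: fidU.
  apply: cvgD; last exact: cvg_cst.
  by apply: cvgD; [exact: fidv|exact: cvg_cst].
have Tft n : (TV Omega (f (k n)) <= (t n)%:E)%E.
  have Tn : TV Omega (f (k n)) \is a fin_num.
    by rewrite ge0_fin_numE// TV_ge0//; exact: bf.
  rewrite -(fineK Tn) lee_fin /t ler_pdivlMr// mulrC lerBrDr lerBrDr.
  apply: le_trans (minE (k n) v pv Tv).
  by rewrite [leRHS]/E le_eqVlt; apply/orP; left; apply/eqP; ring.
(* Solving the limit inequality back for the energies gives the minimality of [U]. *)
have := TV_lower_semicontinuous fO (fun n => bf (k n)) bU fcvg Tft tcvg.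
have Un : TV Omega U \is a fin_num by rewrite ge0_fin_numE// TV_ge0.
rewrite -(fineK Un) lee_fin ler_pdivlMr// mulrC lerBrDr lerBrDr.
apply: le_trans; rewrite [leLHS]/E le_eqVlt; apply/orP; left; apply/eqP; ring.
Qed.
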